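(* For each $n\ge1$ let $\mathbf d=\mathbf d_n=(d_1,\dots,d_n)$, $d_i=d_i^{(n)}$, be a graphic sequence of nonnegative integers. Assume that, as $n\to\infty$, $\sum_{i=1}^n d_i=\Theta(n)$, $\sum_{i=1}^n d_i^2=O(n)$ and $\max_{1\le i\le n}d_i=o(n^{1/2})$. Suppose that $X_n=f_n\bigl(G(n,\mathbf d)\bigr)$ for some (real-valued) function $f_n$, which is defined more generally for labelled multigraphs, and let $X_n^*=f_n\bigl(G^*(n,\mathbf d)\bigr)$. Suppose also that $$f_n\bigl(\widehat G(n,\mathbf d)\bigr)-f_n\bigl(G^*(n,\mathbf d)\bigr)\to0\quad\text{in probability}.$$ If $Y$ is a random variable such that $X_n^*\to Y$ in distribution as $n\to\infty$, then also $X_n\to Y$ in distribution. Here $G(n,\mathbf d)$ is the uniformly random simple graph with degree sequence $\mathbf d$, $G^*(n,\mathbf d)$ is the configuration model multigraph, and $\widehat G(n,\mathbf d)$ is the switched configuration model constructed from $G^*(n,\mathbf d)$ (on the same probability space, with an arbitrary fixed rule for choosing which bad edge to switch).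
   Context: Graphic means that at least one simple graph on $[n]=\{1,\dots,n\}$ has degree sequence $\mathbf d$; in particular $N:=\sum_i d_i$ is even. $\Theta(n)$ means a quantity in $[cn,Cn]$ for some constants $c,C>0$ not depending on $n$. $G(n,\mathbf d)$ is a uniformly random element of the set of simple graphs with vertex set $[n]$ and degree sequence $\mathbf d$. Configuration model: assign $d_i$ half-edges $i_1,\dots,i_{d_i}$ to each vertex $i$, for a total of $N$ half-edges. A configuration is a perfect matching of the half-edges; it projects to a multigraph on $[n]$ by regarding each matched pair $\{i_\alpha,j_\beta\}$ as an edge between $i$ and $j$ (a loop if $i=j$). Let $\Gamma_0$ be a uniformly random configuration; $G^*(n,\mathbf d)$ is the multigraph it projects to. Switched configuration model: an edge (matched pair) of a configuration is bad if it is a loop or is parallel to another edge. Starting from the same $\Gamma_0$, as long as the current configuration has a bad edge, choose a bad edge $i_\alpha j_\beta$ by some fixed rule (e.g. the first in lexicographic order, or a random one), choose another edge $k_\gamma\ell_\delta$ uniformly at random among all other edges of the current configuration, order its two half-edges $k_\gamma,\ell_\delta$ uniformly at random, and replace the two edges $i_\alpha j_\beta$, $k_\gamma\ell_\delta$ by $i_\alpha\ell_\delta$, $k_\gamma j_\beta$ (a switching). Stop when there are no bad edges; $\widehat G(n,\mathbf d)$ is the simple graph that the final configuration projects to. If the process does not terminate, $\widehat G(n,\mathbf d)$ is obtained by restarting with a new random configuration. *)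

(* Defs.v *)
From HB Require Import structures.
From mathcomp Require Import all_boot all_order all_algebra.
From mathcomp Require Import all_classical all_reals all_analysis.
Import Order.TTheory GRing.Theory Num.Theory.
Import numFieldNormedType.Exports.

Set Implicit Arguments.
Unset Strict Implicit.
Unset Printing Implicit Defensive.

Local Open Scope ring_scope.

(* An edge slot is an unordered pair of vertices, a loop at i being {i}; a
   labelled multigraph (loops allowed) gives each slot its multiplicity. *)
Definition slot (n : nat) := {e : {set 'I_n} | (0 < #|e| <= 2)%N}.
Definition multigraph (n : nat) := {ffun slot n -> nat}.

(* Simple graphs on 'I_n, as edge sets, with degree sequence d. *)
Definition simple_graphs (n : nat) (d : 'I_n -> nat) : {set {set {set 'I_n}}} :=
  [set E : {set {set 'I_n}} | [forall e in E, #|e| == 2%N]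
     & [forall i, #|[set e in E | i \in e]| == d i]].

Definition graphic (n : nat) (d : 'I_n -> nat) : Prop :=
  exists E, E \in simple_graphs d.

Definition multigraph_of_graph (n : nat) (E : {set {set 'I_n}}) : multigraph n :=
  [ffun e => nat_of_bool (val e \in E)].

Section Configurations.
Variables (n : nat) (d : 'I_n -> nat).

(* The half-edge i_alpha is the pair of i : 'I_n and alpha : 'I_(d i). *)
Definition halfedge := {i : 'I_n & 'I_(d i)}.

Definition matching := {set {set halfedge}}.

Definition configurations : {set matching} :=
  [set M : matching | finset.partition M [set: halfedge]
     & [forall B in M, #|B| == 2%N]].

(* Two distinct vertices, or a single one if B is a loop. *)
Definition ends (B : {set halfedge}) : {set 'I_n} := [set tag x | x in B].

Definition projection (M : matching) : multigraph n :=
  [ffun e => #|[set B in M | ends B == val e]|].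

Definition bad_edges (M : matching) : {set {set halfedge}} :=
  [set B in M | (#|ends B| == 1%N)
     || [exists B' in M, (B' != B) && (ends B' == ends B)]].

Definition no_bad_edges (M : matching) : bool := bad_edges M == finset.set0.

(* With e = (i_alpha, j_beta) and o = (k_gamma, l_delta), the edges
   i_alpha j_beta, k_gamma l_delta become i_alpha l_delta, k_gamma j_beta. *)
Definition switching (M : matching) (e o : halfedge * halfedge) : matching :=
  (M :\: [set [set e.1; e.2]; [set o.1; o.2]]
     :|: [set [set e.1; o.2]; [set o.1; e.2]])%SET.

Variable R : realType.

(* A possibly randomised rule: [rule h M e] is the probability of switching the
   bad edge e of the current configuration M, h being the list of the earlier
   configurations.  The edge is written as an ordered pair; its orientation is
   immaterial, since that of the other edge is uniformly random. *)
Definition switching_rule :=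
  seq matching -> matching -> halfedge * halfedge -> R.

Definition is_switching_rule (rule : switching_rule) : Prop :=
  forall h M, M \in configurations -> ~~ no_bad_edges M ->
    [/\ forall e, 0 <= rule h M e,
        forall e, rule h M e != 0 -> [set e.1; e.2] \in bad_edges M
      & \sum_e rule h M e = 1].

(* Each of the #|M|.-1 other edges arises from two ordered pairs o.  The process
   is continued after its end by remaining constant. *)
Definition step_prob (rule : switching_rule) (h : seq matching)
    (M M' : matching) : R :=
  if no_bad_edges M then (M' == M)%:R
  else \sum_(e : halfedge * halfedge) (rule h M e *
         \sum_(o : halfedge * halfedge |
               [set o.1; o.2] \in (M :\ [set e.1; e.2])%SET)
            (2 * #|M|.-1)%:R^-1 * (M' == switching M e o)%:R).

(* The probability that a run starts with m 0, ..., m K. *)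
Definition path_prob (rule : switching_rule) (m : nat -> matching) (K : nat) : R :=
  (if m 0%N \in configurations then #|configurations|%:R^-1 else 0) *
  \prod_(k < K) step_prob rule (mkseq m k) (m k) (m k.+1).

End Configurations.

Local Open Scope classical_set_scope.

Definition uniform_on (disp : measure_display) (Omega : measurableType disp)
    (R : realType) (P : probability Omega R) (T : finType) (A : {set T})
    (X : Omega -> T) : Prop :=
  forall x : T, measurable (X @^-1` [set x]) /\
    P (X @^-1` [set x]) = (if x \in A then #|A|%:R^-1 else 0)%:E.

(* Gam r k is the configuration after k switchings in the r-th run, where
   run 0 starts from Gamma_0 and runs 1, 2, ... are the successive restarts.
   The runs are independent and identically distributed. *)
Definition switching_process (disp : measure_display)
    (Omega : measurableType disp) (R : realType) (P : probability Omega R)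
    (n : nat) (d : 'I_n -> nat) (rule : switching_rule d R)
    (Gam : nat -> nat -> Omega -> matching d) : Prop :=
  (forall r k M, measurable (Gam r k @^-1` [set M])) /\
  forall (L K : nat) (m : nat -> nat -> matching d),
    P [set w | forall r k, (r < L)%N -> (k <= K)%N -> Gam r k w = m r k]
    = (\prod_(r < L) path_prob rule (m r) K)%:E.

(* The least k satisfying Q; 0 if there is none. *)
Definition first_time (Q : nat -> Prop) : nat :=
  xget 0%N [set k | Q k /\ forall j, Q j -> (k <= j)%N].

Section Outcomes.
Variables (Omega : Type) (n : nat) (d : 'I_n -> nat).
Variable Gam : nat -> nat -> Omega -> matching d.

Definition terminates (r : nat) (w : Omega) : Prop :=
  exists k, no_bad_edges (Gam r k w).

Definition configuration_multigraph (w : Omega) : multigraph n :=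
  projection (Gam 0%N 0%N w).

(* The first terminating run exists almost surely when d is graphic. *)
Definition switched_graph (w : Omega) : multigraph n :=
  let r := first_time (fun r => terminates r w) in
  let k := first_time (fun k => no_bad_edges (Gam r k w)) in
  projection (Gam r k w).

End Outcomes.

Section Convergence.
Variables (R : realType) (disp : nat -> measure_display).
Variables (Omega : forall n, measurableType (disp n)).
Variables (P : forall n, probability (Omega n) R).

Definition cvg_in_probability0 (Z : forall n, Omega n -> R) : Prop :=
  forall eps : R, 0 < eps ->
    (fun n => P n [set w | eps < `|Z n w|]) @ \oo --> 0%E.

Definition cvg_in_distribution (X : forall n, Omega n -> R)
    (dispY : measure_display) (OmegaY : measurableType dispY)
    (PY : probability OmegaY R) (Y : OmegaY -> R) : Prop :=
  forall g : R -> R, continuous g -> (exists C, forall x, `|g x| <= C) ->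
    (fun n => 'E_(P n)[fun w => g (X n w)]%E) @ \oo --> 'E_PY[fun w => g (Y w)]%E.

End Convergence.

(* Main.v *)
Require Import Defs.
From HB Require Import structures.
From mathcomp Require Import all_boot all_order all_algebra all_fingroup.
From mathcomp Require Import all_classical all_reals all_analysis.
From mathcomp Require Import zify ring lra.
Import Order.TTheory GRing.Theory Num.Theory.
Import numFieldNormedType.Exports.

(** The theorem compares three means of a bounded function of a multigraph: over
simple graphs, over configurations, and over the outcomes of the switchings.

A configuration is clean if it has at worst simple loops and double edges; its
level is then the number of its loops and double edges.  First moments of loops
and pairs of parallel edges show that with probability near 1 a random
configuration is clean and has level at most a large constant K ([level_tight]).
Since the maximum degree is o(sqrt N), a switching of a bad edge with a random
other edge nearly always removes that bad edge and creates no other one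
([forward_loop], [forward_double], [not_generic_le]).  Hence a run started at
level k nearly always stops after exactly k switchings ([value_cst_ge]).

Let phi be a bounded function of the multigraph whose mean over simple graphs is
0, and consider its expected value after k switchings from a configuration of
level k.  Two facts show that its mean over the configurations of level k is
small.

The rule is irrelevant ([value_close]).  Switchings of two distinct edges commute
unless the random edges collide ([avg_comm]), and two half-edges of the same pair
of parallel edges are exchanged by a relabelling ([avg_parallel]); so it hardly
matters which bad edge comes first ([order_insensitive]), and one may as well
switch a uniformly random bad edge.

Means pass from one level to the next ([mean_step]).  A switching is an
involution, so averaging over all switchings out of the configurations with one
more loop amounts to summing over the configurations without it, each weighted
by the number of switchings that create a loop from it.  That weight is nearly
constant: it is close to the number of ordered pairs of half-edges at a common
vertex ([loop_count]).  For double edges the weight is close to a random variable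
that is concentrated by a second moment computation
([double_candidates_deviation]).  By induction all means are proportional, up to
small errors, to the mean over level 0 ([state_mean_bound]); and that mean is 0
because each simple graph is the projection of equally many configurations
([fiber_le]).

So the mean of phi over the outcomes of the runs is small.  As the outcome and the
starting configuration give nearly the same value of f, so is the mean of phi
over configurations ([finite_comparison]).  For fixed K, the errors due to the
switchings are at most a constant times the ratio of the maximum degree to
sqrt N; letting n, and then K, tend to infinity proves the theorem. *)

Set Implicit Arguments.
Unset Strict Implicit.
Unset Printing Implicit Defensive.

Local Open Scope nat_scope.

(** * Configurations as fixed-point-free involutions *)

Lemma set2_eq (T : finType) (x y a b : T) : [set x; y]%SET = [set a; b]%SET ->
  (x = a /\ y = b) \/ (x = b /\ y = a).
Proof.
move=> e.
have xi : x \in [set a; b]%SET by rewrite -e set21.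
have yi : y \in [set a; b]%SET by rewrite -e set22.
have ai : a \in [set x; y]%SET by rewrite e set21.
have bi : b \in [set x; y]%SET by rewrite e set22.
move: xi yi ai bi; rewrite !inE => /orP[/eqP xE|/eqP xE] /orP[/eqP yE|/eqP yE]; subst; auto;
by rewrite orbb => /eqP ? /orP[]/eqP ?; subst; auto.
Qed.

Ltac neq_false := repeat match goal with
  | h : is_true (?a != ?b) |- context [?a == ?b] => rewrite (negbTE h)
  | h : is_true (?a != ?b) |- context [?b == ?a] => rewrite [b == a]eq_sym (negbTE h)
  end.

Section Partners.
Variables (n : nat) (d : 'I_n -> nat).
Local Notation H := (halfedge d).
Implicit Types (M : matching d) (p : H -> H) (x y z : H).
Local Notation Conf := (configurations d).

(** The default value [x] is returned only if [M] is not a configuration. *)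
Definition partner M x : H :=
  odflt x [pick y | (y != x) && ([set x; y]%SET \in M)].

Definition pairing p := involutive p /\ forall x, p x != x.

Definition config_of p : matching d := [set [set x; p x]%SET | x : H]%SET.

Lemma in_config_of p x y : pairing p ->
  ([set x; y]%SET \in config_of p) = (y == p x).
Proof.
move=> [pK pn]; apply/imsetP/eqP => [[z _ /set2_eq[][-> ->]]|->] //.
by exists x.
Qed.

Lemma config_of_conf p : pairing p -> config_of p \in Conf.
Proof.
move=> [pK pn]; rewrite inE; apply/andP; split; last first.
  by apply/forall_inP => _ /imsetP[x _ ->]; rewrite cards2 (eq_sym x) pn.
apply/and3P; split.
- apply/eqP/setP => x; rewrite !inE; apply/bigcupP.
  by exists [set x; p x]%SET; rewrite ?set21 //; apply: imset_f.
- apply/finset.trivIsetP => _ _ /imsetP[x _ ->] /imsetP[y _ ->] xy.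
  rewrite -setI_eq0; apply/eqP/setP => z; rewrite !inE; apply/negP => /andP[].
  case/orP=> /eqP-> /orP[]/eqP e; move: xy.
  + by rewrite e eqxx.
  + by rewrite e pK finset.setUC eqxx.
  + by rewrite -e pK finset.setUC eqxx.
  + by rewrite (inv_inj pK e) eqxx.
- by apply/imsetP => -[x _ /setP/(_ x)]; rewrite !inE eqxx.
Qed.

Lemma partner_config_of p x : pairing p -> partner (config_of p) x = p x.
Proof.
move=> pp; rewrite /partner; case: pickP => [y|/(_ (p x))].
  by rewrite in_config_of // => /andP[_ /eqP].
by rewrite in_config_of // eqxx pp.2.
Qed.

Lemma conf_edge M x : M \in Conf -> (partner M x != x) && ([set x; partner M x]%SET \in M).
Proof.
rewrite inE => /andP[/and3P[/eqP cov tI _] /forall_inP c2].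
rewrite /partner; case: pickP => [//|h].
have : x \in finset.cover M by rewrite cov inE.
case/bigcupP => B BM xB; have /cards2P[a [b [ab BE]]] := c2 _ BM.
move: xB (h b) (h a); rewrite BE !inE => /orP[]/eqP->.
  by rewrite eq_sym ab -BE BM.
by rewrite ab finset.setUC -BE BM.
Qed.

Lemma conf_partner_unique M x y : M \in Conf -> [set x; y]%SET \in M -> y = partner M x.
Proof.
move=> MC xyM; have /andP[px pM] := conf_edge x MC.
move: MC; rewrite inE => /andP[/and3P[_ /finset.trivIsetP tI _] /forall_inP c2].
have [e|/(tI _ _ xyM pM)] := eqVneq [set x; y]%SET [set x; partner M x]%SET.
  by case/set2_eq: e => -[] // _ yx; have := c2 _ xyM; rewrite yx cards2 eqxx.
by rewrite -setI_eq0 => /eqP/setP/(_ x); rewrite !inE eqxx.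
Qed.

Lemma partner_pairing M : M \in Conf -> pairing (partner M).
Proof.
move=> MC; split=> x; last by case/andP: (conf_edge x MC).
symmetry; apply: conf_partner_unique => //; rewrite finset.setUC.
by case/andP: (conf_edge x MC).
Qed.

Lemma partnerK M : M \in Conf -> involutive (partner M).
Proof. by case/partner_pairing. Qed.

Lemma partner_neq M x : M \in Conf -> partner M x != x.
Proof. by case/partner_pairing. Qed.

Lemma config_ofE M p : M \in Conf -> partner M =1 p -> M = config_of p.
Proof.
move=> MC e; have pp : pairing p.
  have [h1 h2] := partner_pairing MC; split=> x; rewrite -!e //.
apply/setP => B; apply/idP/imsetP => [BM|[x _ ->]]; last first.
  by rewrite -e; case/andP: (conf_edge x MC).
move: (MC); rewrite inE => /andP[_ /forall_inP/(_ _ BM)/cards2P[a [b [ab BE]]]].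
by exists a => //; rewrite BE -e (@conf_partner_unique M a b) -?BE.
Qed.

Lemma conf_inj M M' : M \in Conf -> M' \in Conf -> partner M =1 partner M' -> M = M'.
Proof. by move=> MC M'C e; rewrite (config_ofE MC e) -(@config_ofE M') . Qed.

Lemma in_conf M x y : M \in Conf -> ([set x; y]%SET \in M) = (y == partner M x).
Proof.
by move=> MC; rewrite {1}(config_ofE MC (fun=> erefl)) in_config_of //; exact: partner_pairing.
Qed.

Lemma card_conf M : M \in Conf -> (#|M| * 2)%N = #|{: H}|.
Proof.
rewrite inE => /andP[pM /forall_inP c2].
rewrite -cardsT (@card_uniform_partition _ 2 _ _ _ pM) // => B BM.
by apply/eqP/c2.
Qed.

(** The new pairs are [x] with [p z] and [z] with [p x], as in [switching] with
the ordered pairs [(x, p x)] and [(z, p z)]. *)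
Definition switch_fun p x z t :=
  if t == x then p z else if t == p z then x else if t == z then p x
  else if t == p x then z else p t.

Definition sw M x z : matching d := config_of (switch_fun (partner M) x z).

Lemma switch_fun_pairing p x z : pairing p -> x != z -> z != p x ->
  pairing (switch_fun p x z).
Proof.
move=> [pK pn] xz zpx.
have pinj := inv_inj pK.
have h1 : p z != x by rewrite -(inj_eq pinj) pK.
have h2 : p z != p x by rewrite (inj_eq pinj) eq_sym.
have h3 := pn x; have h4 := pn z.
split=> t; rewrite /switch_fun.
  case: (eqVneq t x) => [->|tx]; first by rewrite (negbTE h1) eqxx.
  case: (eqVneq t (p z)) => [->|tpz]; first by rewrite eqxx.
  case: (eqVneq t z) => [->|tz].
    by rewrite (negbTE h3) eq_sym (negbTE h2) eq_sym (negbTE zpx) eqxx.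
  case: (eqVneq t (p x)) => [->|tpx].
    by rewrite eq_sym (negbTE xz) eq_sym (negbTE h4) eqxx.
  rewrite !(inj_eq pinj) (negbTE tx) (negbTE tz).
  by rewrite -(inj_eq pinj) pK (negbTE tpx) -(inj_eq pinj) pK (negbTE tpz).
case: (eqVneq t x) => [->|tx]; first by [].
case: (eqVneq t (p z)) => [->|tpz]; first by rewrite eq_sym.
case: (eqVneq t z) => [->|tz]; first by rewrite eq_sym.
by case: (eqVneq t (p x)) => [->|tpx]; rewrite // eq_sym.
Qed.

Section Switch.
Variables (M : matching d) (MC : M \in Conf).

Lemma sw_conf x z : x != z -> z != partner M x -> sw M x z \in Conf.
Proof.
by move=> xz zpx; apply/config_of_conf/switch_fun_pairing => //; exact: partner_pairing.
Qed.

Lemma partner_sw x z t : x != z -> z != partner M x ->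
  partner (sw M x z) t = switch_fun (partner M) x z t.
Proof.
by move=> xz zpx; rewrite partner_config_of //; apply: switch_fun_pairing => //;
  exact: partner_pairing.
Qed.

Lemma switchingE x z : x != z -> z != partner M x ->
  switching M (x, partner M x) (z, partner M z) = sw M x z.
Proof.
move=> xz; have := partner_pairing MC.
rewrite /sw /switching /=; set p := partner M => pp zpx; have [pK pn] := pp.
rewrite {1}(config_ofE MC (fun=> erefl)) -/p.
have pq := switch_fun_pairing pp xz zpx.
have pinj := inv_inj pK.
have h1 : p z != x by rewrite -(inj_eq pinj) pK.
have h2 : p z != p x by rewrite (inj_eq pinj) eq_sym.
have h3 := pn x; have h4 := pn z.
have qx : switch_fun p x z x = p z by rewrite /switch_fun eqxx.
have qz : switch_fun p x z z = p x.
  by rewrite /switch_fun eq_sym (negbTE xz) eq_sym (negbTE h4) eqxx.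
apply/setP => B; rewrite finset.in_setU finset.in_setD !inE.
apply/orP/imsetP.
  case=> [/andP[]|/orP[]/eqP->]; last 2 first.
  - by exists x; rewrite ?qx.
  - by exists z; rewrite ?qz // finset.setUC.
  rewrite negb_or => /andP[B1 B2] /imsetP[t _ BE]; subst B.
  exists t => //; rewrite /switch_fun.
  case: (eqVneq t x) => [e|tx]; first by rewrite e eqxx in B1.
  case: (eqVneq t (p z)) => [e|tpz]; first by rewrite e pK finset.setUC eqxx in B2.
  case: (eqVneq t z) => [e|tz]; first by rewrite e eqxx in B2.
  by case: (eqVneq t (p x)) => [e|tpx] //; rewrite e pK finset.setUC eqxx in B1.
case=> t _ ->; rewrite /switch_fun.
case: (eqVneq t x) => [->|tx]; first by right; rewrite eqxx.
case: (eqVneq t (p z)) => [->|tpz]; first by right; rewrite finset.setUC eqxx.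
case: (eqVneq t z) => [->|tz]; first by right; rewrite finset.setUC eqxx orbT.
case: (eqVneq t (p x)) => [->|tpx]; first by right; rewrite finset.setUC eqxx orbT.
have tin : [set t; p t]%SET \in config_of p by apply/imsetP; exists t.
left; rewrite negb_or tin andbT; apply/andP; split; apply/eqP => /set2_eq[][e _];
  by [rewrite e eqxx in tx|rewrite e eqxx in tpx|rewrite e eqxx in tz|rewrite e eqxx in tpz].
Qed.

(** The new partner of [x] is [partner M z], so that switching [x] and [z] again
restores both edges; this makes switchings reversible. *)
Lemma swK x z : x != z -> z != partner M x -> sw (sw M x z) x z = M.
Proof.
move=> xz zpx; have M'C := sw_conf xz zpx.
have px' : partner (sw M x z) x = partner M z by rewrite partner_sw // /switch_fun eqxx.
have zpx' : z != partner (sw M x z) x by rewrite px' eq_sym partner_neq.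
symmetry; apply: config_ofE => // t.
have pK := partnerK MC; have pinj := inv_inj pK; have pn y := partner_neq y MC.
rewrite /switch_fun !partner_sw // /switch_fun.
rewrite eqxx ![z == x]eq_sym (negbTE xz) [z == partner M z]eq_sym (negbTE (pn z)) eqxx.
case: (eqVneq t x) => [->//|tx].
case: (eqVneq t (partner M x)) => [->|tpx]; first by rewrite pK.
case: (eqVneq t z) => [->//|tz].
by case: (eqVneq t (partner M z)) => [->|tpz]; first by rewrite pK.
Qed.

(** Reversing both edges of a switching leaves it unchanged, so that the
orientation of the bad edge is immaterial once the other one is random. *)
Lemma sw_flip x z : x != z -> z != partner M x ->
  sw M (partner M x) z = sw M x (partner M z).
Proof.
move=> xz zpx.
have pK := partnerK MC; have pinj := inv_inj pK; have pn y := partner_neq y MC.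
congr config_of; apply/funext => t; rewrite /switch_fun !pK.
case: (eqVneq t (partner M x)) => [->|tpx].
  by rewrite (negbTE (pn _)) eq_sym (negbTE zpx) (inj_eq pinj) (negbTE xz).
case: (eqVneq t (partner M z)) => [->|tpz].
  by rewrite (negbTE (pn z)) -[_ == x](inj_eq pinj) pK (negbTE zpx).
case: (eqVneq t z) => [->|tz]; first by rewrite eq_sym (negbTE xz).
by case: (eqVneq t x).
Qed.
End Switch.

Lemma switch_fun_comm p x z x' z' t :
  uniq [:: x; p x; z; p z; x'; p x'; z'; p z'] ->
  switch_fun (switch_fun p x z) x' z' t = switch_fun (switch_fun p x' z') x z t.
Proof.
move=> U; have {U} : uniq [:: x; p x; z; p z; x'; p x'; z'; p z'] by [].
rewrite /= !inE !negb_or => U.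
repeat match goal with h : is_true (_ && _) |- _ => case/andP: h => ? ? end.
have e1 : switch_fun p x z x' = p x' by rewrite /switch_fun; neq_false.
have e2 : switch_fun p x z z' = p z' by rewrite /switch_fun; neq_false.
have e3 : switch_fun p x' z' x = p x by rewrite /switch_fun; neq_false.
have e4 : switch_fun p x' z' z = p z by rewrite /switch_fun; neq_false.
rewrite {1}/switch_fun e1 e2 [RHS]/switch_fun e3 e4.
case: (eqVneq t x') => [->|tx']; first by rewrite {1}/switch_fun eqxx; neq_false.
case: (eqVneq t (p z')) => [->|tpz']; first by rewrite {1}/switch_fun eqxx; neq_false.
case: (eqVneq t z') => [->|tz']; first by rewrite {1}/switch_fun eqxx; neq_false.
case: (eqVneq t (p x')) => [->|tpx']; first by rewrite {1}/switch_fun eqxx; neq_false.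
by rewrite /switch_fun; neq_false.
Qed.

Lemma sw_comm M x z x' z' : M \in Conf ->
  uniq [:: x; partner M x; z; partner M z; x'; partner M x'; z'; partner M z'] ->
  sw (sw M x z) x' z' = sw (sw M x' z') x z.
Proof.
move=> MC U.
have sub a b a' b' t : uniq [:: a; partner M a; b; partner M b; a'; partner M a'; b'; partner M b'] ->
  switch_fun (partner (sw M a b)) a' b' t = switch_fun (switch_fun (partner M) a b) a' b' t.
  rewrite /= !inE !negb_or => W.
  repeat match goal with h : is_true (_ && _) |- _ => case/andP: h => ? ? end.
  have ab : a != b by []. have ba : b != partner M a by rewrite eq_sym.
  by rewrite /switch_fun !partner_sw.
have U' : uniq [:: x'; partner M x'; z'; partner M z'; x; partner M x; z; partner M z].
  by have := U; rewrite (uniq_catC [:: x; _; z; _] [:: x'; _; z'; _]).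
rewrite {1}/sw [RHS]/sw; apply: (congr1 (@config_of)); apply/funext => t.
rewrite (sub _ _ _ _ t U) (sub _ _ _ _ t U'); exact: switch_fun_comm.
Qed.
End Partners.

(** * Multiplicities, and switchings that remove a bad edge *)

Section Mult.
Variables (n : nat) (d : 'I_n -> nat).
Local Notation H := (halfedge d).
Implicit Types (M : matching d) (x y z : H) (i j : 'I_n).
Local Notation Conf := (configurations d).

(** Both half-edges of a loop count: a simple loop has multiplicity 2, as has a
double edge.  Hence multiplicity above 1 characterises the bad edges. *)
Definition mult M i j : nat :=
  \sum_(x : H) ((tag x == i) && (tag (partner M x) == j)).

Definition badh M x := 1 < mult M (tag x) (tag (partner M x)).

Section Relabel.
Variables (pi : {perm H}).

Definition relabel M : matching d := config_of (fun x => pi (partner M ((pi^-1)%g x))).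

Lemma relabel_pairing M : M \in Conf -> pairing (fun x => pi (partner M ((pi^-1)%g x))).
Proof.
move=> MC; split=> x; first by rewrite permK (partnerK MC) permKV.
by rewrite -{2}(permKV pi x) (inj_eq perm_inj) partner_neq.
Qed.

Lemma relabel_conf M : M \in Conf -> relabel M \in Conf.
Proof. by move=> MC; apply: config_of_conf; exact: relabel_pairing. Qed.

Lemma partner_relabel M x : M \in Conf -> partner (relabel M) (pi x) = pi (partner M x).
Proof. by move=> MC; rewrite partner_config_of ?permK //; exact: relabel_pairing. Qed.

Lemma relabel_sw M x z : M \in Conf -> x != z -> z != partner M x ->
  relabel (sw M x z) = sw (relabel M) (pi x) (pi z).
Proof.
move=> MC xz zpx; have RC := relabel_conf MC.
have xz' : pi x != pi z by rewrite (inj_eq perm_inj).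
have zpx' : pi z != partner (relabel M) (pi x) by rewrite partner_relabel // (inj_eq perm_inj).
apply: conf_inj; [exact/relabel_conf/sw_conf|exact: sw_conf|].
move=> t; rewrite -(permKV pi t); move: ((pi^-1)%g t) => {}t.
rewrite partner_relabel ?sw_conf // !partner_sw // /switch_fun !partner_relabel // !(inj_eq perm_inj).
by do 4 case: ifP => // _.
Qed.

Lemma mult_relabel M i j : M \in Conf -> (forall x, tag (pi x) = tag x) ->
  mult (relabel M) i j = mult M i j.
Proof.
move=> MC pit; rewrite /mult (reindex_inj (@perm_inj _ pi)) /=.
by apply: eq_bigr => x _; rewrite partner_relabel // !pit.
Qed.
End Relabel.

Lemma relabelK (pi : {perm H}) M : M \in Conf -> relabel (pi^-1)%g (relabel pi M) = M.
Proof.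
move=> MC; apply: conf_inj => // [|t]; first by do 2 apply: relabel_conf.
rewrite -{1}(permK pi t) partner_relabel ?relabel_conf // partner_relabel //.
by rewrite permK.
Qed.

Lemma relabel_inj (pi : {perm H}) : {in Conf &, injective (relabel pi)}.
Proof. by move=> M M' MC MC' e; rewrite -(relabelK pi MC) e relabelK. Qed.

Section Multiplicities.
Variables (M : matching d) (MC : M \in Conf).
Let pK := partnerK MC.
Let pinj := inv_inj pK.

Lemma mult_sym i j : mult M i j = mult M j i.
Proof.
rewrite /mult (reindex_inj pinj) /=; apply: eq_bigr => x _.
by rewrite pK andbC.
Qed.

Lemma mult_gt0 x : 0 < mult M (tag x) (tag (partner M x)).
Proof. by rewrite /mult (bigD1 x) //= !eqxx. Qed.

Lemma mult_gt0P i j : reflect (exists x, tag x = i /\ tag (partner M x) = j) (0 < mult M i j).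
Proof.
apply: (iffP idP) => [|[x [<- <-]]]; last exact: mult_gt0.
rewrite lt0n sum_nat_eq0 => /forallPn[x]; rewrite negb_imply eqb0 negbK => /and3P[_ /eqP ? /eqP ?].
by exists x.
Qed.

Lemma mult_ge2 x y : x != y -> tag x = tag y -> tag (partner M x) = tag (partner M y) ->
  badh M x.
Proof.
by move=> xy e1 e2; rewrite /badh /mult (bigD1 x) //= (bigD1 y) 1?eq_sym //= -e1 -e2 !eqxx.
Qed.

Lemma loop_bad x : tag (partner M x) = tag x -> badh M x.
Proof.
move=> e; apply: (@mult_ge2 x (partner M x)) => //; last by rewrite pK e.
by rewrite eq_sym partner_neq.
Qed.

Lemma badh_partner x : badh M (partner M x) = badh M x.
Proof. by rewrite /badh pK mult_sym. Qed.

(** The change is stated without subtraction: both sides are the multiplicity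
of the multigraph that has the two old edges and the two new ones. *)
Lemma mult_sw x z s t : x != z -> z != partner M x ->
  let I (a b : H) := (tag a == s) && (tag b == t) : nat in
  let w := partner M x in let y := partner M z in
  mult (sw M x z) s t + (I x w + I w x + I z y + I y z) =
  mult M s t + (I x y + I y x + I z w + I w z).
Proof.
move=> xz zpx I w y; rewrite /mult.
have pn u := partner_neq u MC.
have xw : w != x by exact: pn.
have zw : z != w by [].
have yx : y != x by rewrite /y -(inj_eq pinj) pK.
have yw : y != w by rewrite (inj_eq pinj) eq_sym.
have yz : y != z by exact: pn.
have split4 (f : H -> nat) : \sum_u f u =
    f x + (f w + (f z + (f y + \sum_(u | [&& u != x, u != w, u != z & u != y]) f u))).
  rewrite (bigD1 x) //= (bigD1 w) ?xw //= (bigD1 z) 1?eq_sym ?xz //= (bigD1 y) ?yx ?yw ?yz //=.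
  by do 4 congr (_ + _); apply: eq_bigl => u; rewrite !andbA.
have qx : partner (sw M x z) x = y by rewrite partner_sw // /switch_fun eqxx.
have qw : partner (sw M x z) w = z by rewrite partner_sw // /switch_fun -/w -/y eqxx; neq_false.
have qz : partner (sw M x z) z = w by rewrite partner_sw // /switch_fun -/w -/y eqxx; neq_false.
have qy : partner (sw M x z) y = x by rewrite partner_sw // /switch_fun -/w -/y eqxx; neq_false.
rewrite !split4 qx qw qz qy.
under eq_bigr => u /and4P[u1 u2 u3 u4].
  rewrite partner_sw // /switch_fun -/w -/y (negbTE u1) (negbTE u2) (negbTE u3) (negbTE u4); over.
rewrite /I !pK -/w -/y /=; ring.
Qed.
End Multiplicities.

(** A computation with the indicators of the four edges of a switching, for a
bad edge ij and a simple edge kl such that il and kj are not yet edges. *)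
Lemma switch_mult_forward (m m' : 'I_n -> 'I_n -> nat) i j k l :
  (forall s t, m s t = m t s) -> (forall s t, m s t <= 2) ->
  (forall s t, m' s t + ((i == s) && (j == t) + (j == s) && (i == t) + (k == s) && (l == t) + (l == s) && (k == t))
   = m s t + ((i == s) && (l == t) + (l == s) && (i == t) + (k == s) && (j == t) + (j == s) && (k == t))) ->
  m i j = 2 -> m k l = 1 -> m i l = 0 -> m k j = 0 -> i != l -> k != j -> k != l ->
  forall s t, m' s t <= 2 /\ ((m' s t == 2) = (m s t == 2) && ~~ (((s, t) == (i, j)) || ((s, t) == (j, i)))).
Proof.
move=> sym le2 E ij kl il kj nil nkj nkl s t.
have nik : i != k by apply/eqP => e; move: kl; rewrite -e il.
have njl : j != l by apply/eqP => e; move: kl; rewrite -e kj.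
have := E s t; have := le2 s t; rewrite !xpair_eqE !(eq_sym s) !(eq_sym t).
have ex (a b c : 'I_n) : a != b -> (a == c) && (b == c) = false.
  by move=> ab; apply/negP => /andP[/eqP ? /eqP ?]; subst; rewrite eqxx in ab.
have v (a b : 'I_n) c : m a b = c -> ((a == s) && (b == t) ==> (m s t == c)) && ((b == s) && (a == t) ==> (m s t == c)).
  by move=> <-; apply/andP; split; apply/implyP => /andP[/eqP<- /eqP<-]; rewrite // sym.
have := v _ _ _ ij; have := v _ _ _ kl; have := v _ _ _ il; have := v _ _ _ kj.
have := ex _ _ s nil; have := ex _ _ s nkj; have := ex _ _ s nkl; have := ex _ _ s nik; have := ex _ _ s njl.
have := ex _ _ t nil; have := ex _ _ t nkj; have := ex _ _ t nkl; have := ex _ _ t nik; have := ex _ _ t njl.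
have : (i == j) && ((i == s) == (j == s)) && ((i == t) == (j == t)) || ((i == s) && (j == s) == false) && ((i == t) && (j == t) == false).
  by case: (eqVneq i j) => [->|ij']; rewrite ?eqxx //= !ex.
case: (i == s); case: (j == s); rewrite ?andbF //=; case: (k == s) => //=; case: (l == s) => //=;
case: (i == t); case: (j == t); rewrite ?andbF //=; case: (k == t) => //=; case: (l == t) => //=; lia.
Qed.

(** The reverse of [switch_mult_forward]: simple edges il and kj are replaced
by a second edge ij (or a loop, if i = j) and a new edge kl. *)
Lemma switch_mult_backward (m m' : 'I_n -> 'I_n -> nat) i j k l :
  (forall s t, m s t = m t s) -> (forall s t, m s t <= 2) ->
  (forall s t, m' s t + ((i == s) && (l == t) + (l == s) && (i == t) + (k == s) && (j == t) + (j == s) && (k == t))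
   = m s t + ((i == s) && (j == t) + (j == s) && (i == t) + (k == s) && (l == t) + (l == s) && (k == t))) ->
  m i j = (i != j) -> m k l = 0 -> m i l = 1 -> m k j = 1 -> i != l -> k != j -> k != l ->
  forall s t, m' s t <= 2 /\ ((m' s t == 2) = (m s t == 2) || (((s, t) == (i, j)) || ((s, t) == (j, i)))).
Proof.
move=> sym le2 E ij kl il kj nil nkj nkl s t.
have nik : i != k by apply/eqP => e; move: kl; rewrite -e il.
have njl : j != l by apply/eqP => e; move: kl; rewrite -e kj.
have := E s t; have := le2 s t; rewrite !xpair_eqE !(eq_sym s) !(eq_sym t).
have ex (a b c : 'I_n) : a != b -> (a == c) && (b == c) = false.
  by move=> ab; apply/negP => /andP[/eqP ? /eqP ?]; subst; rewrite eqxx in ab.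
have v (a b : 'I_n) c : m a b = c -> ((a == s) && (b == t) ==> (m s t == c)) && ((b == s) && (a == t) ==> (m s t == c)).
  by move=> <-; apply/andP; split; apply/implyP => /andP[/eqP<- /eqP<-]; rewrite // sym.
have := v _ _ _ ij; have := v _ _ _ kl; have := v _ _ _ il; have := v _ _ _ kj.
have := ex _ _ s nil; have := ex _ _ s nkj; have := ex _ _ s nkl; have := ex _ _ s nik; have := ex _ _ s njl.
have := ex _ _ t nil; have := ex _ _ t nkj; have := ex _ _ t nkl; have := ex _ _ t nik; have := ex _ _ t njl.
have : (i == j) && ((i == s) == (j == s)) && ((i == t) == (j == t)) || (i != j) && (((i == s) && (j == s) == false) && ((i == t) && (j == t) == false)).
  by case: (eqVneq i j) => [->|ij']; rewrite ?eqxx //= !ex.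
case: (i == j); case: (i == s); case: (j == s); rewrite ?andbF //=; case: (k == s) => //=; case: (l == s) => //=;
case: (i == t); case: (j == t); rewrite ?andbF //=; case: (k == t) => //=; case: (l == t) => //=; lia.
Qed.

Definition clean M := [forall i, forall j, mult M i j <= 2].
Definition dups M := [set s : 'I_n * 'I_n | mult M s.1 s.2 == 2]%SET.
Definition loops M := [set s in dups M | s.1 == s.2]%SET.
Definition doubles M := [set s in dups M | s.1 != s.2]%SET.
(** [doubles] counts a double edge once in each direction. *)
Definition state a b := [set M in Conf | clean M && ((#|loops M| == a) && (#|doubles M| == b.*2))]%SET.

Lemma cleanP M : reflect (forall i j, mult M i j <= 2) (clean M).
Proof.
apply: (iffP forallP) => h i; first by move=> j; apply: (forallP (h i)).
by apply/forallP => j.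
Qed.

Lemma stateP M a b : reflect [/\ M \in Conf, forall i j, mult M i j <= 2, #|loops M| = a & #|doubles M| = b.*2]
  (M \in state a b).
Proof.
rewrite [M \in state a b]finset.in_set; apply: (iffP and3P) => [[MC /cleanP c /andP[/eqP <- /eqP <-]]|[MC c <- <-]].
  by split.
by rewrite MC !eqxx; split=> //; exact/cleanP.
Qed.

Lemma dups_split M : #|dups M| = #|loops M| + #|doubles M|.
Proof.
rewrite -(cardsID (loops M)); congr (_ + _).
  by congr #|pred_of_set _|; apply/setP => s; rewrite !inE; case: (_ == 2).
by congr #|pred_of_set _|; apply/setP => s; rewrite !inE; case: (_ == 2); rewrite ?andbT ?andbF.
Qed.

Lemma clean_bad M x : clean M -> badh M x -> mult M (tag x) (tag (partner M x)) = 2.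
Proof. by move=> /cleanP/(_ (tag x) (tag (partner M x))); rewrite /badh; lia. Qed.

Lemma card_badh M : clean M -> #|[set x | badh M x]%SET| = 2 * #|dups M|.
Proof.
move=> c; rewrite -sum1_card (partition_big (fun x => (tag x, tag (partner M x))) (mem (dups M))) /=; last first.
  by move=> x; rewrite !inE => /(clean_bad c)/= ->.
rewrite mulnC -sum_nat_const; apply: eq_bigr => -[i j]; rewrite inE /= => /eqP e.
rewrite -e /mult big_mkcond [RHS]big_mkcond /=; apply: eq_bigr => x _.
rewrite !inE xpair_eqE; case: eqP => [xi|]; rewrite ?andbF //; case: eqP => [xj|]; rewrite ?andbF //.
by rewrite /badh xi xj e.
Qed.

Lemma doubles_even M : M \in Conf -> exists b, #|doubles M| = b.*2.
Proof.
move=> MC; exists #|[set s in dups M | s.1 < s.2]%SET|.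
rewrite -addnn -(cardsID [set s : 'I_n * 'I_n | s.1 < s.2]%SET); congr (_ + _).
  congr #|pred_of_set _|; apply/setP => -[i j]; rewrite !inE /= -andbA; congr (_ && _).
  by rewrite -(inj_eq val_inj) /=; lia.
have swap_inj : injective (fun s : 'I_n * 'I_n => (s.2, s.1)) by move=> [? ?] [? ?] [-> ->].
rewrite -(card_imset _ swap_inj); congr #|pred_of_set _|; apply/setP => -[i j].
apply/imsetP/idP => [[[k l]]|].
  rewrite !inE /= => /andP[kl /andP[m2 ne]] [-> ->]; rewrite mult_sym // m2 /=.
  by move: kl ne; rewrite -(inj_eq val_inj) /=; lia.
rewrite !inE /= => /andP[m2 ij]; exists (j, i) => //; rewrite !inE /= mult_sym // m2 /=.
by move: ij; rewrite -(inj_eq val_inj) /=; lia.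
Qed.

Lemma clean_state M : M \in Conf -> clean M -> exists a b, M \in state a b /\ a + b.*2 = #|dups M|.
Proof.
move=> MC c; have [b bE] := doubles_even MC; exists #|loops M|, b; split; last by rewrite dups_split bE.
by apply/stateP; split=> //; exact/cleanP.
Qed.

(** The switchings that destroy the bad edge of [x] and no more: the edge of [z]
is simple, and the two new edges join non-adjacent distinct vertices. *)
Definition generic M x z :=
  [&& x != z, z != partner M x, ~~ badh M z,
      mult M (tag x) (tag (partner M z)) == 0, mult M (tag z) (tag (partner M x)) == 0,
      tag x != tag (partner M z) & tag z != tag (partner M x)].

Lemma setU2_card (A B : {set 'I_n * 'I_n}) i j :
  (forall s t, ((s, t) \in B) = ((s, t) \in A) && ~~ (((s, t) == (i, j)) || ((s, t) == (j, i)))) ->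
  (i, j) \in A -> (j, i) \in A -> #|A| = #|B| + (i != j).+1.
Proof.
move=> BE ijA jiA.
have -> : B = A :\ (i, j) :\ (j, i).
  by apply/setP => -[s t]; rewrite BE !inE; case: (_ == (i, j)); case: (_ == (j, i)); rewrite /= ?andbT ?andbF.
rewrite (cardsD1 (i, j) A) ijA (cardsD1 (j, i) (A :\ _)) !inE jiA !xpair_eqE.
by rewrite [j == i]eq_sym; case: (i == j); rewrite /= ?add0n ?add1n ?addn1 ?addn2.
Qed.

Section Forward.
Variables (M : matching d) (a b : nat) (x : H).
Hypotheses (MS : M \in state a b) (xb : badh M x).

Let MC : M \in Conf. Proof. by case/stateP: MS. Qed.
Let Mc : clean M. Proof. by case/stateP: MS => *; exact/cleanP. Qed.

Lemma forward_mult z : generic M x z -> forall s t,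
  mult (sw M x z) s t <= 2 /\ ((mult (sw M x z) s t == 2) = (mult M s t == 2) &&
    ~~ (((s, t) == (tag x, tag (partner M x))) || ((s, t) == (tag (partner M x), tag x)))).
Proof.
case/and5P=> xz zpx zb /eqP il /andP[/eqP kj /andP[nil nkj]].
have kl : mult M (tag z) (tag (partner M z)) = 1.
  by have := mult_gt0 M z; move: zb; rewrite /badh; lia.
apply: (switch_mult_forward (mult_sym MC) _ _ (clean_bad Mc xb) kl il kj nil nkj).
- by case/stateP: MS.
- by move=> s t; have /= := mult_sw MC s t xz zpx; rewrite !addnA.
- by apply/eqP => e; move: zb; rewrite loop_bad.
Qed.

(** A generic switching does not touch the bad edges other than the one it
removes. *)
Lemma forward_bad z x' : generic M x z -> badh M x' ->
  (tag x', tag (partner M x')) != (tag x, tag (partner M x)) ->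
  (tag x', tag (partner M x')) != (tag (partner M x), tag x) ->
  partner (sw M x z) x' = partner M x' /\ badh (sw M x z) x'.
Proof.
move=> g xb' n1 n2; have F := forward_mult g; case/and5P: g => xz zpx zb _ _.
have pK := partnerK MC.
have px' : partner (sw M x z) x' = partner M x'.
  rewrite partner_sw // /switch_fun.
  case: eqP => [e|_]; first by rewrite e eqxx in n1.
  case: eqP => [e|_]; first by move: zb; rewrite -badh_partner // -e xb'.
  case: eqP => [e|_]; first by rewrite -e xb' in zb.
  by case: eqP => [e|_] //; rewrite e pK eqxx in n2.
split=> //; rewrite /badh px'.
have [_ /eqP] := F (tag x') (tag (partner M x')).
by rewrite (negbTE n1) (negbTE n2) (clean_bad Mc xb') eqxx /= => /eqP/eqP->.
Qed.

Lemma forward_loop z : generic M x z -> tag x = tag (partner M x) ->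
  0 < a /\ sw M x z \in state a.-1 b.
Proof.
move=> g e; have F := forward_mult g; case/and5P: g => xz zpx zb _ _.
have m2 := clean_bad Mc xb; rewrite -e in m2.
have h : #|loops M| = #|loops (sw M x z)| + 1.
  rewrite (@setU2_card (loops M) (loops (sw M x z)) (tag x) (tag x)) ?eqxx //.
  - by move=> s t; rewrite !inE /= (F s t).2 -e; case: (_ == 2); case: (s == t); rewrite /= ?andbT ?andbF.
  - by rewrite !inE /= m2 !eqxx.
  - by rewrite !inE /= m2 !eqxx.
case/stateP: MS => _ _ aE bE; split; first by rewrite -aE h addn1.
apply/stateP; split; [exact: sw_conf|by move=> s t; have [] := F s t|by rewrite -aE h addn1|].
rewrite -bE; congr #|pred_of_set _|; apply/setP => -[s t]; rewrite !inE /= (F s t).2 -e !xpair_eqE orbb.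
case: (s =P t) => [->|/eqP st]; rewrite ?andbF // !andbT; case: (_ == 2) => //=.
by apply/negP => /andP[/eqP es /eqP et]; rewrite es et eqxx in st.
Qed.

Lemma forward_double z : generic M x z -> tag x != tag (partner M x) ->
  0 < b /\ sw M x z \in state a b.-1.
Proof.
move=> g ne; have F := forward_mult g; case/and5P: g => xz zpx zb _ _.
have m2 := clean_bad Mc xb.
have h : #|doubles M| = #|doubles (sw M x z)| + 2.
  rewrite (@setU2_card (doubles M) (doubles (sw M x z)) (tag x) (tag (partner M x))) ?ne //.
  - by move=> s t; rewrite !inE /= (F s t).2; case: (_ == 2); case: (s == t); rewrite /= ?andbT ?andbF.
  - by rewrite !inE /= m2 !eqxx.
  - by rewrite !inE /= mult_sym // m2 eq_sym !eqxx.
case/stateP: MS => _ _ aE bE; have b0 : 0 < b by rewrite -double_gt0 -bE h addn2.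
split=> //.
apply/stateP; split; [exact: sw_conf|by move=> s t; have [] := F s t| |by lia].
rewrite -aE; congr #|pred_of_set _|; apply/setP => -[s t]; rewrite !inE /= (F s t).2 !xpair_eqE.
case: (s =P t) => [->|/eqP st]; rewrite ?andbF // !andbT; case: (_ == 2) => //=.
rewrite negb_or; apply/andP; split; apply/negP => /andP[/eqP e1 /eqP e2]; move: ne; by rewrite -e1 -e2 eqxx.
Qed.

End Forward.
End Mult.

(** * Counting the switchings that create a loop or a double edge *)

Lemma sum_and_le (I J : finType) (f : I -> bool) (g : I -> J -> bool) (K : nat) : (forall x, \sum_z g x z <= K) ->
  \sum_x \sum_z (f x && g x z) <= (\sum_x f x) * K.
Proof.
move=> gK; rewrite big_distrl /=; apply: leq_sum => x _.
by case: (f x) => /=; rewrite ?mul1n // sum_nat_const muln0.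
Qed.

Lemma sum_and3_le (I J K : finType) (f : I -> bool) (g : I -> J -> bool) (h : I -> J -> K -> bool) (A B : nat) :
  (forall x, \sum_y g x y <= A) -> (forall x y, \sum_z h x y z <= B) ->
  \sum_x \sum_y \sum_z (f x && (g x y && h x y z)) <= (\sum_x f x) * A * B.
Proof.
move=> gA hB; rewrite -mulnA.
apply: (@leq_trans (\sum_x \sum_(yz : J * K) (f x && (g x yz.1 && h x yz.1 yz.2)))).
  by apply: leq_sum => u _; rewrite pair_big.
apply: sum_and_le => x; rewrite -(pair_big xpredT xpredT (fun y z => (g x y && h x y z : nat))) /=.
by apply: (leq_trans (sum_and_le _ (hB x))); rewrite leq_mul2r gA orbT.
Qed.

Lemma sum3_split (I J K : finType) (f g : I -> J -> K -> nat) :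
  \sum_x \sum_y \sum_z (f x y z + g x y z) =
  \sum_x \sum_y \sum_z f x y z + \sum_x \sum_y \sum_z g x y z.
Proof.
rewrite -big_split; apply: eq_bigr => x _; rewrite -big_split; apply: eq_bigr => y _.
by rewrite -big_split.
Qed.

Lemma le_sum1 (T : finType) (P : T -> nat) t : P t <= \sum_t P t.
Proof. by rewrite (bigD1 t) //= leq_addr. Qed.

Lemma sum_unique (T : finType) (P : T -> bool) (Q : bool) :
  (forall t, P t -> Q) -> (forall t t', P t -> P t' -> t = t') -> \sum_t P t <= Q.
Proof.
move=> PQ u; case: (pickP P) => [t Pt|P0]; last by rewrite big1 // => t _; rewrite P0.
rewrite (PQ _ Pt) (bigD1 t) //= big1 ?addn0 ?Pt // => t' tt'.
by case Pt': (P t') => //; rewrite (u _ _ Pt Pt') eqxx in tt'.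
Qed.

Section Counts.
Variables (n : nat) (d : 'I_n -> nat).
Local Notation H := (halfedge d).
Implicit Types (M : matching d) (x y z u : H) (i j : 'I_n).
Local Notation Conf := (configurations d).

Definition maxdeg := \max_(i < n) d i.
Local Notation D := maxdeg.

Lemma card_at i : \sum_(x : H) (tag x == i) = d i.
Proof.
rewrite (eq_bigr (fun x : H => if tag x == i then 1 else 0)); last by move=> x _; case: eqP.
rewrite -big_mkcond /=.
transitivity (\sum_(k | k == i) \sum_(j < d k | true) 1); last by rewrite big_pred1_eq sum1_card card_ord.
by rewrite sig_big_dep /=; apply: eq_bigl => x; rewrite andbT.
Qed.

Lemma card_halfedge : #|{: H}| = \sum_i d i.
Proof.
by rewrite card_tagged sumnE big_map big_enum; apply: eq_bigr => i _; rewrite card_ord.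
Qed.

Lemma deg_le i : d i <= D.
Proof. exact: (@leq_bigmax _ d). Qed.

Lemma card_at_le i : \sum_(x : H) (tag x == i) <= D.
Proof. by rewrite card_at deg_le. Qed.

Section Config.
Variables (M : matching d) (MC : M \in Conf).
Local Notation p := (partner M).
Let pK := partnerK MC.
Let pinj := inv_inj pK.
Let nb := \sum_x (badh M x).

Lemma card_at_partner i : \sum_(x : H) (tag (p x) == i) = d i.
Proof. by rewrite -card_at [RHS](reindex_inj pinj). Qed.

Lemma card_at_partner_le i : \sum_(x : H) (tag (p x) == i) <= D.
Proof. by rewrite card_at_partner deg_le. Qed.

Lemma nb_card : nb = #|[set x | badh M x]%SET|.
Proof. by rewrite -sum1_card big_mkcond /=; apply: eq_bigr => x _; rewrite inE; case: badh. Qed.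

Lemma mult_le_sum i j : mult M i j <= \sum_(x | tag x == i) (tag (p x) == j).
Proof. by rewrite /mult [leqRHS]big_mkcond; apply: leq_sum => x _; case: eqP => //= _; case: eqP. Qed.

Lemma card_nbr i (f : H -> 'I_n) : (forall j, \sum_x (f x == j) <= D) ->
  \sum_z (0 < mult M i (f z)) <= D * D.
Proof.
move=> fD; apply: (@leq_trans (\sum_z \sum_(x | tag x == i) (f z == tag (p x)))).
  apply: leq_sum => z _; case: ltnP => //= h; apply: (leq_trans h); apply: (leq_trans (mult_le_sum _ _)).
  by apply: leq_sum => x _; rewrite eq_sym.
rewrite exchange_big /=; apply: (@leq_trans (\sum_(x | tag x == i) D)); first by apply: leq_sum => x _.
rewrite big_mkcond /= (eq_bigr (fun x => (tag x == i) * D)); last by move=> x _; case: eqP; rewrite ?mul1n.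
by rewrite -big_distrl /= leq_mul2r card_at_le orbT.
Qed.

(** A non-generic [z] lies on a bad edge, or the vertex or the partner of [z] is
near one of the two ends of the bad edge; the latter excludes O(D^2) choices. *)
Lemma not_generic_le x : badh M x -> 0 < D ->
  \sum_z ~~ generic M x z <= nb + 4 * (D * D).
Proof.
move=> xb D0.
apply: (@leq_trans (\sum_z (badh M z + ((0 < mult M (tag x) (tag (p z))) + ((0 < mult M (tag (p x)) (tag z)) +
   ((tag (p z) == tag x) + (tag z == tag (p x)))))))).
  apply: leq_sum => z _; rewrite /generic (mult_sym MC (tag z)).
  case: (eqVneq x z) => [<-|xz]; first by rewrite xb.
  case: (eqVneq z (p x)) => [->|zpx]; first by rewrite badh_partner // xb.
  rewrite !lt0n; case: badh => //=; case: eqP => //= _; case: eqP => //= _.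
  by rewrite [tag x == _]eq_sym; case: eqP => //= _; case: eqP.
rewrite !big_split /= leq_add2l.
have DD : D <= D * D by rewrite leq_pmulr.
rewrite (_ : 4 * (D * D) = D * D + (D * D + (D * D + D * D))); last by ring.
apply: leq_add; first exact: card_nbr card_at_partner_le.
apply: leq_add; first exact: card_nbr card_at_le.
by apply: leq_add; apply: leq_trans DD; [exact: card_at_partner_le|exact: card_at_le].
Qed.

(** Closed walks of length 3 along distinct edges.  They are the obstructions to
creating a loop, and with [cyc4] to creating a double edge: the switching then
adds an edge between adjacent vertices. *)
Definition cyc3 := \sum_a \sum_b \sum_c
  [&& tag (p a) == tag b, tag (p b) == tag c, tag (p c) == tag a & uniq [:: a; p a; b; p b; c; p c]].

Definition cyc4 := \sum_a \sum_b \sum_c \sum_e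
  [&& tag (p a) == tag b, tag (p b) == tag c, tag (p c) == tag e, tag (p e) == tag a
    & uniq [:: a; p a; b; p b; c; p c; e; p e]].

Definition ends_of (s : seq H) := flatten [seq [:: a; p a] | a <- s].

Lemma uniq_ends_of a s :
  uniq (ends_of (a :: s)) = all (fun b => (a != b) && (a != p b)) s && uniq (ends_of s).
Proof.
have aE t : (t \notin ends_of s) = all (fun b => (t != b) && (t != p b)) s.
  elim: s => //= b s IH; rewrite !inE !negb_or IH.
  by case: (t == b); case: (t == p b).
rewrite /= inE negb_or eq_sym partner_neq //= !aE !andbA; congr (_ && _).
rewrite -all_predI; apply: eq_all => b /=.
rewrite (inj_eq pinj) -[p a == b](inj_eq pinj) pK.
by case: (a == b); case: (a == p b).
Qed.

(** A switching of two edges at a common vertex i creates a loop at i.  The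
candidates only require the common vertex; for [loop_switchings] nothing else
may change. *)
Definition loop_candidates := \sum_x \sum_z ((tag x == tag (p z)) && (x != p z)).
Definition loop_switchings a b := \sum_x \sum_z
  [&& x != z, z != p x, tag x == tag (p z) & sw M x z \in state d a.+1 b].

(** A switching of [x] and [z] creates a double edge next to the edge of [u] if the
new edge joins the same vertices as that of [u]. *)
Definition double_candidates := \sum_x \sum_z \sum_u
  [&& u != x, tag u == tag x, tag (p u) == tag (p z) & p u != p z].
Definition double_switchings a b := \sum_x \sum_z
  [&& x != z, z != p x, tag x != tag (p z), badh (sw M x z) x & sw M x z \in state d a b.+1].

Lemma loop_candidatesE : loop_candidates = \sum_(x : H) \sum_(y : H) ((tag x == tag y) && (x != y)).
Proof. by apply: eq_bigr => x _; rewrite [RHS](reindex_inj pinj). Qed.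

Lemma loop_switchings_le a b : loop_switchings a b <= loop_candidates.
Proof.
apply: leq_sum => x _; apply: leq_sum => z _.
case: eqP => //= _; case: eqP => //= h; case: eqP => //= _.
by case: (eqVneq x (p z)) h => [->|]; rewrite ?pK //; case: (_ \in _).
Qed.

Variables (a b : nat) (MS : M \in state d a b).
Let Mle i j : mult M i j <= 2. Proof. by case/stateP: MS. Qed.

Lemma not_bad x : ~~ badh M x -> mult M (tag x) (tag (p x)) = 1.
Proof. by have := mult_gt0 M x; rewrite /badh; lia. Qed.

Lemma not_bad_loop x : ~~ badh M x -> tag x != tag (p x).
Proof. by apply: contra => /eqP e; rewrite loop_bad. Qed.

Lemma not_bad_parallel x y : ~~ badh M x -> tag x = tag y -> tag (p x) = tag (p y) -> x = y.
Proof. by move=> xb e1 e2; apply/eqP; apply: contraNT xb => xy; exact: mult_ge2 e1 e2. Qed.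

(** Effect on the pairs of multiplicity 2 of a switching of two simple edges that
creates a loop or a second edge between [i] and [j]. *)
Lemma backward_set x z (i := tag x) (j := tag (p z)) (k := tag z) (l := tag (p x)) : x != z -> z != p x ->
  ~~ badh M x -> ~~ badh M z -> mult M i j = (i != j) -> mult M k l = 0 -> k != l ->
  forall s t, mult (sw M x z) s t <= 2 /\ ((mult (sw M x z) s t == 2) = (mult M s t == 2) ||
    (((s, t) == (i, j)) || ((s, t) == (j, i)))).
Proof.
move=> xz zpx xb zb ij kl nkl.
apply: (switch_mult_backward (mult_sym MC) Mle _ ij kl (not_bad xb) (not_bad zb) (not_bad_loop xb) (not_bad_loop zb) nkl).
by move=> s t; have /= := mult_sw MC s t xz zpx; rewrite !addnA.
Qed.

Lemma backward_loop x z : tag x = tag (p z) -> x != p z -> ~~ badh M x -> ~~ badh M z ->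
  mult M (tag x) (tag x) = 0 -> mult M (tag z) (tag (p x)) = 0 ->
  [/\ x != z, z != p x & sw M x z \in state d a.+1 b].
Proof.
move=> e xpz xb zb ii kl.
have xz : x != z by apply/eqP => xz; have := not_bad_loop xb; rewrite e xz eqxx.
have zpx : z != p x by rewrite -(inj_eq pinj) pK eq_sym.
have nkl : tag z != tag (p x).
  by apply/eqP => h; move: xpz; rewrite (not_bad_parallel xb e) ?pK ?eqxx.
have F := backward_set xz zpx xb zb; rewrite -e eqxx in F; have {}F := F ii kl nkl.
split=> //; case/stateP: MS => _ _ aE bE.
apply/stateP; split; [exact: sw_conf|by move=> s t; have [] := F s t| |].
  rewrite (@setU2_card _ (loops (sw M x z)) (loops M) (tag x) (tag x)) ?eqxx ?aE ?addn1 //.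
  - move=> s t; rewrite !inE /= (F s t).2 orbb !xpair_eqE.
    case: (eqVneq (mult M s t) 2) => //= h; case: (s =P tag x) => [sE|]; case: (t =P tag x) => [tE|] //=; rewrite ?andbT ?andbF //.
    by move: h; rewrite sE tE ii.
  - by rewrite !inE /= (F _ _).2 !eqxx !orbT.
  - by rewrite !inE /= (F _ _).2 !eqxx !orbT.
rewrite -bE; congr #|pred_of_set _|; apply/setP => -[s t]; rewrite !inE /= (F s t).2 orbb xpair_eqE.
case: (_ == 2) => //=; case: (s =P tag x) => [->|]; case: (t =P tag x) => [->|] //=; by rewrite ?eqxx.
Qed.

Lemma backward_double x z u : u != x -> tag u = tag x -> tag (p u) = tag (p z) -> p u != p z ->
  ~~ badh M u -> ~~ badh M x -> ~~ badh M z ->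
  tag z != tag (p x) -> mult M (tag z) (tag (p x)) = 0 ->
  [/\ x != z, z != p x, tag x != tag (p z), badh (sw M x z) x & sw M x z \in state d a b.+1].
Proof.
move=> ux e1 e2 uz ub xb zb nkl kl.
have ne : tag x != tag (p z) by rewrite -e1 -e2; exact: not_bad_loop.
have xz : x != z.
  by apply/eqP => xz; move: ux; rewrite (not_bad_parallel ub e1) ?eqxx // e2 xz.
have zpx : z != p x by apply/eqP => zx; move: ne; rewrite zx pK eqxx.
have ij : mult M (tag x) (tag (p z)) = (tag x != tag (p z)).
  by rewrite ne -e1 -e2; exact: not_bad.
have F := backward_set xz zpx xb zb ij kl nkl.
have px : partner (sw M x z) x = p z by rewrite partner_sw // /switch_fun eqxx.
have m2 : mult (sw M x z) (tag x) (tag (p z)) = 2.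
  by apply/eqP; rewrite (F _ _).2 eqxx orbT.
split=> //; first by rewrite /badh px m2.
case/stateP: MS => _ _ aE bE.
apply/stateP; split; [exact: sw_conf|by move=> s t; have [] := F s t| |].
  rewrite -aE; congr #|pred_of_set _|; apply/setP => -[s t]; rewrite !inE /= (F s t).2 !xpair_eqE.
  case: (_ == 2) => //=; case: (s =P t) => [->|]; rewrite ?andbF // andbT.
  apply/negP; case/orP => /andP[/eqP h1 /eqP h2]; move: ne; by rewrite -h1 -h2 eqxx.
rewrite doubleS -bE (@setU2_card _ (doubles (sw M x z)) (doubles M) (tag x) (tag (p z))) ?ne ?addn2 //.
- move=> s t; rewrite !inE /= (F s t).2.
  case: (eqVneq (mult M s t) 2) => h /=; last by rewrite -andbA andbCA andbN andbF.
  rewrite -[LHS]andbT; congr (_ && _); apply/esym; rewrite !xpair_eqE.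
  apply/negP; case/orP => /andP[/eqP h1 /eqP h2]; move: h; rewrite h1 h2 ?ij ?ne //.
  by rewrite (mult_sym MC) ij ne.
- by rewrite !inE /= m2 ne.
- by rewrite !inE /= (F _ _).2 !eqxx !orbT /= eq_sym.
Qed.

Definition cyc3t x y z := [&& tag (p x) == tag y, tag (p y) == tag z, tag (p z) == tag x
  & uniq (ends_of [:: x; y; z])].
Definition cyc4t x y z t := [&& tag (p x) == tag y, tag (p y) == tag z, tag (p z) == tag t, tag (p t) == tag x
  & uniq (ends_of [:: x; y; z; t])].

(** A candidate fails only if one of its edges is bad, its vertex already has a
loop, or the other new edge joins adjacent vertices.  In the first two cases it
is charged to a bad half-edge, in the last to a closed walk of length 3. *)
Lemma loop_count : loop_candidates <= loop_switchings a b + (2 * nb * D + nb * D * D + cyc3).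
Proof.
apply: (@leq_trans (\sum_x \sum_z ([&& x != z, z != p x, tag x == tag (p z) & sw M x z \in state d a.+1 b]
  + ((badh M x && (tag (p z) == tag x)) + ((badh M z && (tag x == tag (p z))) +
   (\sum_u (badh M u && ((tag x == tag u) && (tag (p z) == tag x))) + \sum_c cyc3t z x c)))))).
  apply: leq_sum => x _; apply: leq_sum => z _.
  case: (eqVneq (tag x) (tag (p z))) => //= e; case: (eqVneq x (p z)) => //= xpz.
  case xb: (badh M x) => /=; first by rewrite addnCA.
  case zb: (badh M z) => /=; first by rewrite add0n addnCA.
  rewrite !add0n; have [xz /negPf zb'] : ~~ badh M x /\ ~~ badh M z by rewrite xb zb.
  case ii: (mult M (tag x) (tag x)) => [|m].
    case kl: (mult M (tag z) (tag (p x))) => [|m].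
      by have [-> -> ->] := backward_loop e xpz xz (negbT zb) ii kl.
    have /mult_gt0P[s [s1 s2]] : 0 < mult M (tag z) (tag (p x)) by rewrite kl.
    rewrite (leq_trans _ (leq_addl _ _)) // (leq_trans _ (leq_addl _ _)) //.
    apply: (leq_trans _ (le_sum1 _ (p s))); rewrite /cyc3t !uniq_ends_of -e pK s1 s2 !eqxx /=.
    have lx := not_bad_loop xz; have lz := not_bad_loop (negbT zb).
    rewrite !andbT ?pK.
    have -> : z != x by apply/eqP => h; move: lz; rewrite -e h eqxx.
    have -> : z != p x by rewrite -(inj_eq pinj) pK eq_sym.
    have -> : z != p s by apply/eqP => h; move: lz; rewrite {2}h pK s1 eqxx.
    have -> : z != s by apply/eqP => h; move: lx; rewrite e h s2 eqxx.
    have -> : x != p s by apply/eqP => h; move: lx; rewrite {1}h s2 eqxx.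
    by have -> : x != s by apply/eqP => h; move: lz; rewrite -e -s1 h eqxx.
  have /mult_gt0P[u [u1 u2]] : 0 < mult M (tag x) (tag x) by rewrite ii.
  rewrite (leq_trans _ (leq_addl _ _)) // (leq_trans _ (leq_addr _ _)) //.
  by rewrite (bigD1 u) //= loop_bad ?u1 ?u2 ?eqxx.
under eq_bigr do rewrite !big_split /=.
rewrite !big_split /= leq_add2l.
rewrite mul2n -addnn mulnDl -!addnA; apply: leq_add; last apply: leq_add; last apply: leq_add.
- by apply: sum_and_le => x; exact: card_at_partner_le.
- by rewrite exchange_big /=; apply: sum_and_le => x; exact: card_at_le.
- under eq_bigr do rewrite exchange_big /=.
  rewrite exchange_big /=.
  by apply: sum_and3_le => [u|u x]; [exact: card_at_le|exact: card_at_partner_le].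
- rewrite exchange_big /=; apply: leq_sum => x _; apply: leq_sum => y _; apply: leq_sum => z _.
  exact: leqnn.
Qed.

(** A switching that creates a double edge is a candidate, through the edge [u]
parallel to the new one.  The exception is that the two new edges are parallel to
each other: then the old edges were parallel, or both were loops. *)
Lemma double_count_le : double_switchings a b <= double_candidates + nb * nb.
Proof.
apply: (@leq_trans (\sum_x \sum_z (\sum_u [&& u != x, tag u == tag x, tag (p u) == tag (p z) & p u != p z]
   + (badh M x && badh M z)))); last first.
  under eq_bigr do rewrite big_split /=.
  by rewrite big_split /= leq_add2l; exact: sum_and_le.
apply: leq_sum => x _; apply: leq_sum => z _.
case: (eqVneq x z) => //= xz; case: (eqVneq z (p x)) => //= zpx; case: eqVneq => //= ne.
case bx: (badh _ x) => //=; case st: (_ \in _) => //=.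
have px : partner (sw M x z) x = p z by rewrite partner_sw // /switch_fun eqxx.
move: bx; rewrite /badh px /mult (bigD1 x) //= px !eqxx add1n ltnS lt0n sum_nat_eq0.
move=> /forallPn[u]; rewrite negb_imply eqb0 negbK => /and3P[ux /eqP u1].
have alt : badh M x && badh M z -> 0 < \sum_u [&& u != x, tag u == tag x, tag (p u) == tag (p z) & p u != p z] +
    (badh M x && badh M z) by move=> ->; rewrite addn1.
rewrite partner_sw // /switch_fun (negbTE ux).
case: (eqVneq u (p z)) => [uE|upz]; first by move=> _; move: ne; rewrite -uE u1 eqxx.
case: (eqVneq u z) => [uE|uz].
  move=> /eqP u2; apply: alt; rewrite uE in u1.
  by rewrite (@mult_ge2 _ _ _ x z) // (@mult_ge2 _ _ _ z x) // eq_sym.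
case: (eqVneq u (p x)) => [uE|upx].
  by move=> /eqP u2; apply: alt; rewrite !loop_bad // -uE u1.
move=> /eqP u2; rewrite (leq_trans _ (leq_addr _ _)) //.
by apply: (leq_trans _ (le_sum1 _ u)); rewrite ux u1 u2 !eqxx (inj_eq pinj) uz.
Qed.

(** As in [loop_count], a failing candidate has a bad edge, or else its other new
edge joins equal or adjacent vertices, which closes a walk of length 3 or 4. *)
Lemma double_count_ge : double_candidates <= double_switchings a b + (3 * nb * D * D + cyc3 + cyc4).
Proof.
(* the candidates to which [backward_double] applies *)
pose G x z u := [&& u != x, tag u == tag x, tag (p u) == tag (p z), p u != p z,
  ~~ badh M u, ~~ badh M x, ~~ badh M z, tag z != tag (p x) & mult M (tag z) (tag (p x)) == 0].
have Ggood x z : \sum_u G x z u <= [&& x != z, z != p x, tag x != tag (p z), badh (sw M x z) x & sw M x z \in state d a b.+1].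
  apply: sum_unique => [u|u u'].
    case/and5P=> h1 /eqP h2 /eqP h3 h4 /and5P[h5 h6 h7 h8 /eqP h9].
    by have [-> -> -> -> ->] := backward_double h1 h2 h3 h4 h5 h6 h7 h8 h9.
  case/and5P=> _ /eqP h2 /eqP h3 _ /andP[h5 _] /and5P[_ /eqP h2' /eqP h3' _ _].
  by apply: not_bad_parallel => //; rewrite ?h2' ?h3'.
apply: (@leq_trans (\sum_x \sum_z \sum_u (G x z u +
   ((badh M u && ((tag x == tag u) && (tag (p z) == tag (p u)))) + ((badh M x && ((tag u == tag x) && (tag (p z) == tag (p u)))) +
   ((badh M z && ((tag (p u) == tag (p z)) && (tag x == tag u))) + (cyc3t u (p z) (p x) + \sum_c cyc4t u (p z) c (p x)))))))).
  apply: leq_sum => x _; apply: leq_sum => z _; apply: leq_sum => u _; rewrite /G.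
  case: (eqVneq u x) => //= ux; case: (eqVneq (tag u) (tag x)) => //= h2; case: (eqVneq (tag (p u)) (tag (p z))) => //= h3.
  case: (eqVneq (p u) (p z)) => //= h4; rewrite ?andbT.
  case ub: (badh M u) => //=; case xb: (badh M x) => //=; case zb: (badh M z) => //=; rewrite !add0n.
  have lx := not_bad_loop (negbT xb); have lz := not_bad_loop (negbT zb); have lu := not_bad_loop (negbT ub).
  have upz : u != p z by apply/eqP => h; move: lu; rewrite h3 -h eqxx.
  have uz : u != z by rewrite -(inj_eq pinj).
  have upx : u != p x by apply/eqP => h; move: lx; rewrite -h2 -h eqxx.
  have zx : z != x.
    by apply/eqP => h; move: ux; rewrite (not_bad_parallel (negbT ub) h2) ?eqxx // h3 h.
  have pzx : p z != x by apply/eqP => h; move: lu; rewrite h3 h h2 eqxx.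
  case: (eqVneq (tag z) (tag (p x))) => [kl|nkl] /=.
    rewrite add0n (leq_trans _ (leq_addr _ _)) // /cyc3t !uniq_ends_of h3 !pK kl h2 !eqxx /=.
    by rewrite ?pK !andbT upz uz upx ux (inj_eq pinj) zx pzx.
  case kl: (mult M (tag z) (tag (p x))) => [|m] //=.
  have /mult_gt0P[c [c1 c2]] : 0 < mult M (tag z) (tag (p x)) by rewrite kl.
  rewrite add0n (leq_trans _ (leq_addl _ _)) //.
  have nzu : tag z != tag u.
    by apply/eqP => h; move: uz; rewrite (not_bad_parallel (negbT ub) (esym h)) ?eqxx.
  apply: (leq_trans _ (le_sum1 _ c)); rewrite /cyc4t !uniq_ends_of h3 !pK c1 c2 h2 !eqxx /=.
  rewrite !pK [p z == p x](inj_eq pinj) upz uz upx ux zx pzx /= !andbT.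
  have -> : u != c by apply/eqP => h; move: nzu; rewrite h c1 eqxx.
  have -> : u != p c by apply/eqP => h; move: lz; rewrite -h3 h pK c1 eqxx.
  have -> : p z != c by apply/eqP => h; move: lz; rewrite h c1 eqxx.
  have -> : p z != p c.
    apply/eqP => h; move: ux; rewrite (not_bad_parallel (negbT ub) h2) ?eqxx // h3.
    by rewrite h.
  have -> : c != p x by apply/eqP => h; move: nkl; rewrite -c1 h eqxx.
  by have -> : c != x by apply/eqP => h; move: nzu; rewrite -c1 h h2 eqxx.
rewrite !sum3_split; apply: leq_add.
  by apply: leq_sum => x _; apply: leq_sum => z _; exact: Ggood.
rewrite (_ : 3 * nb * D * D = nb * D * D + (nb * D * D + nb * D * D)); last by ring.
rewrite -!addnA; apply: leq_add; last apply: leq_add; last apply: leq_add; last apply: leq_add.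
- under eq_bigr do rewrite exchange_big /=.
  rewrite exchange_big /=; apply: sum_and3_le => [u|u x]; [exact: card_at_le|exact: card_at_partner_le].
- under eq_bigr do rewrite exchange_big /=.
  by apply: sum_and3_le => [u|u x]; [exact: card_at_le|exact: card_at_partner_le].
- rewrite exchange_big /=; under eq_bigr do rewrite exchange_big /=.
  by apply: sum_and3_le => [u|u x]; [exact: card_at_partner_le|exact: card_at_le].
- under eq_bigr do rewrite exchange_big /=.
  rewrite exchange_big /=; apply: leq_sum => u _; rewrite exchange_big [leqRHS](reindex_inj pinj) /=.
  by apply: leq_sum => z _; rewrite [leqRHS](reindex_inj pinj) /=; apply: leq_sum => x _.
- under eq_bigr do rewrite exchange_big /=.
  rewrite exchange_big /=; apply: leq_sum => u _; rewrite exchange_big [leqRHS](reindex_inj pinj) /=.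
  apply: leq_sum => z _; rewrite exchange_big /=; apply: leq_sum => c _.
  by rewrite [leqRHS](reindex_inj pinj) /=; apply: leq_sum => x _.
Qed.
End Config.
End Counts.

Local Open Scope ring_scope.

(** * First moments over configurations *)

Lemma sum_bool_inj (S T : finType) (f : S -> T) (q : S -> bool) (r : T -> bool) :
  {in q &, injective f} -> (forall s, q s -> r (f s)) -> (\sum_s q s <= \sum_t r t)%N.
Proof.
move=> fi qr.
have cE (U : finType) (P : U -> bool) : (\sum_u P u)%N = #|[set u | P u]%SET|.
  by rewrite -sum1_card [RHS]big_mkcond; apply: eq_bigr => u _; rewrite inE; case: (P u).
rewrite !cE -(card_in_imset (f := f) (D := mem [set s | q s]%SET)).
  apply: subset_leq_card; apply/fintype.subsetP => t /imsetP[s qs ->].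
  by move: qs; rewrite !inE; exact: qr.
by move=> s s'; rewrite !inE; exact: fi.
Qed.

Lemma leq_andl (a b : bool) : (a && b <= a)%N.
Proof. by case: a; case: b. Qed.

Section Expectation.
Variables (R : realType) (n : nat) (d : 'I_n -> nat).
Local Notation H := (halfedge d).
Implicit Types (M : matching d) (x y z u : H) (i j : 'I_n) (s : seq (H * H)).
Local Notation Conf := (configurations d).
Local Notation N := #|{: H}|.

Definition Ex (F : matching d -> R) : R := #|Conf|%:R^-1 * \sum_(M in Conf) F M.

Definition joins M s := all (fun e => partner M e.1 == e.2) s.
Definition halfs s := flatten [seq [:: e.1; e.2] | e <- s].

Lemma size_halfs s : size (halfs s) = (size s).*2.
Proof. by elim: s => //= e s IH; rewrite IH doubleS. Qed.

Lemma joins_partner M s y : M \in Conf -> joins M s -> y \in halfs s -> partner M y \in halfs s.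
Proof.
move=> MC; elim: s => //= -[a b] s IH /= /andP[/eqP ab js]; rewrite !inE.
case/or3P => [/eqP->|/eqP->|/(IH js)->]; rewrite ?orbT //.
  by rewrite ab eqxx orbT.
by rewrite -ab (partnerK MC) eqxx.
Qed.

Definition num_joining s := #|[set M in Conf | joins M s]%SET|.

(** The transposition of [y] and [y'] maps the configurations counted on the left
to those counted on the right. *)
Lemma num_joining_swap x y y' s : uniq [:: x, y & halfs s] -> uniq [:: x, y' & halfs s] ->
  (num_joining ((x, y) :: s) <= num_joining ((x, y') :: s))%N.
Proof.
rewrite /= !inE !negb_or => /and3P[/andP[xy xs] ys us] /and3P[/andP[xy' _] ys' _].
pose pi := tperm y y'.
have pix : pi x = x by rewrite /pi tpermD // eq_sym.
have piid z : z \in halfs s -> pi z = z.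
  by move=> zs; rewrite /pi tpermD //; [apply: contraNneq ys => ->|apply: contraNneq ys' => ->].
rewrite /num_joining -(card_in_imset (f := relabel pi)); last first.
  by move=> M M' /setIdP[MC _] /setIdP[M'C _]; exact: relabel_inj.
apply: subset_leq_card; apply/fintype.subsetP => _ /imsetP[M /setIdP[MC /= /andP[/eqP xE js]] ->].
apply/setIdP; split; first exact: relabel_conf.
apply/andP; split; first by rewrite -{1}pix partner_relabel // xE /pi tpermL.
apply/allP => -[a b] ab; have /allP/(_ _ ab)/= /eqP pab := js.
have ain : a \in halfs s by apply/flattenP; exists [:: a; b]; rewrite ?inE ?eqxx //; apply/mapP; exists (a, b).
have bin : b \in halfs s by apply/flattenP; exists [:: a; b]; rewrite ?inE ?eqxx ?orbT //; apply/mapP; exists (a, b).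
by rewrite -{1}(piid a) // partner_relabel // pab piid.
Qed.

(** A free half-edge is equally likely to be paired with any other free one. *)
Lemma num_joining_cons x y s : uniq [:: x, y & halfs s] -> (num_joining s = num_joining ((x, y) :: s) * (N - (size s).*2.+1))%N.
Proof.
move=> us; rewrite {1}/num_joining -sum1_card (partition_big (fun M => partner M x) predT) //=.
rewrite (bigID (fun y' => y' \in x :: halfs s)) /= big1 ?add0n; last first.
  move=> y' y's; rewrite big_pred0 // => M; apply/negP => /andP[/setIdP[MC js] /eqP e].
  move: y's; rewrite -e inE => /orP[/eqP h|h]; first by have := partner_neq x MC; rewrite h eqxx.
  by have := joins_partner MC js h; rewrite (partnerK MC); move: us; rewrite /= inE negb_or => /andP[/andP[_ /negbTE ->]].
rewrite (eq_bigr (fun=> num_joining ((x, y) :: s))) => [|y' y's]; last first.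
  have uy' : uniq [:: x, y' & halfs s].
    move: us y's; rewrite /= !inE !negb_or => /and3P[/andP[_ xs] _ us] /andP[xy' y's].
    by rewrite xs us y's eq_sym xy'.
  transitivity (num_joining ((x, y') :: s)).
    rewrite /num_joining -sum1_card; apply: eq_bigl => M.
    apply/andP/setIdP => [[/setIdP[MC js] e]|[MC /andP[e js]]]; first by split=> //=; rewrite e.
    by split=> //; apply/setIdP.
  by apply/eqP; rewrite eqn_leq !num_joining_swap.
rewrite sum_nat_const mulnC; congr (_ * _)%N.
have -> : #|[pred y' | y' \notin x :: halfs s]| = #|[predC (x :: halfs s)]| by apply: eq_card.
have := cardC [predC (x :: halfs s)].
have -> : #|[predC [predC (x :: halfs s)]]| = #|mem (x :: halfs s)|.
  by apply: eq_card => t; rewrite !inE negbK.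
have -> : #|mem (x :: halfs s)| = (size s).*2.+1.
  rewrite (card_uniqP _) /= ?size_halfs //.
  by move: us; rewrite /= inE negb_or => /and3P[/andP[_ ->] _ ->].
by move=> <-; rewrite addnK.
Qed.

Lemma ExE (F G : matching d -> R) : (forall M, M \in Conf -> F M = G M) -> Ex F = Ex G.
Proof. by move=> FG; rewrite /Ex; congr (_ * _); apply: eq_bigr. Qed.

Lemma Ex_le (F G : matching d -> R) : (forall M, M \in Conf -> F M <= G M) -> Ex F <= Ex G.
Proof. by move=> FG; rewrite /Ex ler_wpM2l ?invr_ge0 ?ler0n //; apply: ler_sum. Qed.

Lemma ExD (F G : matching d -> R) : Ex (fun M => F M + G M) = Ex F + Ex G.
Proof. by rewrite /Ex big_split mulrDr. Qed.

Lemma ExZ (c : R) (F : matching d -> R) : Ex (fun M => c * F M) = c * Ex F.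
Proof. by rewrite /Ex -big_distrr /= mulrCA. Qed.

Lemma Ex_sum (T : finType) (P : pred T) (F : T -> matching d -> R) :
  Ex (fun M => \sum_(t | P t) F t M) = \sum_(t | P t) Ex (F t).
Proof. by rewrite /Ex exchange_big /= -big_distrr. Qed.

Lemma Ex_ge0 (F : matching d -> R) : (forall M, M \in Conf -> 0 <= F M) -> 0 <= Ex F.
Proof. by move=> F0; rewrite /Ex mulr_ge0 ?invr_ge0 ?ler0n ?sumr_ge0. Qed.

Hypothesis Cgt0 : (0 < #|Conf|)%N.

Lemma Ex_cst c : Ex (fun=> c) = c.
Proof. by rewrite /Ex sumr_const -[c *+ _]mulr_natl mulrA mulVf ?mul1r // pnatr_eq0 -lt0n. Qed.

Lemma Ex_norm_le (F : matching d -> R) : `|Ex F| <= Ex (fun M => `|F M|).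
Proof. by rewrite /Ex normrM ger0_norm ?invr_ge0 ?ler0n // ler_wpM2l ?invr_ge0 ?ler0n ?ler_norm_sum. Qed.

Definition joins_prob s : R := Ex (fun M => (joins M s)%:R).

Lemma joins_probE s : joins_prob s = (num_joining s)%:R / #|Conf|%:R.
Proof.
rewrite /joins_prob /Ex mulrC; congr (_ / _); rewrite /num_joining -sum1_card natr_sum [LHS]big_mkcond [RHS]big_mkcond.
apply: eq_bigr => M _ /=; case: ifP => MC.
  by case: (boolP (joins M s)) => js; [rewrite ifT //; apply/setIdP|rewrite ifF //; apply/negP => /setIdP[_]; exact/negP].
by rewrite ifF //; apply/negP => /setIdP[]; rewrite MC.
Qed.

Lemma joins_prob_cons x y s : uniq [:: x, y & halfs s] -> ((size s).*2.+1 < N)%N ->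
  joins_prob ((x, y) :: s) = joins_prob s / (N%:R - (size s).*2.+1%:R).
Proof.
move=> us sN; rewrite !joins_probE (num_joining_cons us) natrM -natrB ?(ltnW sN) //.
have : ((N - (size s).*2.+1)%:R : R) != 0 by rewrite pnatr_eq0 subn_eq0 -ltnNge.
by move=> h; field; rewrite h pnatr_eq0 -lt0n Cgt0.
Qed.

Lemma joins_prob_nil : joins_prob [::] = 1.
Proof. by rewrite /joins_prob -[RHS](Ex_cst 1). Qed.

Lemma joins_prob1 x y : x != y -> (1 < N)%N -> joins_prob [:: (x, y)] = (N%:R - 1)^-1.
Proof. by move=> xy N1; rewrite joins_prob_cons ?joins_prob_nil ?div1r //= inE xy. Qed.

Lemma joins_prob2 x y u v : uniq [:: x; y; u; v] -> (3 < N)%N ->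
  joins_prob [:: (x, y); (u, v)] = ((N%:R - 1) * (N%:R - 3))^-1.
Proof.
move=> us N3; rewrite joins_prob_cons // joins_prob1 //; last exact: (leq_ltn_trans _ N3).
  by rewrite /= invfM.
by move: us; rewrite /= !inE => /and4P[_ _ ->].
Qed.

Hypothesis N16 : (16 <= N)%N.

Lemma joins_prob_le s : uniq (halfs s) -> (size s <= 4)%N -> joins_prob s <= (2 / N%:R) ^+ size s.
Proof.
elim: s => [|[x y] s IH]; first by rewrite joins_prob_nil expr0.
move=> us ss; rewrite joins_prob_cons //; last by move: ss N16 => /=; lia.
have us' : uniq (halfs s) by move: us => /= /and3P[].
have IH' := IH us' (ltnW ss).
have N0 : (16 : R) <= N%:R by rewrite ler_nat.
have s4 : ((size s).*2.+1%:R : R) <= 7 by rewrite ler_nat; move: ss => /=; lia.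
rewrite exprS mulrC; apply: ler_pM => //.
- by rewrite invr_ge0; lra.
- by apply: Ex_ge0 => M _; rewrite ler0n.
- rewrite -div1r ler_pdivrMr; last lra.
  by rewrite mulrAC ler_pdivlMr; lra.
Qed.

(** The union bound for a random count: with m prescribed pairs, each of probability
at most 2 / N given the previous ones. *)
Lemma Ex_joins_le (T : finType) (P : T -> bool) (f : T -> seq (H * H)) (F : matching d -> nat) m K :
  (forall M, M \in Conf -> F M <= \sum_t (P t && joins M (f t)))%N ->
  (forall t, P t -> uniq (halfs (f t)) /\ size (f t) = m) -> (m <= 4)%N -> (\sum_t P t <= K)%N ->
  Ex (fun M => (F M)%:R) <= K%:R * (2 / N%:R) ^+ m.
Proof.
move=> FP fP m4 PK; apply: (@le_trans _ _ (\sum_(t | P t) joins_prob (f t))).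
  rewrite /joins_prob -Ex_sum; apply: Ex_le => M MC; rewrite -natr_sum ler_nat [leqRHS]big_mkcond.
  by apply: (leq_trans (FP _ MC)); apply: leq_sum => t _; case: (P t).
apply: (@le_trans _ _ (\sum_(t | P t) (2 / N%:R) ^+ m)).
  by apply: ler_sum => t /fP[us ss]; rewrite -ss joins_prob_le ?ss.
rewrite sumr_const -[leLHS]mulr_natl ler_wpM2r ?exprn_ge0 ?divr_ge0 ?ler0n // ler_nat.
by rewrite (leq_trans _ PK) // -sum1_card big_mkcond; apply: leq_sum => t _; rewrite unfold_in; case: (P t).
Qed.

(** The sum of the squares of the degrees. *)
Definition pairs2 := (\sum_(x : H) \sum_(y : H) (tag x == tag y))%N.
Definition same (e : H * H) := tag e.1 == tag e.2.

Lemma pairs2E : pairs2 = (\sum_e same e)%N.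
Proof. by rewrite /pairs2 pair_big. Qed.

Lemma sum_andM (S T : finType) (f : S -> bool) (g : T -> bool) :
  (\sum_t (f t.1 && g t.2) = (\sum_s f s) * (\sum_t g t))%N.
Proof.
rewrite big_distrl /= -(pair_big xpredT xpredT (fun a b => (f a && g b : nat))) /=; apply: eq_bigr => a _.
by rewrite big_distrr /=; apply: eq_bigr => b _; case: (f a); rewrite ?mul1n ?mul0n.
Qed.

Lemma pairs2_2 : (\sum_e (same e.1 && same e.2) = pairs2 ^ 2)%N.
Proof. by rewrite sum_andM -pairs2E mulnn. Qed.

Lemma pairs2_3 : (\sum_e (same e.1 && (same e.2.1 && same e.2.2)) = pairs2 ^ 3)%N.
Proof.
by rewrite (sum_andM same (fun e => same e.1 && same e.2)) pairs2_2 -pairs2E expnS.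
Qed.

Lemma pairs2_4 : (\sum_e (same e.1 && (same e.2.1 && (same e.2.2.1 && same e.2.2.2))) = pairs2 ^ 4)%N.
Proof.
by rewrite (sum_andM same (fun e => same e.1 && (same e.2.1 && same e.2.2))) pairs2_3 -pairs2E expnS.
Qed.

Lemma Ex_cyc3 : Ex (fun M => (cyc3 M)%:R) <= (pairs2 ^ 3)%:R * (2 / N%:R) ^+ 3.
Proof.
pose P (e : (H * H) * ((H * H) * (H * H))) := [&& same e.1, same e.2.1 & same e.2.2] &&
   uniq [:: e.2.2.2; e.1.1; e.1.2; e.2.1.1; e.2.1.2; e.2.2.1].
pose f (e : (H * H) * ((H * H) * (H * H))) := [:: (e.2.2.2, e.1.1); (e.1.2, e.2.1.1); (e.2.1.2, e.2.2.1)].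
apply: (@Ex_joins_le _ P f) => //; last first.
- by rewrite -pairs2_3; apply: leq_sum => e _; exact: leq_andl.
- by move=> t /andP[].
move=> M MC; rewrite /cyc3.
under eq_bigr do rewrite pair_big /=.
rewrite pair_big /=.
apply: (sum_bool_inj (f := fun s : H * (H * H) => ((partner M s.1, s.2.1), ((partner M s.2.1, s.2.2), (partner M s.2.2, s.1))))).
  by move=> [a [b c]] [a' [b' c']] _ _ [_ -> _ -> _ ->].
move=> [a [b c]] /= /and4P[/eqP h1 /eqP h2 /eqP h3 us].
by rewrite /P /same /= h1 h2 h3 !eqxx /=; move: us => /= ->.
Qed.

Lemma Ex_cyc4 : Ex (fun M => (cyc4 M)%:R) <= (pairs2 ^ 4)%:R * (2 / N%:R) ^+ 4.
Proof.
pose P (e : (H * H) * ((H * H) * ((H * H) * (H * H)))) := [&& same e.1, same e.2.1, same e.2.2.1 & same e.2.2.2] &&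
   uniq [:: e.2.2.2.2; e.1.1; e.1.2; e.2.1.1; e.2.1.2; e.2.2.1.1; e.2.2.1.2; e.2.2.2.1].
pose f (e : (H * H) * ((H * H) * ((H * H) * (H * H)))) := [:: (e.2.2.2.2, e.1.1); (e.1.2, e.2.1.1); (e.2.1.2, e.2.2.1.1); (e.2.2.1.2, e.2.2.2.1)].
apply: (@Ex_joins_le _ P f) => //; last first.
- by rewrite -pairs2_4; apply: leq_sum => e _; exact: leq_andl.
- by move=> t /andP[].
move=> M MC; rewrite /cyc4.
under eq_bigr do under eq_bigr do rewrite pair_big /=.
under eq_bigr do rewrite pair_big /=.
rewrite pair_big /=.
apply: (sum_bool_inj (f := fun s : H * (H * (H * H)) => ((partner M s.1, s.2.1), ((partner M s.2.1, s.2.2.1),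
  ((partner M s.2.2.1, s.2.2.2), (partner M s.2.2.2, s.1)))))).
  by move=> [a [b [c e]]] [a' [b' [c' e']]] _ _ [_ -> _ -> _ -> _ ->].
move=> [a [b [c e]]] /= /and5P[/eqP h1 /eqP h2 /eqP h3 /eqP h4 us].
by rewrite /P /same /= h1 h2 h3 h4 !eqxx /=; move: us => /= ->.
Qed.

Definition num_loops M := (\sum_x (tag x == tag (partner M x)))%N.
Definition num_par M := (\sum_x \sum_y [&& tag x == tag y, tag (partner M x) == tag (partner M y)
  & uniq [:: x; partner M x; y; partner M y]])%N.
Definition num_par_loops M := (\sum_x \sum_y [&& tag x == tag y, tag x == tag (partner M x), tag x == tag (partner M y)
  & uniq [:: x; partner M x; y; partner M y]])%N.
Definition num_triples M := (\sum_x \sum_y \sum_z [&& tag x == tag y, tag x == tag z,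
  tag (partner M x) == tag (partner M y), tag (partner M x) == tag (partner M z)
  & uniq [:: x; partner M x; y; partner M y; z; partner M z]])%N.

Lemma Ex_num_loops : Ex (fun M => (num_loops M)%:R) <= pairs2%:R * (2 / N%:R) ^+ 1.
Proof.
pose P (e : H * H) := same e && uniq [:: e.1; e.2].
apply: (@Ex_joins_le _ P (fun e => [:: e])) => //; last first.
- by rewrite pairs2E; apply: leq_sum => e _; exact: leq_andl.
- by move=> t /andP[].
move=> M MC; apply: (sum_bool_inj (f := fun x : H => (x, partner M x))).
  by move=> x y _ _ [->].
move=> x /= xx; rewrite eqxx andbT /P /same /= xx /= inE eq_sym partner_neq //.
Qed.

Lemma Ex_num_par : Ex (fun M => (num_par M)%:R) <= (pairs2 ^ 2)%:R * (2 / N%:R) ^+ 2.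
Proof.
pose P (e : (H * H) * (H * H)) := (same e.1 && same e.2) && uniq [:: e.1.1; e.2.1; e.1.2; e.2.2].
apply: (@Ex_joins_le _ P (fun e => [:: (e.1.1, e.2.1); (e.1.2, e.2.2)])) => //; last first.
- by rewrite -pairs2_2; apply: leq_sum => e _; exact: leq_andl.
- by move=> t /andP[].
move=> M MC; rewrite /num_par pair_big /=.
apply: (sum_bool_inj (f := fun s : H * H => ((s.1, s.2), (partner M s.1, partner M s.2)))).
  by move=> [x y] [x' y'] _ _ [-> ->].
move=> [x y] /= /and3P[e1 e2 us].
by rewrite /P /same /= e1 e2 !eqxx /=; move: us => /= ->.
Qed.

Lemma pairs2_triple : ((\sum_(x : H) \sum_(y : H) \sum_(z : H) ((tag x == tag y) && (tag x == tag z))) <=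
  pairs2 * maxdeg d)%N.
Proof.
rewrite /pairs2 big_distrl /=; apply: leq_sum => x _; apply: sum_and_le => y.
by apply: leq_trans (card_at_le d (tag x)); apply: leq_sum => z _; rewrite eq_sym.
Qed.

Lemma Ex_num_par_loops :
  Ex (fun M => (num_par_loops M)%:R) <= (pairs2 * maxdeg d * maxdeg d)%:R * (2 / N%:R) ^+ 2.
Proof.
pose P (e : (H * H) * (H * H)) := [&& same e.1, tag e.1.1 == tag e.2.1 & tag e.1.1 == tag e.2.2] && uniq [:: e.1.1; e.2.1; e.1.2; e.2.2].
apply: (@Ex_joins_le _ P (fun e => [:: (e.1.1, e.2.1); (e.1.2, e.2.2)])) => //; last first.
- apply: (@leq_trans (\sum_(e : (H * H) * (H * H)) [&& same e.1, tag e.1.1 == tag e.2.1 & tag e.1.1 == tag e.2.2])).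
    by apply: leq_sum => e _; exact: leq_andl.
  rewrite -(pair_big xpredT xpredT (fun e f : H * H => [&& same e, tag e.1 == tag f.1 & tag e.1 == tag f.2] : nat)) /=.
  rewrite pairs2E.
  have cd (x : H) : (\sum_(y : H) (tag x == tag y) <= maxdeg d)%N.
    by apply: leq_trans (card_at_le d (tag x)); apply: leq_sum => y _; rewrite eq_sym.
  have : (\sum_(e : H * H) \sum_(y : H) \sum_(z : H) (same e && ((tag e.1 == tag y) && (tag e.1 == tag z))) <= (\sum_e same e) * maxdeg d * maxdeg d)%N.
    by apply: sum_and3_le => [e|e y]; exact: cd.
  by apply: leq_trans; apply: leq_sum => e _; rewrite pair_big.
- by move=> t /andP[].
move=> M MC; rewrite /num_par_loops pair_big /=.
apply: (sum_bool_inj (f := fun s : H * H => ((s.1, s.2), (partner M s.1, partner M s.2)))).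
  by move=> [x y] [x' y'] _ _ [-> ->].
move=> [x y] /= /and4P[e1 e2 e3 us].
by rewrite /P /same /= e1 e2 e3 !eqxx /=; move: us => /= ->.
Qed.

Lemma Ex_num_triples :
  Ex (fun M => (num_triples M)%:R) <= ((pairs2 * maxdeg d) ^ 2)%:R * (2 / N%:R) ^+ 3.
Proof.
pose Q (e : H * (H * H)) := (tag e.1 == tag e.2.1) && (tag e.1 == tag e.2.2).
pose P (e : (H * (H * H)) * (H * (H * H))) := (Q e.1 && Q e.2) && uniq [:: e.1.1; e.2.1; e.1.2.1; e.2.2.1; e.1.2.2; e.2.2.2].
apply: (@Ex_joins_le _ P (fun e => [:: (e.1.1, e.2.1); (e.1.2.1, e.2.2.1); (e.1.2.2, e.2.2.2)])) => //; last first.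
- apply: (@leq_trans (\sum_e (Q e.1 && Q e.2))).
    by apply: leq_sum => e _; exact: leq_andl.
  rewrite sum_andM mulnn leq_sqr; apply: leq_trans pairs2_triple.
  under [leqRHS]eq_bigr do rewrite pair_big.
  by rewrite pair_big.
- by move=> t /andP[].
move=> M MC; rewrite /num_triples.
under eq_bigr do rewrite pair_big /=.
rewrite pair_big /=.
apply: (sum_bool_inj (f := fun s : H * (H * H) => (s, (partner M s.1, (partner M s.2.1, partner M s.2.2))))).
  by move=> x y _ _ [->].
move=> [x [y z]] /= /and5P[e1 e2 e3 e4 us].
by rewrite /P /Q /= e1 e2 e3 e4 !eqxx /=; move: us => /= ->.
Qed.

End Expectation.

(** * Concentration of the number of ways to create a double edge *)

Lemma inv_sub_le (F : realFieldType) (v m : F) : 16 <= v -> 0 <= m -> m <= 7 -> 0 <= (v - m)^-1 <= 2 / v.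
Proof.
move=> v16 m0 m7; apply/andP; split; first by rewrite invr_ge0; lra.
rewrite ler_pdivlMr; last lra.
by rewrite mulrC ler_pdivrMr; lra.
Qed.

Section Moments.
Variables (R : realType) (n : nat) (d : 'I_n -> nat).
Local Notation H := (halfedge d).
Implicit Types (M : matching d) (x y z u : H) (i j : 'I_n).
Local Notation Conf := (configurations d).
Local Notation N := #|{: H}|.
Local Notation D := (maxdeg d).

Lemma mult_card M i j : mult M i j = #|[set x | (tag x == i) && (tag (partner M x) == j)]%SET|.
Proof.
by rewrite /mult -sum1_card [RHS]big_mkcond; apply: eq_bigr => x _; rewrite inE; case: (_ && _).
Qed.

Section Config.
Variables (M : matching d) (MC : M \in Conf).
Local Notation p := (partner M).
Let pK := partnerK MC.
Let pinj := inv_inj pK.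

Lemma uniq2 x y : x != y -> x != p y -> uniq [:: x; p x; y; p y].
Proof.
move=> xy xpy; have := uniq_ends_of MC x [:: y]; rewrite (uniq_ends_of MC y [::]) /= xy xpy.
by [].
Qed.

Lemma num_bad_le : (\sum_x badh M x <= num_loops M + num_par M)%N.
Proof.
rewrite -big_split /=; apply: leq_sum => x _.
case bx: (badh M x) => //=; case: (eqVneq (tag x) (tag (p x))) => //= nl.
move: bx; rewrite /badh mult_card => /card_gt1P[a [b [aS bS ab]]].
have [y [yx yS]] : exists y, y != x /\ y \in [set u | (tag u == tag x) && (tag (p u) == tag (p x))]%SET.
  case: (eqVneq a x) => [ax|ax]; last by exists a.
    by exists b; split=> //; rewrite -ax eq_sym.
move: yS; rewrite inE => /andP[/eqP e1 /eqP e2].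
have xpy : x != p y.
  by apply/eqP => h; move: nl; rewrite -e2 -h eqxx.
have := uniq2 _ xpy; rewrite eq_sym => /(_ yx) U.
by rewrite add0n (bigD1 y) //= e1 e2 !eqxx /=; move: U => /= ->.
Qed.

(** A pair of multiplicity at least 3 gives three parallel edges, or two loops at a
vertex. *)
Lemma not_clean : ~~ clean M -> (0 < num_par_loops M + num_triples M)%N.
Proof.
case/forallPn => i /forallPn[j]; rewrite -ltnNge mult_card => /card_gt2P[x [y [z []]]].
rewrite !inE => -[/andP[/eqP x1 /eqP x2] /andP[/eqP y1 /eqP y2] /andP[/eqP z1 /eqP z2]] [xy yz zx].
have [ij|ij] := eqVneq i j.
  have [w [w1 w2 xw xpw]] : exists w, [/\ tag w = i, tag (p w) = i, x != w & x != p w].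
    case: (eqVneq x (p y)) => [xpy|xpy]; last by exists y; split=> //; rewrite ij.
    exists z; split=> //; [by rewrite ij|by rewrite eq_sym|].
    by rewrite xpy (inj_eq pinj).
  rewrite ltn_addr // /num_par_loops (bigD1 x) //= (bigD1 w) //= x1 x2 w1 w2 ij !eqxx /=.
  by have := uniq2 xw xpw => /= ->.
rewrite ltn_addl // /num_triples (bigD1 x) //= (bigD1 y) //= (bigD1 z) //= x1 x2 y1 y2 z1 z2 !eqxx /=.
have neq a b : tag a = i -> tag (p b) = j -> a != p b.
  by move=> a1 b2; apply/eqP => h; move: ij; rewrite -a1 -b2 h eqxx.
have U : uniq [:: x; p x; y; p y; z; p z].
  by rewrite -[uniq _]/(uniq (ends_of M [:: x; y; z])) !(uniq_ends_of MC) /= xy yz (eq_sym x z) zx !neq.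
by move: U => /= ->.
Qed.

(** The degree of the vertex of [u] minus 1. *)
Definition others u := (\sum_(x : H) ((u != x) && (tag u == tag x)))%N.

(** Choosing [x] at the vertex of [u] and [partner M z] at that of [partner M u]. *)
Lemma double_candidatesE : double_candidates M = (\sum_u others u * others (p u))%N.
Proof.
rewrite /double_candidates.
under eq_bigr do rewrite exchange_big /=.
rewrite exchange_big /=; apply: eq_bigr => u _.
rewrite /others big_distrl; apply: eq_bigr => x _ /=.
rewrite big_distrr [RHS](reindex_inj pinj) /=; apply: eq_bigr => z _.
by case: (u != x); case: (_ == _); rewrite ?mul0n //= mul1n andbC.
Qed.
End Config.

Lemma others_le u : (others u <= D)%N.
Proof.
apply: leq_trans (card_at_le d (tag u)); apply: leq_sum => x _.
by rewrite [tag x == _]eq_sym; case: (u != x).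
Qed.

Lemma sum_others : (\sum_u others u = \sum_(x : H) \sum_(y : H) ((tag x == tag y) && (x != y)))%N.
Proof. by apply: eq_bigr => x _; apply: eq_bigr => y _; rewrite andbC. Qed.

Lemma sum_others_le : (\sum_u others u <= pairs2 d)%N.
Proof.
by rewrite sum_others; apply: leq_sum => x _; apply: leq_sum => y _; exact: leq_andl.
Qed.

Hypothesis Cgt0 : (0 < #|Conf|)%N.
Hypothesis N16 : (16 <= N)%N.

Lemma Ex_partner (f : H -> H -> R) :
  Ex (fun M => \sum_x f x (partner M x)) = (N%:R - 1)^-1 * \sum_x \sum_(y | x != y) f x y.
Proof.
rewrite Ex_sum big_distrr; apply: eq_bigr => x _ /=; rewrite big_distrr /=.
transitivity (Ex (fun M => \sum_(y | x != y) f x y * (joins M [:: (x, y)])%:R)).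
  apply: ExE => M MC; rewrite (bigD1 (partner M x)) 1?eq_sym ?partner_neq //= eqxx mulr1 big1 ?addr0 //.
  by move=> y /andP[_ ypx]; rewrite eq_sym (negbTE ypx) /= mulr0.
rewrite Ex_sum; apply: eq_bigr => y xy; rewrite ExZ mulrC -/(joins_prob R _) joins_prob1 //; lia.
Qed.

Let c u : R := (others u)%:R.
Let S : R := \sum_u c u.
Let Q : R := \sum_u c u ^+ 2.
Let Y M : R := (double_candidates M)%:R.

Lemma double_candidates_others M : M \in Conf -> Y M = \sum_u c u * c (partner M u).
Proof. by move=> MC; rewrite /Y double_candidatesE // natr_sum; apply: eq_bigr => u _; rewrite natrM. Qed.

Lemma Ex_double_candidates : Ex Y = (S ^+ 2 - Q) / (N%:R - 1).
Proof.
rewrite (ExE double_candidates_others) (Ex_partner (fun u v => c u * c v)) mulrC; congr (_ / _).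
apply/eqP; rewrite eq_sym subr_eq expr2 /S mulr_suml /Q -big_split /=; apply/eqP; apply: eq_bigr => u _.
rewrite [in LHS](bigD1 u) //= mulrDr expr2 addrC mulr_sumr; congr (_ + _).
by apply: eq_bigl => v; rewrite eq_sym.
Qed.

(** Expanding the square, the terms where both half-edges are on the same edge give
the first summand, the others only involve the joint law of two edges. *)
Lemma Ex_double_candidates_sqr : Ex (fun M => Y M ^+ 2) <= (2 * Q ^+ 2) / (N%:R - 1) + S ^+ 4 / ((N%:R - 1) * (N%:R - 3)).
Proof.
have c0 u : 0 <= c u by rewrite ler0n.
have N0 : (16 : R) <= N%:R by rewrite ler_nat.
pose F1 M : R := \sum_u 2 * c u ^+ 2 * c (partner M u) ^+ 2.
pose T : finType := (H * H * (H * H))%type.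
pose F2 M : R := \sum_(t : T | uniq [:: t.1.1; t.1.2; t.2.1; t.2.2]) c t.1.1 * c t.1.2 * c t.2.1 * c t.2.2 *
   (joins M [:: t.1; t.2])%:R.
have YE M : M \in Conf -> Y M ^+ 2 = F1 M + F2 M.
  move=> MC; rewrite double_candidates_others // expr2 mulr_suml.
  have -> : F2 M = \sum_u \sum_(v | (u != v) && (u != partner M v)) c u * c (partner M u) * c v * c (partner M v).
    rewrite pair_big_dep /= /F2.
    rewrite (eq_bigr (fun t : T => if joins M [:: t.1; t.2] then c t.1.1 * c t.1.2 * c t.2.1 * c t.2.2 else 0)); last first.
      by move=> t _; case: ifP; rewrite ?mulr1 ?mulr0.
    rewrite -big_mkcondr /=.
    rewrite (reindex_onto (fun e : H * H => ((e.1, partner M e.1), (e.2, partner M e.2)) : T) (fun t => (t.1.1, t.2.1))) /=.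
      apply: eq_bigl => -[u v]; rewrite /= !eqxx !andbT.
      have := uniq_ends_of MC u [:: v]; rewrite (uniq_ends_of MC v [::]) /= !andbT => -> .
      by rewrite -[u == partner M v](inj_eq (inv_inj (partnerK MC))) (partnerK MC) -[partner M u == v](inj_eq (inv_inj (partnerK MC))) (partnerK MC).
    by move=> [[a a'] [b b']] /= /andP[_ /and3P[/eqP-> /eqP-> _]].
  rewrite /F1 -big_split /=; apply: eq_bigr => u _.
  rewrite mulr_sumr (bigD1 u) //= (bigD1 (partner M u)) ?partner_neq //= (partnerK MC) addrA.
  congr (_ + _); first by rewrite !expr2; ring.
  apply: eq_big => v; first by rewrite [v == u]eq_sym -[v == _](inj_eq (inv_inj (partnerK MC))) (partnerK MC) [_ == u]eq_sym.
  by move=> _; rewrite !mulrA.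
rewrite (ExE YE) ExD; apply: lerD.
  rewrite (Ex_partner (fun u v => 2 * c u ^+ 2 * c v ^+ 2)) mulrC ler_wpM2r ?invr_ge0; first by [].
    lra.
  rewrite expr2 /Q mulr_suml mulr_sumr; apply: ler_sum => u _.
  rewrite mulr_sumr mulr_sumr [leRHS](bigID (fun v => u != v)) /=.
  apply: (@le_trans _ _ (\sum_(v | u != v) 2 * (c u ^+ 2 * c v ^+ 2))).
    by apply: ler_sum => v _; rewrite mulrA.
  by rewrite lerDl sumr_ge0 // => v _; rewrite !mulr_ge0 ?exprn_ge0.
rewrite /F2 Ex_sum.
under eq_bigr => t ut.
  rewrite ExZ -/(joins_prob R _) [t.1]surjective_pairing [t.2]surjective_pairing joins_prob2 //=; last lia.
  over.
rewrite -mulr_suml ler_wpM2r //; first by rewrite invr_ge0; apply: mulr_ge0; lra.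
have -> : S ^+ 4 = \sum_(t : T) c t.1.1 * c t.1.2 * c t.2.1 * c t.2.2.
  rewrite -(pair_big xpredT xpredT (fun a b : H * H => c a.1 * c a.2 * c b.1 * c b.2)) /=.
  have S2 : S ^+ 2 = \sum_(a : H * H) c a.1 * c a.2.
    rewrite -(pair_big xpredT xpredT (fun a b => c a * c b)) /= expr2 /S mulr_suml.
    by apply: eq_bigr => u _; rewrite mulr_sumr.
  rewrite (_ : S ^+ 4 = S ^+ 2 * S ^+ 2); last by rewrite -exprD.
  rewrite S2 mulr_suml; apply: eq_bigr => a _; rewrite mulr_sumr; apply: eq_bigr => b _.
  by rewrite !mulrA.
rewrite [leRHS](bigID (fun t : T => uniq [:: t.1.1; t.1.2; t.2.1; t.2.2])) /= lerDl.
by apply: sumr_ge0 => t _; rewrite !mulr_ge0.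
Qed.

(** The approximate mean of [double_candidates], in which a half-edge is paired with
a uniformly random one. *)
Definition double_rate : R := S ^+ 2 / (N%:R - 1).

Lemma double_candidates_variance : Ex (fun M => (Y M - double_rate) ^+ 2) <=
  2 * Q ^+ 2 / (N%:R - 1) + 2 * S ^+ 4 / ((N%:R - 1) ^+ 2 * (N%:R - 3)) + 2 * S ^+ 2 * Q / (N%:R - 1) ^+ 2.
Proof.
have N0 : (16 : R) <= N%:R by rewrite ler_nat.
rewrite (ExE (G := fun M => Y M ^+ 2 + (- 2 * double_rate * Y M + double_rate ^+ 2))); last by move=> M _; ring.
rewrite !ExD ExZ Ex_cst // Ex_double_candidates; apply: le_trans (lerD Ex_double_candidates_sqr (lexx _)) _.
rewrite /double_rate le_eqVlt; apply/orP; left; apply/eqP.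
field; apply/andP; split; lra.
Qed.

Variables (A e : R).
Hypothesis A0 : 0 <= A.
Hypothesis e0 : 0 < e.
Hypothesis hA : (pairs2 d)%:R <= A * N%:R.
Hypothesis hD : D%:R ^+ 2 <= e ^+ 2 * N%:R.

Lemma maxdeg_gt0 : (0 < D)%N.
Proof using N16.
have /card_gt0P[x _] : (0 < N)%N by exact: leq_trans N16.
by apply: leq_trans (deg_le d (tag x)); case: x => i [k ki] /=; exact: leq_ltn_trans ki.
Qed.

Lemma sum_others_ge0 : 0 <= S. Proof. by apply: sumr_ge0 => u _; rewrite ler0n. Qed.
Lemma sum_others_bound : S <= A * N%:R.
Proof. by apply: le_trans hA; rewrite /S /c -natr_sum ler_nat sum_others_le. Qed.

Lemma sum_others_sqr_ge0 : 0 <= Q. Proof. by apply: sumr_ge0 => u _; rewrite exprn_ge0 ?ler0n. Qed.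

Lemma sum_others_sqr_bound : Q <= D%:R * (A * N%:R).
Proof.
apply: (@le_trans _ _ (D%:R * S)); last by rewrite ler_wpM2l ?ler0n ?sum_others_bound.
rewrite /S mulr_sumr; apply: ler_sum => u _; rewrite expr2 ler_wpM2r ?ler0n // ler_nat; exact: others_le.
Qed.

Lemma inv_card_sub_le m : (m <= 7)%N -> 0 <= (N%:R - m%:R : R)^-1 <= 2 / N%:R.
Proof. by move=> m7; apply: inv_sub_le; rewrite ?ler0n ?ler_nat. Qed.

Lemma maxdeg_sqr_ge1 : 1 <= D%:R ^+ 2 :> R.
Proof using N16. by rewrite exprn_ege1 // ler1n maxdeg_gt0. Qed.

(** The variance is of order e^2 N^2: each term has either a factor N^-1 left or two
extra degrees, and D^2 is at most e^2 N. *)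
Lemma double_candidates_deviation : Ex (fun M => `|Y M - double_rate|) <= (4 * A ^+ 2 + 16 * A ^+ 4 + 8 * A ^+ 3 + 1) / 2 * (e * N%:R).
Proof.
have N0 : (16 : R) <= N%:R by rewrite ler_nat.
have /andP[i0 i1] := @inv_card_sub_le 1 isT; have /andP[j0 j1] := @inv_card_sub_le 3 isT.
have N00 : 0 < N%:R :> R by lra.
set nu : R := N%:R in N0 N00 i0 i1 j0 j1 *.
have AN0 : 0 <= A * nu by rewrite mulr_ge0 // ltW.
have D0 : 0 <= D%:R :> R by rewrite ler0n.
have hD1 := maxdeg_sqr_ge1.
have DD : D%:R <= D%:R ^+ 2 :> R by rewrite expr2 ler_peMl // ler1n maxdeg_gt0.
have hv1 : 2 * Q ^+ 2 * (nu - 1)^-1 <= 4 * A ^+ 2 * (e ^+ 2 * nu ^+ 2).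
  apply: (@le_trans _ _ (2 * (D%:R * (A * nu)) ^+ 2 * (2 / nu))).
    by rewrite ler_pM ?mulr_ge0 ?exprn_ge0 ?sum_others_sqr_ge0 // ler_wpM2l // lerXn2r ?nnegrE ?sum_others_sqr_ge0 ?mulr_ge0 ?sum_others_sqr_bound.
  rewrite (_ : _ * (2 / nu) = 4 * A ^+ 2 * (D%:R ^+ 2 * nu)); last by field; rewrite gt_eqF.
  rewrite ler_wpM2l ?mulr_ge0 ?exprn_ge0 // (_ : e ^+ 2 * nu ^+ 2 = e ^+ 2 * nu * nu); last by ring.
  by rewrite ler_wpM2r // ltW.
have hv2 : 2 * S ^+ 4 * ((nu - 1)^-1 ^+ 2 * (nu - 3)^-1) <= 16 * A ^+ 4 * (e ^+ 2 * nu ^+ 2).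
  apply: (@le_trans _ _ (2 * (A * nu) ^+ 4 * ((2 / nu) ^+ 2 * (2 / nu)))).
    rewrite ler_pM ?mulr_ge0 ?exprn_ge0 ?sum_others_ge0 //.
      by rewrite ler_wpM2l // lerXn2r ?nnegrE ?sum_others_ge0 ?sum_others_bound.
    by rewrite ler_pM ?exprn_ge0 // lerXn2r ?nnegrE // (le_trans i0 i1).
  rewrite (_ : _ * (_ * (2 / nu)) = 16 * A ^+ 4 * (1 * nu)); last by field; rewrite gt_eqF.
  rewrite ler_wpM2l ?mulr_ge0 ?exprn_ge0 // (_ : e ^+ 2 * nu ^+ 2 = e ^+ 2 * nu * nu); last by ring.
  by rewrite ler_wpM2r ?(ltW N00) // (le_trans hD1).
have hv3 : 2 * S ^+ 2 * Q * (nu - 1)^-1 ^+ 2 <= 8 * A ^+ 3 * (e ^+ 2 * nu ^+ 2).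
  apply: (@le_trans _ _ (2 * (A * nu) ^+ 2 * (D%:R * (A * nu)) * (2 / nu) ^+ 2)).
    rewrite ler_pM ?mulr_ge0 ?exprn_ge0 ?sum_others_ge0 ?sum_others_sqr_ge0 //; last by rewrite lerXn2r ?nnegrE // (le_trans i0 i1).
    rewrite ler_pM ?mulr_ge0 ?exprn_ge0 ?sum_others_ge0 ?sum_others_sqr_ge0 ?sum_others_sqr_bound //.
    by rewrite ler_wpM2l // lerXn2r ?nnegrE ?sum_others_ge0 ?sum_others_bound.
  rewrite (_ : _ * (2 / nu) ^+ 2 = 8 * A ^+ 3 * (D%:R * nu)); last by field; rewrite gt_eqF.
  rewrite ler_wpM2l ?mulr_ge0 ?exprn_ge0 // (_ : e ^+ 2 * nu ^+ 2 = e ^+ 2 * nu * nu); last by ring.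
  by rewrite ler_wpM2r ?(ltW N00) // (le_trans DD).
set K := 4 * A ^+ 2 + 16 * A ^+ 4 + 8 * A ^+ 3.
have var : Ex (fun M => (Y M - double_rate) ^+ 2) <= K * (e ^+ 2 * nu ^+ 2).
  apply: (le_trans double_candidates_variance); rewrite -/nu invfM -exprVn.
  by have := lerD (lerD hv1 hv2) hv3; rewrite -!mulrDl.
have en : 0 < e * nu by rewrite mulr_gt0.
(* |z| <= z^2 / (2 w) + w / 2, with w = e N balancing the two terms *)
apply: (@le_trans _ _ (Ex (fun M => (2 * (e * nu))^-1 * (Y M - double_rate) ^+ 2 + e * nu / 2))).
  apply: Ex_le => M _; set z := Y M - _.
  have : 0 <= (`|z| - e * nu) ^+ 2 by rewrite sqr_ge0.
  rewrite sqrrB real_normK ?num_real // => h.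
  move: (e * nu) en h => w w0 h; rewrite -subr_ge0.
  rewrite (_ : _ - _ = (2 * w)^-1 * (z ^+ 2 - `|z| * w *+ 2 + w ^+ 2)); last by field; rewrite gt_eqF.
  by rewrite mulr_ge0 // invr_ge0 mulr_ge0 // ltW.
have -> : (K + 1) / 2 * (e * nu) = (2 * (e * nu))^-1 * (K * (e ^+ 2 * nu ^+ 2)) + e * nu / 2.
  by field; rewrite !gt_eqF.
have -> : Ex (fun M => (2 * (e * nu))^-1 * (Y M - double_rate) ^+ 2 + e * nu / 2) =
    (2 * (e * nu))^-1 * Ex (fun M => (Y M - double_rate) ^+ 2) + e * nu / 2.
  by rewrite ExD (Ex_cst Cgt0) ExZ.
rewrite lerD2r; apply: ler_wpM2l var.
by rewrite invr_ge0 mulr_ge0 // ltW.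
Qed.
End Moments.

(** * Levels, and averages over the second edge *)

Section Bad.
Variables (n : nat) (d : 'I_n -> nat).
Local Notation H := (halfedge d).
Implicit Types (M : matching d) (x y z u : H) (i j : 'I_n).
Local Notation Conf := (configurations d).

Lemma ends_pair x y : ends [set x; y]%SET = [set tag x; tag y]%SET.
Proof.
apply/setP => i; rewrite !inE; apply/imsetP/orP => [[z]|[]/eqP->].
- by rewrite !inE => /orP[]/eqP-> ->; rewrite eqxx; auto.
- by exists x; rewrite ?inE ?eqxx.
- by exists y; rewrite ?inE ?eqxx ?orbT.
Qed.

Lemma conf_edgeP M B : M \in Conf -> B \in M -> exists x, B = [set x; partner M x]%SET.
Proof.
move=> MC; rewrite (config_ofE MC (fun=> erefl)) => /imsetP[x _ ->]; exists x.
by rewrite partner_config_of //; exact: partner_pairing.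
Qed.

Lemma badh_edge M x : M \in Conf -> ([set x; partner M x]%SET \in bad_edges M) = badh M x.
Proof.
move=> MC; have pK := partnerK MC; rewrite /bad_edges [LHS]finset.in_set in_conf // eqxx /= ends_pair.
apply/orP/idP => [[]|bx].
- rewrite cards2; case: (eqVneq (tag x) (tag (partner M x))) => // e _; by apply: loop_bad.
- case/exists_inP => B' B'M /andP[ne].
  have [y yE] := conf_edgeP MC B'M; rewrite yE ends_pair => /eqP/set2_eq[][e1 e2].
    apply: (@mult_ge2 _ _ _ x y) => //; apply: contraNneq ne => ->; by rewrite yE.
  apply: (@mult_ge2 _ _ _ x (partner M y)); rewrite ?pK //.
  by apply: contraNneq ne => ->; rewrite yE pK finset.setUC.
- have [e|ne] := eqVneq (tag x) (tag (partner M x)); first by left; rewrite cards2 -e eqxx.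
  right; apply/exists_inP.
  move: bx; rewrite /badh mult_card => /card_gt1P[a [b [aS bS ab]]].
  have [y [yx]] : exists y, y != x /\ y \in [set u | (tag u == tag x) && (tag (partner M u) == tag (partner M x))]%SET.
    case: (eqVneq a x) => [ax|ax]; last by exists a.
    by exists b; split=> //; rewrite -ax eq_sym.
  rewrite inE => /andP[/eqP e1 /eqP e2].
  exists [set y; partner M y]%SET; first by rewrite in_conf.
  rewrite ends_pair e1 e2 eqxx andbT; apply: contra ne => /eqP/set2_eq[][e3 e4].
    by rewrite e3 eqxx in yx.
  by rewrite -e1 e3.
Qed.

Lemma no_badP M : M \in Conf -> reflect (forall x, ~~ badh M x) (no_bad_edges M).
Proof.
move=> MC; rewrite /no_bad_edges; apply: (iffP eqP) => [e x|h].
  by rewrite -badh_edge // e inE.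
apply/setP => B; rewrite [B \in finset.set0]inE; apply/negP => Bb; have BM : B \in M by case/setIdP: Bb.
have [x xE] := conf_edgeP MC BM; move: Bb; rewrite xE badh_edge //; exact/negP.
Qed.

(** [#|doubles M|] is even, and its half is the number of double edges. *)
Definition level k M := [&& M \in Conf, clean M & (#|loops M| + #|doubles M|./2 == k)%N].

Lemma levelP k M : level k M -> exists a b, M \in state d a b /\ (a + b = k)%N.
Proof.
case/and3P=> MC c /eqP <-; have [b bE] := doubles_even MC.
by exists #|loops M|, b; rewrite bE doubleK; split=> //; apply/stateP; split=> //; exact/cleanP.
Qed.

Lemma state_level a b M : M \in state d a b -> level (a + b)%N M.
Proof.
case/stateP => MC c aE bE; apply/and3P; split=> //; first exact/cleanP.
by rewrite aE bE doubleK.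
Qed.

Lemma level_conf k M : level k M -> M \in Conf. Proof. by case/and3P. Qed.
Lemma level_clean k M : level k M -> clean M. Proof. by case/and3P. Qed.

Lemma level_num_bad k M : level k M -> (\sum_x badh M x <= 4 * k)%N.
Proof.
move=> Sk; rewrite nb_card card_badh ?(level_clean Sk) // dups_split.
have [a [b [/stateP[_ _ -> ->] <-]]] := levelP Sk.
by rewrite -muln2; lia.
Qed.

Lemma level0 M : level 0 M = (M \in Conf) && no_bad_edges M.
Proof.
apply/idP/andP => [S0|[MC nb]].
  have MC := level_conf S0; split=> //; apply/no_badP => // x.
  by have := level_num_bad S0; rewrite muln0 leqn0 sum_nat_eq0 => /forallP/(_ x) /=; rewrite eqb0.
have c : clean M.
  apply/cleanP => i j; case: (posnP (mult M i j)) => [->//|/mult_gt0P[x [<- <-]]].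
  by have /no_badP := nb => /(_ MC x); rewrite /badh -leqNgt => /leqW.
have e0 : dups M = finset.set0.
  apply/setP => -[i j]; rewrite !inE /=; apply/negP => /eqP m2.
  have /mult_gt0P[x [xi xj]] : (0 < mult M i j)%N by rewrite m2.
  by have /no_badP := nb => /(_ MC x); rewrite /badh xi xj m2.
have := dups_split M; rewrite e0 cards0 => /esym/eqP; rewrite addn_eq0 => /andP[/eqP l0 /eqP d0].
by rewrite /level MC c l0 d0.
Qed.

Lemma level_uniq k k' M : level k M -> level k' M -> k = k'.
Proof. by case/and3P=> _ _ /eqP <- /and3P[_ _ /eqP]. Qed.

(** A generic switching replaces the bad edge by simple ones. *)
Lemma level_generic k M x z : level k M -> badh M x -> generic M x z -> (0 < k)%N /\ level k.-1 (sw M x z).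
Proof.
move=> Sk bx g; have [a [b [MS <-]]] := levelP Sk.
case: (eqVneq (tag x) (tag (partner M x))) => [e|ne].
  have [a0 /state_level h] := forward_loop MS bx g e; split; first by rewrite addn_gt0 a0.
  by have -> : ((a + b).-1 = a.-1 + b)%N by case: a a0 {MS Sk h}.
have [b0 /state_level h] := forward_double MS bx g ne; split; first by rewrite addn_gt0 b0 orbT.
by have -> : ((a + b).-1 = a + b.-1)%N by case: b b0 {MS Sk h} => // b _; rewrite addnS.
Qed.

Lemma level_relabel k (pi : {perm H}) M : (forall x, tag (pi x) = tag x) -> M \in Conf ->
  level k (relabel pi M) = level k M.
Proof.
move=> pit MC; rewrite /level relabel_conf // MC /=.
have e : dups (relabel pi M) = dups M by apply/setP => -[i j]; rewrite !inE /= mult_relabel.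
rewrite /loops /doubles e; congr (_ && _).
by apply: eq_forallb => i; apply: eq_forallb => j; rewrite mult_relabel.
Qed.

Lemma badh_relabel (pi : {perm H}) M x : (forall x, tag (pi x) = tag x) -> M \in Conf ->
  badh (relabel pi M) (pi x) = badh M x.
Proof. by move=> pit MC; rewrite /badh mult_relabel // partner_relabel // !pit. Qed.

End Bad.

Section Operators.
Variables (R : realType) (n : nat) (d : 'I_n -> nat).
Local Notation H := (halfedge d).
Implicit Types (M : matching d) (x y z u : H) (i j : 'I_n).
Local Notation Conf := (configurations d).
Local Notation N := #|{: H}|.
Local Notation D := (maxdeg d).

(** The expected value of [psi] after a switching of the edge of [x] with a random
other edge in a random direction, as there are N - 2 choices for [z]. *)
Definition avg (psi : matching d -> R) M x : R :=
  (N%:R - 2)^-1 * \sum_(z | (z != x) && (z != partner M x)) psi (sw M x z).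

Lemma card_others M x : M \in Conf -> \sum_(z | (z != x) && (z != partner M x)) 1 = N%:R - 2 :> R.
Proof.
move=> MC; have : \sum_(z : H) 1 = N%:R :> R by rewrite sumr_const.
rewrite (bigD1 x) //= (bigD1 (partner M x)) ?partner_neq //= => <-; ring.
Qed.

Hypothesis N16 : (16 <= N)%N.
Let N0 : (16 : R) <= N%:R. Proof. by rewrite ler_nat. Qed.
Let Ninv0 : 0 < (N%:R - 2 : R)^-1. Proof. by rewrite invr_gt0; have := N0; lra. Qed.

Lemma inv_N2_le : 0 <= (N%:R - 2 : R)^-1 <= 2 / N%:R.
Proof. by apply: inv_sub_le; rewrite ?ler_nat // ler0n. Qed.

(** Two functions that are close at the good choices [P] of the second edge have
close averages if the other choices are rare. *)
Lemma avg_le (psi psi' : matching d -> R) M x (c : R) (P : H -> bool) b : M \in Conf ->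
  (forall z, x != z -> z != partner M x -> P z -> `|psi (sw M x z) - psi' (sw M x z)| <= b) ->
  (forall z, x != z -> z != partner M x -> `|psi (sw M x z) - psi' (sw M x z)| <= b + c) ->
  0 <= c ->
  `|avg psi M x - avg psi' M x| <= b + c * ((N%:R - 2)^-1 * (\sum_z ~~ P z)%:R).
Proof.
move=> MC Pb bc c0; rewrite /avg -mulrBr -sumrB normrM gtr0_norm //.
apply: (@le_trans _ _ ((N%:R - 2)^-1 * (\sum_(z | (z != x) && (z != partner M x)) (b + c * (~~ P z)%:R)))).
  rewrite ler_pM2l //; apply: le_trans (ler_norm_sum _ _ _) _; apply: ler_sum => z /andP[zx zpx].
  case: (boolP (P z)) => [Pz|nPz] /=; first by rewrite mulr0 addr0 Pb // eq_sym.
  by rewrite mulr1 bc // eq_sym.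
rewrite big_split /= mulrDr; apply: lerD.
  rewrite (eq_bigr (fun=> b * 1)); last by move=> z _; rewrite mulr1.
  rewrite -mulr_sumr card_others // mulrCA mulVf ?mulr1 // gt_eqF //; have := N0; lra.
rewrite -mulr_sumr mulrCA ler_wpM2l // ler_pM2l // natr_sum.
rewrite [leRHS](bigID (fun z => (z != x) && (z != partner M x))) /= lerDl.
by apply: sumr_ge0 => z _; rewrite ler0n.
Qed.

Lemma avg_bound (psi : matching d -> R) M x c : M \in Conf ->
  (forall M', M' \in Conf -> `|psi M'| <= c) -> `|avg psi M x| <= c.
Proof.
move=> MC pc; rewrite -[avg psi M x]subr0.
have -> : 0 = avg (fun=> 0) M x :> R by rewrite /avg big1 ?mulr0.
apply: le_trans (@avg_le psi (fun=> 0) M x 0 xpredT c MC _ _ _) _ => //.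
- by move=> z xz zpx _; rewrite subr0 pc // sw_conf.
- by move=> z xz zpx; rewrite subr0 addr0 pc // sw_conf.
- by rewrite mul0r addr0.
Qed.

Lemma avg_flip (psi : matching d -> R) M x : M \in Conf -> avg psi M (partner M x) = avg psi M x.
Proof.
move=> MC; have pK := partnerK MC; have pinj := inv_inj pK; rewrite /avg pK; congr (_ * _).
rewrite [RHS](reindex_inj pinj) /=; apply: eq_big => [z|z /andP[z1 z2]].
  by rewrite (inj_eq pinj) -[partner M z == x](inj_eq pinj) pK andbC.
by rewrite sw_flip // eq_sym.
Qed.

Lemma avg_relabel (pi : {perm H}) (psi : matching d -> R) M x :
  (forall M, M \in Conf -> psi (relabel pi M) = psi M) -> M \in Conf ->
  avg psi (relabel pi M) (pi x) = avg psi M x.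
Proof.
move=> inv MC; rewrite /avg; congr (_ * _); rewrite (reindex_inj (@perm_inj _ pi)) /=.
apply: eq_big => [z|z /andP[z1 z2]]; first by rewrite partner_relabel // !(inj_eq perm_inj).
move: z1 z2; rewrite partner_relabel // !(inj_eq perm_inj) => z1 z2.
by rewrite -relabel_sw ?inv ?sw_conf // eq_sym.
Qed.

(** Invariance under the relabellings of the half-edges at each vertex; any function
of the projection has it. *)
Definition relabel_invariant (psi : matching d -> R) := forall (pi : {perm H}), (forall x, tag (pi x) = tag x) ->
  forall M, M \in Conf -> psi (relabel pi M) = psi M.

(** The relabelling that exchanges two parallel edges fixes the configuration. *)
Lemma avg_parallel (psi : matching d -> R) M x x' : relabel_invariant psi -> M \in Conf ->
  tag x = tag x' -> tag (partner M x) = tag (partner M x') -> avg psi M x = avg psi M x'.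
Proof.
move=> inv MC e1 e2; have pK := partnerK MC; have pinj := inv_inj pK.
have [->//|xx'] := eqVneq x x'.
have [->|xpx'] := eqVneq x (partner M x'); first by rewrite avg_flip.
pose pi := (tperm x x' * tperm (partner M x) (partner M x'))%g.
have px := partner_neq x MC; have px' := partner_neq x' MC.
have xpx'' : x' != partner M x by rewrite -(inj_eq pinj) pK eq_sym.
have pxx : partner M x != partner M x' by rewrite (inj_eq pinj).
have pix : pi x = x' by rewrite permM tpermL tpermD // eq_sym.
have pix' : pi x' = x by rewrite permM tpermR tpermD // eq_sym.
have pipx : pi (partner M x) = partner M x' by rewrite permM (tpermD (x := x)) ?tpermL // eq_sym.
have pipx' : pi (partner M x') = partner M x by rewrite permM (tpermD (x := x)) ?tpermR // eq_sym.
have piid t : t != x -> t != x' -> t != partner M x -> t != partner M x' -> pi t = t.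
  by move=> *; rewrite permM !tpermD // eq_sym.
have pit t : tag (pi t) = tag t.
  have [->|t1] := eqVneq t x; first by rewrite pix.
  have [->|t2] := eqVneq t x'; first by rewrite pix'.
  have [->|t3] := eqVneq t (partner M x); first by rewrite pipx.
  have [->|t4] := eqVneq t (partner M x'); first by rewrite pipx'.
  by rewrite piid.
have rM : relabel pi M = M.
  apply: conf_inj => //; first exact: relabel_conf.
  move=> t; rewrite -(permKV pi t); move: ((pi^-1)%g t) => {}t; rewrite partner_relabel //.
  have [->|t1] := eqVneq t x; first by rewrite pix pipx.
  have [->|t2] := eqVneq t x'; first by rewrite pix' pipx'.
  have [->|t3] := eqVneq t (partner M x); first by rewrite pipx !pK.
  have [->|t4] := eqVneq t (partner M x'); first by rewrite pipx' !pK.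
  have pn a : t != partner M a -> partner M t != a by move=> h; rewrite -(inj_eq pinj) pK.
  by rewrite (piid t) // piid ?(inj_eq pinj) ?pn.
by have := avg_relabel x (inv pi pit) MC; rewrite rM pix.
Qed.

(** The four edges involved in two switchings are distinct. *)
Definition disjoint_switchings M x x' z z' :=
  uniq [:: x; partner M x; z; partner M z; x'; partner M x'; z'; partner M z'].

Lemma card_not_disjoint M x x' : M \in Conf -> x' != x -> x' != partner M x ->
  (\sum_z \sum_z' ~~ disjoint_switchings M x x' z z' <= 10 * N)%N.
Proof.
move=> MC xx' xpx'; have pK := partnerK MC; have pinj := inv_inj pK.
have bound (s : seq H) : (\sum_z (z \in s) <= size s)%N.
  rewrite -[leqRHS]count_predT; elim: s => [|a s IH] /=.
    by rewrite big1 // => z _; rewrite in_nil.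
  apply: (@leq_trans (\sum_(z : H) ((z == a) + (z \in s)))).
    by apply: leq_sum => z _; rewrite inE; case: (z == a) => //; rewrite leq_addr.
  rewrite big_split /=; apply: leq_add => //.
  by rewrite (bigD1 a) //= eqxx big1 // => z /negbTE ->.
pose s4 := [:: x; partner M x; x'; partner M x'].
apply: (@leq_trans (\sum_z \sum_z' ((z \in s4) + ((z' \in s4) + (z' \in [:: z; partner M z]))))).
  apply: leq_sum => z _; apply: leq_sum => z' _; rewrite /disjoint_switchings.
  have lb (b : bool) (k : nat) : (0 < k)%N -> (b <= k)%N by case: b.
  have [zs|zs] := boolP (z \in s4); first by apply: lb.
  have [zs'|zs'] := boolP (z' \in s4); first by apply: lb.
  have [zz'|zz'] := boolP (z' \in _); first by apply: lb.
  move: zs zs' zz'; rewrite !inE !negb_or => /and4P[z1 z2 z3 z4] /and4P[w1 w2 w3 w4] /andP[w5 w6].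
  have fl a b : (a != partner M b) = (b != partner M a) by rewrite -(inj_eq pinj) pK eq_sym.
  have U : uniq (ends_of M [:: x; z; x'; z']).
    rewrite !uniq_ends_of //= !andbT.
    rewrite (eq_sym x z) z1 (fl x z) z2 (eq_sym x x') xx' (fl x x') xpx' (eq_sym x z') w1 (fl x z') w2.
    by rewrite z3 z4 (eq_sym z z') w5 (fl z z') w6 (eq_sym x' z') w3 (fl x' z') w4.
  by move: U => /= ->.
rewrite (_ : 10 * N = N * 4 + N * 6)%N; last lia.
under eq_bigr do rewrite big_split /= big_split /=.
rewrite big_split /=; apply: leq_add.
  by rewrite exchange_big /= sum_nat_const leq_mul2l bound orbT.
apply: (@leq_trans (\sum_(z : H) 6)); last by rewrite sum_nat_const.
apply: leq_sum => z _; apply: (@leq_trans (4 + 2)%N) => //; apply: leq_add; exact: bound.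
Qed.

(** Two switchings that involve four distinct edges commute, and only O(N) of the N^2
choices of the second edges make two of the four coincide. *)
Lemma avg_comm (psi : matching d -> R) M x x' (c : R) : M \in Conf -> x' != x -> x' != partner M x ->
  (forall M', M' \in Conf -> `|psi M'| <= c) ->
  `|avg (fun M' => avg psi M' x') M x - avg (fun M' => avg psi M' x) M x'| <= 80 * c / N%:R.
Proof.
move=> MC xx' xpx' pc.
have pK := partnerK MC; have pinj := inv_inj pK.
have c0 : 0 <= c by apply: le_trans (pc _ MC).
pose ok M z z' := (z' != z) && (z' != partner M z).
pose L z z' := if ok M x z && ok (sw M x z) x' z' then psi (sw (sw M x z) x' z') else 0.
pose L' z z' := if ok M x' z' && ok (sw M x' z') x z then psi (sw (sw M x' z') x z) else 0.
have E1 : avg (fun M' => avg psi M' x') M x = (N%:R - 2)^-1 ^+ 2 * \sum_z \sum_z' L z z'.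
  rewrite /avg expr2 -mulrA; congr (_ * _); rewrite -mulr_sumr; congr (_ * _).
  rewrite big_mkcond; apply: eq_bigr => z _; rewrite /L /ok.
  case: ifP => zo /=; last by rewrite big1.
  by rewrite -big_mkcond.
have E2 : avg (fun M' => avg psi M' x) M x' = (N%:R - 2)^-1 ^+ 2 * \sum_z \sum_z' L' z z'.
  rewrite /avg expr2 -mulrA; congr (_ * _); rewrite -mulr_sumr; congr (_ * _).
  rewrite exchange_big big_mkcond; apply: eq_bigr => z _; rewrite /L' /ok.
  case: ifP => zo /=; last by rewrite big1.
  by rewrite -big_mkcond.
have LL z z' : `|L z z' - L' z z'| <= 2 * c * (~~ disjoint_switchings M x x' z z')%:R.
  have bd1 : `|L z z'| <= c.
    rewrite /L; case: ifP => [/andP[/andP[h1 h2] /andP[h3 h4]]|_]; last by rewrite normr0.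
    by apply: pc; apply: sw_conf; rewrite ?sw_conf // eq_sym.
  have bd2 : `|L' z z'| <= c.
    rewrite /L'; case: ifP => [/andP[/andP[h1 h2] /andP[h3 h4]]|_]; last by rewrite normr0.
    by apply: pc; apply: sw_conf; rewrite ?sw_conf // eq_sym.
  case: (boolP (disjoint_switchings _ _ _ _ _)) => [U|_]; last first.
    rewrite mulr1; move: (L z z') (L' z z') bd1 bd2 => l1 l2 bd1 bd2.
    by apply: le_trans (ler_normB _ _) _; rewrite mulr_natl mulr2n; exact: lerD.
  rewrite mulr0 normr_le0 subr_eq0 /L /L' /ok (sw_comm MC U).
  move: U; rewrite /disjoint_switchings /= !inE !negb_or => U.
  repeat match goal with h : is_true (_ && _) |- _ => case/andP: h => ? ? end.
  have xz : x != z by []. have zpx : z != partner M x by rewrite eq_sym.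
  have xz' : x' != z' by []. have zpx' : z' != partner M x' by rewrite eq_sym.
  rewrite !partner_sw // /switch_fun; neq_false => /=.
  by rewrite ?(eq_sym z x) ?(eq_sym z' x'); neq_false.
rewrite E1 E2 -mulrBr -sumrB normrM ger0_norm; last by rewrite exprn_ge0 // ltW.
apply: (@le_trans _ _ ((N%:R - 2)^-1 ^+ 2 * (2 * c * (10 * N)%:R))).
  rewrite ler_wpM2l ?exprn_ge0 ?(ltW Ninv0) //; apply: (le_trans (ler_norm_sum _ _ _)).
  apply: (@le_trans _ _ (\sum_z \sum_z' 2 * c * (~~ disjoint_switchings M x x' z z')%:R)).
    apply: ler_sum => z _; rewrite -sumrB; apply: (le_trans (ler_norm_sum _ _ _)).
    by apply: ler_sum => z' _; exact: LL.
  under eq_bigr do rewrite -mulr_sumr -natr_sum.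
  by rewrite -mulr_sumr -natr_sum ler_wpM2l ?mulr_ge0 // ler_nat card_not_disjoint.
have /andP[i0 i1] := inv_N2_le.
apply: (@le_trans _ _ ((2 / N%:R) ^+ 2 * (2 * c * (10 * N)%:R))).
  rewrite ler_wpM2r ?mulr_ge0 //; rewrite lerXn2r ?nnegrE //; exact: le_trans i0 i1.
rewrite natrM le_eqVlt; apply/orP; left; apply/eqP; field.
by rewrite pnatr_eq0 -lt0n (leq_trans _ N16).
Qed.

End Operators.

(** * Independence of the order of the switchings *)

Section Operators.
Variables (R : realType) (n : nat) (d : 'I_n -> nat).
Local Notation H := (halfedge d).
Implicit Types (M : matching d) (x y z u : H) (i j : 'I_n).
Local Notation Conf := (configurations d).
Local Notation N := #|{: H}|.
Local Notation D := (maxdeg d).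

Hypothesis N16 : (16 <= N)%N.
Let N0 : (16 : R) <= N%:R. Proof. by rewrite ler_nat. Qed.
Let Ninv0 : 0 < (N%:R - 2 : R)^-1. Proof. by rewrite invr_gt0; have := N0; lra. Qed.

Let Npos : 0 < N%:R :> R. Proof. by rewrite ltr0n (leq_trans _ N16). Qed.

Section UniformRule.
Variables (phi : matching d -> R) (c : R).
Hypothesis c0 : 0 <= c.
Hypothesis phi_inv : relabel_invariant phi.
Hypothesis phi_bound : forall M, M \in Conf -> `|phi M| <= c.

(** The expected value of [phi] after k switchings of uniformly random bad edges from
a configuration of level k, where runs whose level does not fall by one at each
step contribute 0.  It stands in for the process with an arbitrary rule. *)
Fixpoint uniform_value k M : R := if level k M then
  (if k is k'.+1 then (\sum_x badh M x)%:R^-1 * \sum_(x | badh M x) avg (uniform_value k') M x else phi M) else 0.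

Lemma level_has_bad k M : level k.+1 M -> (0 < \sum_x badh M x)%N.
Proof.
move=> Sk; rewrite lt0n; apply/negP => /eqP z.
have : level 0 M.
  rewrite level0 (level_conf Sk); apply/no_badP; first exact: level_conf Sk.
  by move=> x; move/eqP: z; rewrite sum_nat_eq0 => /forallP/(_ x) /=; rewrite eqb0.
by move/(level_uniq Sk).
Qed.

Lemma mean_close (P : pred H) (F : H -> R) (b e : R) : (0 < \sum_x P x)%N ->
  (forall x, P x -> `|F x - b| <= e) ->
  `|(\sum_x P x)%:R^-1 * \sum_(x | P x) F x - b| <= e.
Proof.
move=> P0 Fb; set m := (\sum_x P x)%N in P0 *.
have mE : \sum_(x | P x) 1 = m%:R :> R.
  by rewrite /m natr_sum [LHS]big_mkcond; apply: eq_bigr => x _; case: (P x).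
have m0 : 0 < m%:R :> R by rewrite ltr0n.
have -> : b = m%:R^-1 * \sum_(x | P x) b * 1 by rewrite -mulr_sumr mE mulrCA mulVf ?mulr1 // gt_eqF.
rewrite -mulrBr -sumrB normrM gtr0_norm ?invr_gt0 // mulrC ler_pdivrMr //.
apply: (le_trans (ler_norm_sum _ _ _)).
apply: (@le_trans _ _ (\sum_(x | P x) e * 1)); last by rewrite -mulr_sumr mE.
by apply: ler_sum => x Px; rewrite !mulr1; exact: Fb.
Qed.

Lemma uniform_value_bound k M : M \in Conf -> `|uniform_value k M| <= c.
Proof.
elim: k M => [|k IH] M MC /=; case: ifP => Sk; rewrite ?normr0 //; first exact: phi_bound.
rewrite -[X in `|X|]subr0; apply: mean_close; first exact: level_has_bad Sk.
by move=> x _; rewrite subr0; exact: avg_bound.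
Qed.

Lemma uniform_value_inv k : relabel_invariant (uniform_value k).
Proof.
elim: k => [|k IH] pi pit M MC /=; rewrite level_relabel //; case: ifP => // _; first exact: phi_inv.
congr (_ * _).
  by congr (_%:R^-1); rewrite (reindex_inj (@perm_inj _ pi)); apply: eq_bigr => x _; rewrite badh_relabel.
rewrite (reindex_inj (@perm_inj _ pi)); apply: eq_big => [x|x _]; first by rewrite badh_relabel.
by apply: avg_relabel => // M' M'C; exact: IH.
Qed.

Section Insensitive.
Variable e : R.
Hypothesis hD : D%:R ^+ 2 <= e ^+ 2 * N%:R.
Hypothesis one_D : (0 < D)%N.

(** A bound for the probability of a non-generic switching from level k. *)
Definition nongeneric_rate k : R := 8 * k.+1%:R * e ^+ 2.

Lemma one_le_e2N : 1 <= e ^+ 2 * N%:R.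
Proof. by apply: le_trans hD; rewrite exprn_ege1 // ler1n. Qed.

Lemma inv_N_le : N%:R^-1 <= e ^+ 2.
Proof. by rewrite -div1r ler_pdivrMr ?one_le_e2N. Qed.

Lemma not_generic_frac k M x : level k M -> badh M x ->
  (N%:R - 2)^-1 * (\sum_z ~~ generic M x z)%:R <= nongeneric_rate k.
Proof.
move=> Sk bx; have h := not_generic_le (level_conf Sk) bx one_D.
have {}h : (\sum_z ~~ generic M x z <= 4 * k.+1 * D ^ 2)%N.
  apply: (leq_trans h); have := level_num_bad Sk; have : (0 < D ^ 2)%N by rewrite expn_gt0 one_D.
  by rewrite mulnn; set X := (D ^ 2)%N; set s := (\sum_x _)%N; nia.
have /andP[i0 i1] := inv_N2_le R N16.
apply: (@le_trans _ _ (2 / N%:R * (4 * k.+1 * D ^ 2)%:R)).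
  by apply: ler_pM; rewrite ?ler0n ?ler_nat.
rewrite natrM natrX natrM mulrAC ler_pdivrMr //.
rewrite (_ : nongeneric_rate k * N%:R = 2 * (4 * k.+1%:R * (e ^+ 2 * N%:R))); last by rewrite /nongeneric_rate; ring.
by rewrite ler_wpM2l // ler_wpM2l // mulr_ge0.
Qed.

Lemma nongeneric_rate_ge0 k : 0 <= nongeneric_rate k.
Proof. by rewrite /nongeneric_rate; apply: mulr_ge0 (sqr_ge0 _); exact: mulr_ge0. Qed.

Lemma scaled_rate_ge0 k : 0 <= 2 * c * nongeneric_rate k.
Proof. by apply: mulr_ge0 (nongeneric_rate_ge0 k); exact: mulr_ge0. Qed.

Lemma avg_close k M x (psi psi' : matching d -> R) b : level k M -> badh M x -> 0 <= b ->
  (forall M', M' \in Conf -> `|psi M'| <= c) -> (forall M', M' \in Conf -> `|psi' M'| <= c) ->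
  (forall z, generic M x z -> `|psi (sw M x z) - psi' (sw M x z)| <= b) ->
  `|avg psi M x - avg psi' M x| <= b + 2 * c * nongeneric_rate k.
Proof.
move=> Sk bx b0 p1 p2 g; have MC := level_conf Sk.
apply: le_trans (@avg_le R n d N16 psi psi' M x (2 * c) (generic M x) b MC _ _ _) _.
- by move=> z _ _; exact: g.
- move=> z xz zpx; apply: (le_trans (ler_normB _ _)); rewrite mulr_natl mulr2n ler_wpDl //.
  by apply: lerD; [apply: p1|apply: p2]; rewrite sw_conf.
- by rewrite mulr_ge0.
- by rewrite lerD2l ler_wpM2l ?mulr_ge0 // not_generic_frac.
Qed.

(** Bounds the dependence of [uniform_value] on the first bad edge.  The recursion
follows the proof of [order_insensitive_pair]: two comparisons at level k, and an
exchange of two switchings. *)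
Fixpoint order_error k : R := if k is k'.+1 then 2 * (order_error k' + 2 * c * nongeneric_rate k.+1) + 80 * c * e ^+ 2
  else 4 * c * nongeneric_rate 1.

Lemma order_error_ge0 k : 0 <= order_error k.
Proof.
have h := scaled_rate_ge0.
elim: k => [|k IH] /=; first by rewrite (_ : 4 * c * _ = 2 * c * nongeneric_rate 1 + 2 * c * nongeneric_rate 1); [exact: addr_ge0|ring].
apply: addr_ge0; first by apply: mulr_ge0 => //; exact: addr_ge0.
by apply: mulr_ge0 (sqr_ge0 _); exact: mulr_ge0.
Qed.

Lemma uniform_valueS k M : level k.+1 M -> uniform_value k.+1 M = (\sum_x badh M x)%:R^-1 * \sum_(x | badh M x) avg (uniform_value k) M x.
Proof. by rewrite /uniform_value /= => ->. Qed.

(** Switching [x] is, by induction, nearly the same as switching [x] and then [x'];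
that nearly commutes to switching [x'] and then [x]. *)
Lemma order_insensitive_pair k :
  (forall M x, level k M -> badh M x -> if k is k'.+1 then `|avg (uniform_value k') M x - uniform_value k M| <= order_error k' else True) ->
  forall M x x', level k.+1 M -> badh M x -> badh M x' -> `|avg (uniform_value k) M x - avg (uniform_value k) M x'| <= order_error k.
Proof.
move=> IH M x x' Sk bx bx'; have MC := level_conf Sk; have Mc := level_clean Sk.
have pK := partnerK MC; have pinj := inv_inj pK.
have [a [b [MS _]]] := levelP Sk.
have inv := @uniform_value_inv k.
have [e1|n1] := eqVneq (tag x', tag (partner M x')) (tag x, tag (partner M x)).
  case: e1 => e1 e2; rewrite (avg_parallel inv MC (esym e1) (esym e2)) subrr normr0; exact: order_error_ge0.
have [e1|n2] := eqVneq (tag x', tag (partner M x')) (tag (partner M x), tag x).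
  case: e1 => e1 e2; rewrite -(avg_flip _ _ MC) -(avg_parallel inv MC (x := partner M x)) ?pK //.
  by rewrite subrr normr0 order_error_ge0.
have n1' : (tag x, tag (partner M x)) != (tag x', tag (partner M x')) by rewrite eq_sym.
have n2' : (tag x, tag (partner M x)) != (tag (partner M x'), tag x').
  by apply: contra n2 => /eqP[-> ->].
have fb := forward_bad MS bx _ bx' n1 n2; have fb' := forward_bad MS bx' _ bx n1' n2'.
have xx' : x' != x by apply: contra n1 => /eqP->.
have xpx' : x' != partner M x by apply: contra n2 => /eqP->; rewrite pK.
(* At level 1 there cannot be two distinct bad edges, as one of them would
   survive a generic switching of the other, which leads to level 0. *)
case: k IH Sk inv => [|k] IH Sk inv.
  have far y y' : badh M y -> badh M y' -> (forall z, generic M y z -> badh (sw M y z) y') -> `|avg (uniform_value 0) M y| <= 2 * c * nongeneric_rate 1.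
    move=> by_ by' g; rewrite -[avg _ _ _]subr0.
    have -> : 0 = avg (fun=> 0) M y :> R by rewrite /avg big1 ?mulr0.
    apply: le_trans (avg_close (b := 0) Sk by_ (lexx _) _ _ _) _; last by rewrite add0r.
    - by move=> M' M'C; exact: uniform_value_bound.
    - by move=> M' _; rewrite normr0.
    - move=> z gz; have [_ S0] := level_generic Sk by_ gz.
      by have := level_num_bad S0; rewrite muln0 leqn0 sum_nat_eq0 => /forallP/(_ y')/=; rewrite (g z gz).
  rewrite /order_error (_ : 4 * c * nongeneric_rate 1 = 2 * c * nongeneric_rate 1 + 2 * c * nongeneric_rate 1); last by ring.
  apply: (le_trans (ler_normB _ _)); apply: lerD.
    by apply: (far x x') => // z g; have [] := fb z g.
  by apply: (far x' x) => // z g; have [] := fb' z g.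
have near y y' : badh M y -> (forall z, generic M y z -> badh (sw M y z) y') ->
    `|avg (uniform_value k.+1) M y - avg (fun M' => avg (uniform_value k) M' y') M y| <= order_error k + 2 * c * nongeneric_rate k.+2.
  move=> by_ g; apply: avg_close => //; first exact: order_error_ge0.
  - by move=> M' M'C; exact: uniform_value_bound.
  - by move=> M' M'C; apply: avg_bound => // *; exact: uniform_value_bound.
  - move=> z gz; have [_ S1] := level_generic Sk by_ gz.
    by rewrite distrC; apply: IH => //; exact: g.
have h1 := near x x' bx (fun z g => (fb z g).2).
have h2 := near x' x bx' (fun z g => (fb' z g).2).
have h3 := @avg_comm R n d N16 (uniform_value k) M x x' c MC xx' xpx' (@uniform_value_bound k).
have h4 : 80 * c / N%:R <= 80 * c * e ^+ 2 by rewrite ler_wpM2l ?mulr_ge0 ?inv_N_le.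
rewrite distrC in h2; rewrite /order_error -/order_error.
set a1 := avg (uniform_value k.+1) M x in h1 *; set a2 := avg (uniform_value k.+1) M x' in h2 *.
set b1 := avg _ M x in h1 h3 *; set b2 := avg _ M x' in h2 h3 *.
have -> : a1 - a2 = (a1 - b1) + (b1 - b2) + (b2 - a2) by ring.
apply: (le_trans (ler_normD _ _)); apply: (le_trans (lerD (ler_normD _ _) (lexx _))).
apply: (le_trans (lerD (lerD h1 (le_trans h3 h4)) h2)).
by rewrite [leRHS](_ : _ = order_error k + 2 * c * nongeneric_rate k.+2 + 80 * c * e ^+ 2 + (order_error k + 2 * c * nongeneric_rate k.+2)) //; ring.
Qed.

Lemma order_insensitive k M x : level k.+1 M -> badh M x -> `|avg (uniform_value k) M x - uniform_value k.+1 M| <= order_error k.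
Proof.
elim: k M x => [|k IH] M x Sk bx; rewrite (uniform_valueS Sk) distrC; apply: mean_close => //; try exact: level_has_bad Sk.
  by move=> y by_; apply: order_insensitive_pair.
by move=> y by_; apply: order_insensitive_pair.
Qed.

Section Process.
Variable rule : switching_rule d R.
Hypothesis rule_ok : is_switching_rule rule.

(** The conditional expectation of [psi], given the past, of the configuration after k
more steps from [M] with history [h]. *)
Fixpoint value (psi : matching d -> R) k h M : R := if k is k'.+1 then
  \sum_M' step_prob rule h M M' * value psi k' (rcons h M) M' else psi M.

Lemma value_no_bad psi k h M : no_bad_edges M -> value psi k.+1 h M = value psi k (rcons h M) M.
Proof.
move=> nb /=; rewrite (bigD1 M) //= /step_prob nb eqxx mul1r big1 ?addr0 // => M' M'M.
by rewrite (negbTE M'M) mul0r.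
Qed.

(** The two orientations of the second edge are the two values of [z] on it, so that a
step of the process averages [avg] over the edge chosen by the rule. *)
Lemma value_bad psi k h M : M \in Conf -> ~~ no_bad_edges M ->
  value psi k.+1 h M = \sum_e' rule h M e' * avg (value psi k (rcons h M)) M e'.1.
Proof.
move=> MC nb /=; rewrite /step_prob (negbTE nb); have [r0 rb _] := rule_ok h MC nb.
have pK := partnerK MC.
under eq_bigr do rewrite mulr_suml.
rewrite exchange_big /=; apply: eq_bigr => -[x y] _ /=.
have [->|rn] := eqVneq (rule h M (x, y)) 0; first by rewrite mul0r big1 // => M' _; rewrite !mul0r.
have xyb := rb _ rn; have /= xyM : [set x; y]%SET \in M by case/setIdP: xyb.
have yE := conf_partner_unique MC xyM; rewrite /= in xyb.
under eq_bigr do rewrite -mulrA.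
rewrite -mulr_sumr; congr (_ * _).
under eq_bigr do rewrite mulr_suml.
rewrite exchange_big /= /avg.
have -> : (2 * #|M|.-1)%:R = N%:R - 2 :> R.
  rewrite -natrB; last by apply: leq_trans N16.
  by rewrite -(card_conf MC) -subn1 mulnBr muln1 mulnC.
rewrite mulr_sumr.
transitivity (\sum_(o | (o.1 != x) && (o.1 != partner M x) && (o.2 == partner M o.1))
   (N%:R - 2)^-1 * value psi k (rcons h M) (switching M (x, y) o)).
  apply: eq_big => [[z w]|[z w] _] /=; last first.
    rewrite (bigD1 (switching M (x, y) (z, w))) //= eqxx mulr1 big1 ?addr0 // => M' ne.
    by rewrite (negbTE ne) mulr0 mul0r.
  rewrite finset.in_setD1 in_conf //; have [wE|//] := eqVneq w (partner M z); last by rewrite !andbF.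
  rewrite !andbT wE yE; apply/idP/andP => [ne|[zx zpx]].
    split; apply: contra ne => /eqP->; first by [].
    by rewrite pK finset.setUC.
  by apply/eqP => /set2_eq[][h1 _]; [rewrite h1 eqxx in zx|rewrite h1 eqxx in zpx].
rewrite (reindex_onto (fun z => (z, partner M z)) (fun o => o.1)) /=; last first.
  by move=> [z w] /= /andP[_ /eqP->].
apply: eq_big => [z|z]; first by rewrite !eqxx !andbT.
by rewrite !eqxx !andbT => /andP[zx zpx]; rewrite yE switchingE // eq_sym.
Qed.

Lemma value_bound psi k h M : (forall M, M \in Conf -> `|psi M| <= c) -> M \in Conf -> `|value psi k h M| <= c.
Proof.
move=> pb; elim: k h M => [|k IH] h M MC; first exact: pb.
have [nb|nb] := boolP (no_bad_edges M); first by rewrite value_no_bad // IH.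
rewrite value_bad //; have [r0 _ r1] := rule_ok h MC nb.
apply: (le_trans (ler_norm_sum _ _ _)).
rewrite -[leRHS]mulr1 -r1 mulr_sumr; apply: ler_sum => e' _.
rewrite normrM ger0_norm ?r0 // mulrC ler_wpM2r //.
by apply: avg_bound => // M' M'C; exact: IH.
Qed.

(** The error of [order_insensitive] and the non-generic switchings, added over k
steps. *)
Fixpoint rule_error k : R := if k is k'.+1 then rule_error k' + 2 * c * nongeneric_rate k + order_error k' else 0.

Lemma rule_error_ge0 k : 0 <= rule_error k.
Proof. elim: k => //= k IH; apply: addr_ge0 (order_error_ge0 k); exact: addr_ge0 IH (scaled_rate_ge0 _). Qed.

(** At each step the bad edge is chosen by the rule, but all choices give nearly the
same expected value, by [order_insensitive]. *)
Lemma value_close k h M : level k M -> `|value (uniform_value 0) k h M - uniform_value k M| <= rule_error k.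
Proof.
elim: k h M => [|k IH] h M Sk; first by rewrite /= subrr normr0.
have MC := level_conf Sk.
have nb : ~~ no_bad_edges M.
  by apply/negP => nb; have S0 : level 0 M; [rewrite level0 MC|have := level_uniq Sk S0].
rewrite value_bad //; have [r0 rb r1] := rule_ok h MC nb.
rewrite -[X in _ - X]mul1r -r1 mulr_suml -sumrB.
apply: (le_trans (ler_norm_sum _ _ _)).
rewrite -[leRHS]mulr1 -r1 mulr_sumr; apply: ler_sum => -[x y] _.
have [->|rn] := eqVneq (rule h M (x, y)) 0; first by rewrite !mul0r subrr normr0 mulr0.
have xyb := rb _ rn; have /= xyM : [set x; y]%SET \in M by case/setIdP: xyb.
have bx : badh M x by rewrite -badh_edge // -(conf_partner_unique MC xyM).
rewrite -mulrBr normrM ger0_norm ?r0 // mulrC ler_wpM2r //=.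
have h1 : `|avg (value (uniform_value 0) k (rcons h M)) M x - avg (uniform_value k) M x| <= rule_error k + 2 * c * nongeneric_rate k.+1.
  apply: avg_close => //; first exact: rule_error_ge0.
  - by move=> M' M'C; apply: value_bound => // *; exact: uniform_value_bound.
  - by move=> M' M'C; exact: uniform_value_bound.
  - by move=> z g; have [_ S1] := level_generic Sk bx g; exact: IH.
rewrite -(subrK (avg (uniform_value k) M x) (avg (value _ _ _) _ _)) -addrA.
by apply: (le_trans (ler_normD _ _)); apply: lerD => //; exact: order_insensitive.
Qed.

End Process.
End Insensitive.
End UniformRule.
End Operators.

(** * Means over configurations with given numbers of loops and double edges *)

Lemma le_pad (F : realFieldType) (x y z t : F) : 0 <= y -> 0 <= t -> x + z <= x + y + z + t.
Proof. by move=> ? ?; lra. Qed.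

Lemma natr_monomial (F : pzSemiRingType) (a b c k : nat) : (a * b * c ^ k)%N%:R = a%:R * b%:R * c%:R ^+ k :> F.
Proof. by rewrite natrM natrX natrM. Qed.

Section Backward.
Variables (R : realType) (n : nat) (d : 'I_n -> nat).
Local Notation H := (halfedge d).
Implicit Types (M : matching d) (x y z u : H) (i j : 'I_n).
Local Notation Conf := (configurations d).
Local Notation N := #|{: H}|.
Local Notation D := (maxdeg d).

Lemma card_badh_dups M (P : 'I_n -> 'I_n -> bool) : clean M ->
  (\sum_x (badh M x && P (tag x) (tag (partner M x))) = 2 * #|[set s in dups M | P s.1 s.2]%SET|)%N.
Proof.
move=> c.
transitivity (\sum_(x | badh M x && P (tag x) (tag (partner M x))) 1)%N.
  by rewrite [RHS]big_mkcond; apply: eq_bigr => x _; case: (_ && _).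
rewrite (partition_big (fun x => (tag x, tag (partner M x))) (mem [set s in dups M | P s.1 s.2]%SET)) /=; last first.
  by move=> x /andP[/(clean_bad c) h ?]; rewrite !inE /= h.
rewrite mulnC -sum_nat_const; apply: eq_bigr => -[i j]; rewrite inE /= => /andP[]; rewrite inE /= => /eqP e Pij.
rewrite -e /mult [LHS]big_mkcond; apply: eq_bigr => x _.
rewrite xpair_eqE; case: eqP => [xi|]; rewrite ?andbF //; case: eqP => [xj|]; rewrite ?andbF //.
by rewrite /badh xi xj e Pij.
Qed.

Lemma card_loop_halves M : M \in Conf -> clean M -> (\sum_x (tag x == tag (partner M x)) = 2 * #|loops M|)%N.
Proof.
move=> MC c; rewrite -(@card_badh_dups M (fun i j => i == j) c); apply: eq_bigr => x _.
by case: eqP; rewrite ?andbF // => e; rewrite loop_bad.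
Qed.

Lemma card_double_halves M : M \in Conf -> clean M ->
  (\sum_x (badh M x && (tag x != tag (partner M x))) = 2 * #|doubles M|)%N.
Proof. by move=> MC c; rewrite (@card_badh_dups M (fun i j => i != j) c). Qed.

(** The map [fun M => sw M x z] is an involution of the configurations in which [z]
is neither [x] nor its partner. *)
Lemma sw_exchange (B : matching d -> H -> bool) (psi : matching d -> R) :
  \sum_(M in Conf) \sum_x \sum_z (if [&& B M x, z != x & z != partner M x] then psi (sw M x z) else 0) =
  \sum_(M in Conf) psi M * (\sum_x \sum_z [&& x != z, z != partner M x & B (sw M x z) x])%:R.
Proof.
rewrite exchange_big /=.
under [RHS]eq_bigr do rewrite natr_sum mulr_sumr.
rewrite [RHS]exchange_big /=; apply: eq_bigr => x _.
under [RHS]eq_bigr do rewrite natr_sum mulr_sumr.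
rewrite exchange_big [RHS]exchange_big /=; apply: eq_bigr => z _.
rewrite (bigID (fun M => (z != x) && (z != partner M x))) /= [X in _ + X]big1 ?addr0; last first.
  by move=> M /andP[_ /negbTE ne]; rewrite andbC ne.
rewrite [RHS](bigID (fun M => (z != x) && (z != partner M x))) /= [X in _ = _ + X]big1 ?addr0; last first.
  by move=> M /andP[_ /negbTE ne]; rewrite eq_sym andbA ne mulr0.
rewrite (reindex_onto (fun M => sw M x z) (fun M => sw M x z)) /=; last first.
  by move=> M /and3P[MC zx zpx]; rewrite swK // eq_sym.
have E M : [&& sw M x z \in Conf, z != x & z != partner (sw M x z) x] && (sw (sw M x z) x z == M) =
   (M \in Conf) && ((z != x) && (z != partner M x)).
  apply/idP/idP => [/andP[/and3P[M1C zx zp1] /eqP e]|/and3P[MC zx zpx]].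
    have xz : x != z by rewrite eq_sym.
    have MC : M \in Conf by rewrite -e sw_conf.
    rewrite MC zx -e partner_sw // /switch_fun eqxx /= eq_sym; exact: partner_neq.
  have xz : x != z by rewrite eq_sym.
  rewrite sw_conf // zx swK // eqxx andbT partner_sw // /switch_fun eqxx /= eq_sym; exact: partner_neq.
apply: eq_big => [M|M]; first exact: E.
rewrite E => /and3P[MC zx zpx]; have xz : x != z by rewrite eq_sym.
rewrite swK // partner_sw // /switch_fun eqxx zx xz zpx /= [z == partner M z]eq_sym partner_neq // andbT.
by case: ifP => _; rewrite ?mulr1 ?mulr0.
Qed.

Section Step.
Variables (phi : matching d -> R) (c : R).
Hypothesis c0 : 0 <= c.
Hypothesis phi_inv : relabel_invariant phi.
Hypothesis phi_bound : forall M, M \in Conf -> `|phi M| <= c.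
Variables (A e : R).
Hypothesis Cgt0 : (0 < #|Conf|)%N.
Hypothesis N16 : (16 <= N)%N.
Hypothesis A0 : 0 <= A.
Hypothesis e0 : 0 < e.
Hypothesis hA : (pairs2 d)%:R <= A * N%:R.
Hypothesis hD : D%:R ^+ 2 <= e ^+ 2 * N%:R.
Local Notation uniform_value := (uniform_value phi).
Local Notation nongeneric_rate := (nongeneric_rate e).
Local Notation order_error := (order_error c e).
Let D0 : (0 < D)%N := maxdeg_gt0 N16.

(** [S'] is a class of configurations with one more bad edge of a given kind than [S],
and [sel] selects the m half-edges of these bad edges, so that one of them may be
switched first.  By [sw_exchange] the mean over [S'] becomes a mean over [S], weighted
by the number of switchings back; the weight is [rate] up to the mean error [err]. *)
Lemma mean_step (S S' : pred (matching d)) (sel : matching d -> H -> bool) k m (rate err : R) :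
  (forall M, S' M -> level k.+1 M) -> (forall M, S M -> level k M) ->
  (forall M x, S' M -> sel M x -> badh M x) ->
  (0 < m)%N -> (forall M, S' M -> \sum_x sel M x = m)%N ->
  (forall M x z, S' M -> sel M x -> generic M x z -> S (sw M x z)) ->
  0 <= rate ->
  Ex (fun M => (S M)%:R * `|(\sum_x \sum_z [&& x != z, z != partner M x, S' (sw M x z) & sel (sw M x z) x])%:R - rate|) <= err ->
  `|Ex (fun M => (S' M)%:R * uniform_value k.+1 M)| <=
    order_error k + 2 * c * nongeneric_rate k.+1 + 2 / N%:R * (rate * `|Ex (fun M => (S M)%:R * uniform_value k M)| + c * err).
Proof.
move=> S'k Sk selb m0 mE gS r0 errE.
pose good M := (\sum_x \sum_z [&& x != z, z != partner M x, S' (sw M x z) & sel (sw M x z) x])%N.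
pose psi M := (S M)%:R * uniform_value k M.
have psib M : M \in Conf -> `|psi M| <= c.
  by move=> MC; rewrite /psi; case: (S M); rewrite ?mul1r ?mul0r ?normr0 // uniform_value_bound.
(* the mean over the selected half-edges only, and over the switchings into S *)
pose T M := m%:R^-1 * \sum_(x | sel M x) avg psi M x.
have close M : M \in Conf -> `|(S' M)%:R * uniform_value k.+1 M - (S' M)%:R * T M| <= order_error k + 2 * c * nongeneric_rate k.+1.
  move=> MC; case S'M: (S' M); last by rewrite !mul0r subrr normr0 addr_ge0 ?order_error_ge0 ?scaled_rate_ge0.
  rewrite !mul1r distrC /T -(mE _ S'M); apply: mean_close; first by rewrite mE.
  move=> x sx; have bx := selb _ _ S'M sx; have S1 := S'k _ S'M.
  rewrite -(subrK (avg (uniform_value k) M x) (avg psi M x)) -addrA addrC.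
  apply: (le_trans (ler_normD _ _)); rewrite [leRHS]addrC.
  rewrite [leLHS]addrC; apply: lerD; last exact: order_insensitive.
  have := @avg_close R n d N16 c c0 e hD D0 k.+1 M x psi (uniform_value k) 0 S1 bx (lexx _) psib.
  rewrite add0r; apply; first by move=> M' M'C; exact: uniform_value_bound.
  by move=> z gz; rewrite /psi (gS _ _ _ S'M sx gz) mul1r subrr normr0.
have TE : Ex (fun M => (S' M)%:R * T M) = m%:R^-1 * (N%:R - 2)^-1 * Ex (fun M => psi M * (good M)%:R).
  rewrite /Ex [in RHS]mulrCA; congr (_ * _).
  rewrite -(sw_exchange (fun M x => S' M && sel M x)) mulr_sumr; apply: eq_bigr => M MC.
  rewrite /T -mulrA; case S'M: (S' M); last by rewrite mul0r big1 ?mulr0 // => x _; rewrite big1.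
  rewrite mul1r; congr (_ * _); rewrite mulr_sumr big_mkcond; apply: eq_bigr => x _ /=.
  case: (sel M x); last by rewrite big1 ?mulr0.
  by rewrite /avg big_mkcond.
have goodE : `|Ex (fun M => psi M * (good M)%:R)| <= rate * `|Ex psi| + c * err.
  have -> : Ex (fun M => psi M * (good M)%:R) = rate * Ex psi + Ex (fun M => psi M * ((good M)%:R - rate)).
    by rewrite -ExZ -ExD; apply: ExE => M _; ring.
  apply: (le_trans (ler_normD _ _)); rewrite normrM (ger0_norm r0) lerD2l.
  apply: (le_trans (Ex_norm_le _)); apply: le_trans (ler_wpM2l c0 errE); rewrite -ExZ; apply: Ex_le => M MC.
  rewrite -/(good M) /psi normrM; case: (S M); rewrite ?mul1r ?mul0r ?mulr0 ?normr0 ?mul0r //.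
  by rewrite ler_wpM2r // uniform_value_bound.
have m1 : 0 <= (m%:R^-1 : R) <= 1 by rewrite invr_ge0 ler0n invf_le1 ?ltr0n ?ler1n.
have /andP[i0 i1] := inv_N2_le R N16.
have -> : Ex (fun M => (S' M)%:R * uniform_value k.+1 M) = Ex (fun M => (S' M)%:R * uniform_value k.+1 M - (S' M)%:R * T M) + Ex (fun M => (S' M)%:R * T M).
  by rewrite -ExD; apply: ExE => M _; rewrite subrK.
apply: (le_trans (ler_normD _ _)); apply: lerD.
  apply: (le_trans (Ex_norm_le _)); rewrite -[leRHS](Ex_cst Cgt0); apply: Ex_le => M MC; exact: close.
case/andP: m1 => m1 m1'; rewrite TE normrM [X in X * _]ger0_norm ?mulr_ge0 //.
apply: ler_pM goodE; rewrite ?mulr_ge0 //.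
by rewrite -[leRHS]mul1r; apply: ler_pM.
Qed.

Local Notation F a b := (Ex (fun M => (M \in state d a b)%:R * uniform_value (a + b)%N M)).

Lemma state_bad (a b : nat) M : M \in state d a b -> (\sum_x badh M x <= 4 * (a + b))%N.
Proof. by move/state_level/level_num_bad. Qed.

Let Npos : 0 < N%:R :> R. Proof. by rewrite ltr0n (leq_trans _ N16). Qed.
Let Ninv : N%:R^-1 <= e ^+ 2. Proof. exact: inv_N_le hD D0. Qed.
Let DN : D%:R ^+ 2 / N%:R <= e ^+ 2. Proof. by rewrite ler_pdivrMr. Qed.

Lemma pairs_pow_le k : (pairs2 d ^ k)%:R * (2 / N%:R) ^+ k <= (2 * A) ^+ k :> R.
Proof.
rewrite natrX -exprMn lerXn2r ?nnegrE ?mulr_ge0 ?ler0n ?invr_ge0 //.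
apply: (@le_trans _ _ (A * N%:R * (2 / N%:R))); first by rewrite ler_wpM2r // divr_ge0.
by rewrite le_eqVlt; apply/orP; left; apply/eqP; field; rewrite gt_eqF.
Qed.

Lemma Ex_cyc3_le : Ex (fun M => (cyc3 M)%:R) <= 8 * A ^+ 3.
Proof.
apply: (le_trans (Ex_cyc3 R Cgt0 N16)); apply: (le_trans (pairs_pow_le 3)).
by rewrite exprMn -natrX.
Qed.

Lemma Ex_cyc4_le : Ex (fun M => (cyc4 M)%:R) <= 16 * A ^+ 4.
Proof.
apply: (le_trans (Ex_cyc4 R Cgt0 N16)); apply: (le_trans (pairs_pow_le 4)).
by rewrite exprMn -natrX.
Qed.

Lemma others_sum_le : (\sum_(u : H) others u)%:R <= A * N%:R :> R.
Proof. by apply: le_trans hA; rewrite ler_nat sum_others_le. Qed.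

(** [mean_step] for the loops, with weights given by [loop_count]. *)
Lemma loop_step (a b : nat) : `|F a.+1 b| <= order_error (a + b)%N + 2 * c * nongeneric_rate (a + b).+1%N +
  (2 * A * `|F a b| + c * ((24 * (a + b)%N%:R + 16 * A ^+ 3) * e ^+ 2)).
Proof.
set k := (a + b)%N.
pose err : R := 12 * k%:R * D%:R ^+ 2 + 8 * A ^+ 3.
apply: (le_trans (@mean_step (fun M => M \in state d a b) (fun M => M \in state d a.+1 b) (fun M x => tag x == tag (partner M x))
  k (2 * a.+1) (\sum_(u : H) others u)%:R err _ _ _ _ _ _ _ _)) => //.
- by move=> M /state_level.
- by move=> M /state_level.
- by move=> M x /state_level/level_conf MC /eqP e1; apply: loop_bad.
- by move=> M /stateP[MC cl <- _]; rewrite card_loop_halves //; exact/cleanP.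
- move=> M x z MS /eqP e1 g; have MC := level_conf (state_level MS).
  by have [_] := forward_loop MS (loop_bad MC (esym e1)) g e1.
- apply: (@le_trans _ _ (Ex (fun M => 12 * k%:R * D%:R ^+ 2 + (cyc3 M)%:R))); last first.
    by rewrite ExD (Ex_cst Cgt0) lerD2l Ex_cyc3_le.
  apply: Ex_le => M MC; case MS: (M \in state d a b); last first.
    by rewrite mul0r addr_ge0 ?ler0n ?mulr_ge0 ?exprn_ge0.
  have -> : (\sum_x \sum_z [&& x != z, z != partner M x, sw M x z \in state d a.+1 b & tag x == tag (partner (sw M x z) x)] = loop_switchings M a b)%N.
    apply: eq_bigr => x _; apply: eq_bigr => z _.
    case: (eqVneq x z) => //= xz; case: (eqVneq z (partner M x)) => //= zpx.
    by rewrite partner_sw // /switch_fun eqxx andbC.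
  rewrite mul1r sum_others -(loop_candidatesE MC) distrC ger0_norm; last by rewrite subr_ge0 ler_nat loop_switchings_le.
  rewrite lerBlDl.
  apply: (@le_trans _ _ (loop_switchings M a b + (12 * k * D ^ 2 + cyc3 M))%N%:R).
    rewrite ler_nat; apply: leq_trans (loop_count MC MS) _; rewrite leq_add2l leq_add2r.
    have := state_bad MS; rewrite -/k; move: (\sum_x _)%N D D0 => nb X X0 h.
    have hX : (X <= X * X)%N by rewrite leq_pmulr.
    by have h1 := leq_mul h hX; have h2 := leq_mul h (leqnn (X * X)); rewrite -mulnn; clear -h1 h2; lia.
  by rewrite natrD natrD natr_monomial.
rewrite lerD2l mulrDr; apply: lerD.
  rewrite mulrA ler_wpM2r // mulrAC ler_pdivrMr // -mulrA ler_wpM2l //; exact: others_sum_le.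
rewrite mulrCA ler_wpM2l // /err [leLHS]mulrDr [leRHS]mulrDl; apply: lerD.
  rewrite (_ : 2 / N%:R * _ = 24 * k%:R * (D%:R ^+ 2 / N%:R)); last by field; rewrite gt_eqF.
  by rewrite ler_wpM2l // mulr_ge0.
rewrite (_ : 2 / N%:R * _ = 16 * A ^+ 3 * N%:R^-1); last by field; rewrite gt_eqF.
by rewrite ler_wpM2l // mulr_ge0 ?exprn_ge0.
Qed.

(** [mean_step] for the double edges.  Here the weight is random, but close to
[double_rate] by [double_candidates_deviation]. *)
Lemma double_step (a b : nat) : `|F a b.+1| <= order_error (a + b)%N + 2 * c * nongeneric_rate (a + b).+1%N +
  (4 * A ^+ 2 * `|F a b| + c * ((24 * (a + b)%N%:R + 32 * (a + b)%N%:R ^+ 2 + 16 * A ^+ 3 + 32 * A ^+ 4) * e ^+ 2 +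
     (4 * A ^+ 2 + 16 * A ^+ 4 + 8 * A ^+ 3 + 1) * e)).
Proof.
set k := (a + b)%N; set KY := 4 * A ^+ 2 + 16 * A ^+ 4 + 8 * A ^+ 3 + 1.
pose err : R := 12 * k%:R * D%:R ^+ 2 + 16 * k%:R ^+ 2 + 8 * A ^+ 3 + 16 * A ^+ 4 + KY / 2 * (e * N%:R).
have rate0 : 0 <= double_rate R d.
  by rewrite /double_rate divr_ge0 ?sqr_ge0 // subr_ge0 ler1n (leq_trans _ N16).
rewrite addnS; apply: (le_trans (@mean_step (fun M => M \in state d a b) (fun M => M \in state d a b.+1)
  (fun M x => badh M x && (tag x != tag (partner M x)))
  k (2 * b.+1.*2) (double_rate R d) err _ _ _ _ _ _ _ _)) => //.
- by move=> M MS; have := state_level MS; rewrite addnS.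
- by move=> M /state_level.
- by move=> M x _ /andP[].
- by move=> M /stateP[MC cl _ <-]; rewrite card_double_halves //; exact/cleanP.
- move=> M x z MS /andP[bx ne] g.
  by have [_] := forward_double MS bx g ne.
- apply: (@le_trans _ _ (Ex (fun M => (12 * k%:R * D%:R ^+ 2 + 16 * k%:R ^+ 2) + (cyc3 M)%:R + (cyc4 M)%:R +
     `|(double_candidates M)%:R - double_rate R d|))); last first.
    rewrite 3!ExD (Ex_cst Cgt0) /err; apply: lerD; last exact: (double_candidates_deviation Cgt0 N16 A0 e0 hA hD).
    apply: lerD (Ex_cyc4_le); apply: lerD (Ex_cyc3_le); exact: lexx.
  apply: Ex_le => M MC; case MS: (M \in state d a b); last first.
    by rewrite mul0r !addr_ge0 ?ler0n ?mulr_ge0 ?exprn_ge0.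
  have -> : (\sum_x \sum_z [&& x != z, z != partner M x, sw M x z \in state d a b.+1 &
       badh (sw M x z) x && (tag x != tag (partner (sw M x z) x))] = double_switchings M a b)%N.
    apply: eq_bigr => x _; apply: eq_bigr => z _.
    case: (eqVneq x z) => //= xz; case: (eqVneq z (partner M x)) => //= zpx.
    by rewrite partner_sw // /switch_fun eqxx andbC andbAC andbC.
  rewrite mul1r -(subrK (double_candidates M)%:R (double_switchings M a b)%:R) -addrA.
  apply: (le_trans (ler_normD _ _)); rewrite lerD2r.
  have hb := state_bad MS; rewrite -/k in hb.
  have hu := double_count_le MC a b; have hl := double_count_ge MC MS.
  have e1 : ((12 * k * D ^ 2 + 16 * k ^ 2 + cyc3 M + cyc4 M)%N%:R : R) = 12 * k%:R * D%:R ^+ 2 + 16 * k%:R ^+ 2 + (cyc3 M)%:R + (cyc4 M)%:R.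
    by rewrite natrD natrD natrD natr_monomial natrM natrX.
  rewrite -e1 ler_norml lerNl opprB !lerBlDl -!natrD !ler_nat; move: hu hl hb.
  move: (\sum_x _)%N D => nb X hu hl hb; apply/andP; split.
    apply: (leq_trans hl); rewrite leq_add2l leq_add2r leq_add2r (leq_trans _ (leq_addr _ _)) // -mulnn.
    by have h := leq_mul hb (leqnn (X * X)); clear -h; lia.
  have h : (nb * nb <= 16 * k ^ 2)%N by have h := leq_mul hb hb; rewrite -mulnn; clear -h; lia.
  by apply: (leq_trans hu); rewrite leq_add2l; apply: (leq_trans h);
  move: (16 * k ^ 2)%N (12 * k * X ^ 2)%N => t w; rewrite -!addnA addnCA leq_addr.
rewrite lerD2l mulrDr; apply: lerD.
  rewrite mulrA ler_wpM2r //.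
  have /andP[i0 i1] := inv_card_sub_le R N16 (isT : (1 <= 7)%N).
  have s0 : 0 <= \sum_(u : H) ((others u)%:R : R) by apply: sumr_ge0 => u _; rewrite ler0n.
  have s1 : \sum_(u : H) ((others u)%:R : R) <= A * N%:R by rewrite -natr_sum; exact: others_sum_le.
  apply: (@le_trans _ _ (2 / N%:R * ((A * N%:R) ^+ 2 * (2 / N%:R)))).
    rewrite ler_wpM2l ?divr_ge0 // /double_rate; apply: ler_pM; rewrite ?sqr_ge0 //.
    by rewrite lerXn2r ?nnegrE ?mulr_ge0.
  by rewrite le_eqVlt; apply/orP; left; apply/eqP; field; rewrite gt_eqF.
rewrite mulrCA ler_wpM2l // /err [leLHS]mulrDr; apply: lerD; last first.
  by rewrite le_eqVlt; apply/orP; left; apply/eqP; field; rewrite gt_eqF.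
rewrite (_ : 2 / N%:R * _ = 24 * k%:R * (D%:R ^+ 2 / N%:R) + (32 * k%:R ^+ 2 + 16 * A ^+ 3 + 32 * A ^+ 4) * N%:R^-1); last first.
  by field; rewrite gt_eqF.
rewrite -!addrA [leRHS]mulrDl; apply: lerD; first by rewrite ler_wpM2l // mulr_ge0.
by rewrite ler_wpM2l // !addr_ge0 // mulr_ge0 ?exprn_ge0.
Qed.

(** The common worst case of [loop_step] and [double_step], iterated from level 0. *)
Fixpoint mean_error k : R := if k is k'.+1 then
  (2 * A + 4 * A ^+ 2) * mean_error k' + (order_error k' + 2 * c * nongeneric_rate k + c * ((24 * k'%:R + 32 * k'%:R ^+ 2 + 16 * A ^+ 3 + 32 * A ^+ 4) * e ^+ 2 +
     (4 * A ^+ 2 + 16 * A ^+ 4 + 8 * A ^+ 3 + 1) * e)) else 0.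

Lemma mean_error_step k (r w X : R) : 0 <= r -> r <= 2 * A + 4 * A ^+ 2 ->
  w <= (24 * k%:R + 32 * k%:R ^+ 2 + 16 * A ^+ 3 + 32 * A ^+ 4) * e ^+ 2 +
     (4 * A ^+ 2 + 16 * A ^+ 4 + 8 * A ^+ 3 + 1) * e -> 0 <= X -> X <= mean_error k ->
  order_error k + 2 * c * nongeneric_rate k.+1 + (r * X + c * w) <= mean_error k.+1.
Proof.
move=> r0 r1 w1 X0 X1; rewrite addrCA; apply: lerD; first exact: ler_pM.
by rewrite lerD2l ler_wpM2l.
Qed.

(** Loops and double edges are removed one kind after the other; all means are
controlled by the mean over level 0. *)
Lemma state_mean_bound (a b : nat) : Ex (fun M => (M \in state d 0 0)%:R * phi M) = 0 -> `|F a b| <= mean_error (a + b)%N.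
Proof.
move=> F00; have {}F00 : F 0 0 = 0.
  rewrite -[RHS]F00; apply: ExE => M MC; case MS: (M \in _); rewrite ?mul0r //.
  by have /= -> := state_level MS.
elim: a => [|a IH].
  elim: b => [|b IH]; first by rewrite F00 normr0.
  rewrite addnS; apply: (le_trans (double_step 0 b)); rewrite add0n; apply: mean_error_step => //.
    by rewrite mulr_ge0 ?exprn_ge0.
  by rewrite lerDr mulr_ge0.
rewrite addSn; apply: (le_trans (loop_step a b)); apply: mean_error_step => //.
- by rewrite mulr_ge0.
- by rewrite lerDl mulr_ge0 ?exprn_ge0.
- rewrite -[leLHS]addr0; apply: lerD; last by rewrite mulr_ge0 ?(ltW e0) // !addr_ge0 // mulr_ge0 ?exprn_ge0.
  by rewrite ler_wpM2r ?sqr_ge0 // le_pad // ?mulr_ge0 ?exprn_ge0 //.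
Qed.

End Step.
End Backward.

(** * Means of the process, tightness and size of the errors *)

Section Assembly.
Variables (R : realType) (n : nat) (d : 'I_n -> nat).
Local Notation H := (halfedge d).
Implicit Types (M : matching d) (x y z u : H) (i j : 'I_n).
Local Notation Conf := (configurations d).
Local Notation N := #|{: H}|.
Local Notation D := (maxdeg d).

Variables (A e : R).
Hypothesis Cgt0 : (0 < #|Conf|)%N.
Hypothesis N16 : (16 <= N)%N.
Hypothesis A0 : 0 <= A.
Hypothesis e0 : 0 < e.
Hypothesis hA : (pairs2 d)%:R <= A * N%:R.
Hypothesis hD : D%:R ^+ 2 <= e ^+ 2 * N%:R.
Let D0 : (0 < D)%N := maxdeg_gt0 N16.
Let Npos : 0 < N%:R :> R. Proof. by rewrite ltr0n (leq_trans _ N16). Qed.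

Lemma level_states k M : (level k M : nat) = (\sum_(a < k.+1) (M \in state d a (k - a)))%N.
Proof.
have [Sk|nS] := boolP (level k M).
  have [a [b [MS abk]]] := levelP Sk.
  have ak : (a < k.+1)%N by rewrite ltnS -abk leq_addr.
  have bE : (k - a)%N = b by rewrite -abk addKn.
  rewrite (bigD1 (Ordinal ak)) //= bE MS big1 // => a' ne.
  apply/eqP; rewrite eqb0; apply: contra ne => /stateP[_ _ a'E _].
  by apply/eqP/val_inj; rewrite /= -a'E; case/stateP: MS.
rewrite big1 // => a _; apply/eqP; rewrite eqb0; apply: contra nS => /state_level.
by rewrite subnKC // -ltnS.
Qed.

Section Value.
Variables (phi : matching d -> R) (c : R).
Hypothesis c0 : 0 <= c.
Hypothesis phi_inv : relabel_invariant phi.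
Hypothesis phi_bound : forall M, M \in Conf -> `|phi M| <= c.
Variable rule : switching_rule d R.
Hypothesis rule_ok : is_switching_rule rule.

(** The set of configurations of level k is the disjoint union of those with a loops
and k - a double edges. *)
Lemma level_value_le k : Ex (fun M => (M \in state d 0 0)%:R * phi M) = 0 ->
  `|Ex (fun M => (level k M)%:R * value rule (uniform_value phi 0) k [::] M)| <= rule_error c e k + k.+1%:R * mean_error c A e k.
Proof.
move=> phi0.
have -> : Ex (fun M => (level k M)%:R * value rule (uniform_value phi 0) k [::] M) =
  Ex (fun M => (level k M)%:R * (value rule (uniform_value phi 0) k [::] M - uniform_value phi k M)) +
  \sum_(a < k.+1) Ex (fun M => (M \in state d a (k - a))%:R * uniform_value phi k M).
  rewrite -Ex_sum -ExD; apply: ExE => M MC.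
  by rewrite -mulr_suml -natr_sum -level_states mulrBr subrK.
apply: (le_trans (ler_normD _ _)); apply: lerD.
  apply: (le_trans (Ex_norm_le _)); rewrite -[leRHS](Ex_cst Cgt0); apply: Ex_le => M MC.
  case Sk: (level k M); rewrite ?mul0r ?normr0 ?mul1r; first exact: value_close.
  exact: rule_error_ge0.
apply: (le_trans (ler_norm_sum _ _ _)).
apply: (@le_trans _ _ (\sum_(a < k.+1) mean_error c A e k)); last by rewrite sumr_const card_ord mulr_natl.
apply: ler_sum => a _.
have ak : (a + (k - a) = k)%N by rewrite subnKC // -ltnS.
have := @state_mean_bound R n d phi c c0 phi_inv phi_bound A e Cgt0 N16 A0 e0 hA hD a (k - a)%N phi0.
by rewrite ak.
Qed.

(** The probability, up to the factor 2 c, that a switching is not generic at one of k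
steps. *)
Fixpoint constant_error k : R := if k is k'.+1 then constant_error k' + 2 * c * nongeneric_rate e k else 0.

Lemma constant_error_ge0 k : 0 <= constant_error k.
Proof. by elim: k => //= k IH; rewrite addr_ge0 // scaled_rate_ge0. Qed.

Lemma uniform_value_constant k M : (forall M, M \in Conf -> phi M = c) -> level k M -> `|uniform_value phi k M - c| <= constant_error k.
Proof.
move=> pc; elim: k M => [|k IH] M Sk.
  by rewrite /= Sk pc ?subrr ?normr0 // (level_conf Sk).
rewrite (uniform_valueS _ Sk); apply: mean_close; first exact: level_has_bad Sk.
move=> x bx; have MC := level_conf Sk.
have -> : c = avg (fun=> c) M x.
  rewrite /avg (eq_bigr (fun=> c * 1)); last by move=> *; rewrite mulr1.
  rewrite -mulr_sumr card_others // mulrCA mulVf ?mulr1 //.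
  by rewrite subr_eq0 eqr_nat; apply/eqP => h; move: N16; rewrite h.
apply: avg_close => //; first exact: constant_error_ge0.
- by move=> M' M'C; exact: uniform_value_bound.
- by move=> M' _; rewrite ger0_norm.
- by move=> z gz; have [_ S1] := level_generic Sk bx gz; exact: IH.
Qed.

(** If [phi] is the constant c, then [value] is c times the probability that k steps
lead to a simple configuration. *)
Lemma value_cst_ge k M : (forall M, M \in Conf -> phi M = c) -> level k M ->
  c - (rule_error c e k + constant_error k) <= value rule (uniform_value phi 0) k [::] M.
Proof.
move=> pc Sk; have h1 := value_close N16 c0 phi_inv phi_bound hD D0 rule_ok [::] Sk.
have h2 := uniform_value_constant pc Sk.
move: h1 h2; rewrite !ler_distl => /andP[h1 _] /andP[h2 _].
rewrite opprD addrA; apply: le_trans h1; rewrite addrAC lerD2r //.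
Qed.
End Value.

(** Markov's inequality for the number of bad half-edges; configurations that are not
clean are excluded by the first moments of triple edges and double loops. *)
Lemma level_tight K : Ex (fun M => (~~ [exists k : 'I_K.+1, level k M])%:R) <=
  (2 * A + 4 * A ^+ 2) / (2 * K.+1%:R) + (4 * A + 8 * A ^+ 2) * e ^+ 2.
Proof.
have DN : D%:R ^+ 2 / N%:R <= e ^+ 2 by rewrite ler_pdivrMr.
apply: (@le_trans _ _ (Ex (fun M => (2 * K.+1%:R)^-1 * ((num_loops M)%:R + (num_par M)%:R) +
   ((num_par_loops M)%:R + (num_triples M)%:R)))).
  apply: Ex_le => M MC.
  have K0 : 0 < 2 * K.+1%:R :> R by rewrite mulr_gt0 // ltr0n.
  have [cl|ncl] := boolP (clean M); last first.
    apply: (@le_trans _ _ 1); first by rewrite lern1 leq_b1.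
    rewrite -[leLHS]add0r; apply: lerD; first by rewrite mulr_ge0 ?invr_ge0 ?(ltW K0) // addr_ge0.
    by rewrite -natrD ler1n not_clean.
  apply: (@le_trans _ _ ((2 * K.+1%:R)^-1 * ((num_loops M)%:R + (num_par M)%:R))); last by rewrite lerDl addr_ge0.
  case: existsP => /= [_|nk]; first by rewrite mulr_ge0 ?invr_ge0 ?(ltW K0) // addr_ge0.
  rewrite mulrC ler_pdivlMr // mul1r -natrD -natrM ler_nat.
  apply: leq_trans (num_bad_le MC); rewrite nb_card card_badh // leq_mul2l /=.
  have [a [b [MS <-]]] := clean_state MC cl; rewrite ltnNge; apply/negP => abK.
  have abK' : (a + b < K.+1)%N by rewrite ltnS (leq_trans _ abK) // leq_add2l -addnn leq_addr.
  by apply: nk; exists (Ordinal abK'); exact: state_level.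
rewrite ExD ExZ !ExD; apply: lerD.
  rewrite mulrC ler_wpM2r ?invr_ge0 ?mulr_ge0 //; apply: lerD.
    apply: (le_trans (Ex_num_loops R Cgt0 N16)); have := @pairs_pow_le R n d A N16 A0 hA 1.
    by rewrite expn1.
  apply: (le_trans (Ex_num_par R Cgt0 N16)); apply: (le_trans (@pairs_pow_le R n d A N16 A0 hA 2)).
  by rewrite exprMn -natrX.
have P0 : 0 <= (pairs2 d)%:R :> R by rewrite ler0n.
have D00 : 0 <= D%:R ^+ 2 :> R by rewrite sqr_ge0.
have AN : 0 <= A * N%:R by rewrite mulr_ge0.
rewrite [leRHS]mulrDl; apply: lerD.
  apply: (le_trans (Ex_num_par_loops R Cgt0 N16)).
  rewrite -mulnA mulnn natrM natrX.
  apply: (@le_trans _ _ (A * N%:R * D%:R ^+ 2 * (2 / N%:R) ^+ 2)).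
    by rewrite ler_wpM2r ?sqr_ge0 // ler_wpM2r.
  rewrite (_ : _ * (2 / N%:R) ^+ 2 = 4 * A * (D%:R ^+ 2 / N%:R)); last by field; rewrite gt_eqF.
  by rewrite ler_wpM2l // mulr_ge0.
apply: (le_trans (Ex_num_triples R Cgt0 N16)).
rewrite natrX natrM exprMn.
apply: (@le_trans _ _ ((A * N%:R) ^+ 2 * D%:R ^+ 2 * (2 / N%:R) ^+ 3)).
  rewrite ler_wpM2r ?exprn_ge0 ?divr_ge0 // ler_wpM2r // lerXn2r ?nnegrE //.
rewrite (_ : _ * (2 / N%:R) ^+ 3 = 8 * A ^+ 2 * (D%:R ^+ 2 / N%:R)); last by field; rewrite gt_eqF.
by rewrite ler_wpM2l // mulr_ge0 ?exprn_ge0.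
Qed.
End Assembly.

Section LinearBounds.
Variables (R : realType) (c A : R).
Hypothesis (c0 : 0 <= c) (A0 : 0 <= A).

(** Each error term tends to 0 with the ratio e of the maximum degree to sqrt N, for
any fixed number k of switchings. *)
Definition linear_bound (f : R -> R) := exists2 C : R, 0 <= C & forall e, 0 < e -> e <= 1 -> f e <= C * e.

Lemma linear_boundD f g : linear_bound f -> linear_bound g -> linear_bound (fun e => f e + g e).
Proof.
move=> [C C0 fC] [C' C'0 gC]; exists (C + C'); first exact: addr_ge0.
by move=> e e0 e1; rewrite mulrDl; apply: lerD; [exact: fC|exact: gC].
Qed.

Lemma linear_boundZ a f : 0 <= a -> linear_bound f -> linear_bound (fun e => a * f e).
Proof.
move=> a0 [C C0 fC]; exists (a * C); first exact: mulr_ge0.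
by move=> e e0 e1; rewrite -mulrA ler_wpM2l // fC.
Qed.

Lemma linear_bound_id : linear_bound id.
Proof. by exists 1 => // e _ _; rewrite mul1r. Qed.

Lemma linear_bound_sqr : linear_bound (fun e => e ^+ 2).
Proof. by exists 1 => // e e0 e1; rewrite mul1r expr2 ler_piMl // ltW. Qed.

Lemma linear_bound0 : linear_bound (fun=> 0).
Proof. by exists 0 => // e _ _; rewrite mul0r. Qed.

Lemma linear_bound_sum (I : finType) (f : I -> R -> R) : (forall i, linear_bound (f i)) ->
  linear_bound (fun e => \sum_i f i e).
Proof.
move=> h; elim: (index_enum I) => [|i s IH].
  by case: linear_bound0 => C C0 h0; exists C => // e e0 e1; rewrite big_nil; exact: h0.
by case: (linear_boundD (h i) IH) => C C0 h0; exists C => // e e0 e1; rewrite big_cons; exact: h0.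
Qed.

Lemma linear_bound_nongeneric_rate k : linear_bound (fun e => nongeneric_rate e k).
Proof. by apply: linear_boundZ linear_bound_sqr; rewrite mulr_ge0. Qed.

Lemma linear_bound_order_error k : linear_bound (fun e => order_error c e k).
Proof.
elim: k => [|k IH] /=; first by apply: linear_boundZ (linear_bound_nongeneric_rate 1); rewrite mulr_ge0.
apply: linear_boundD; last by apply: linear_boundZ linear_bound_sqr; rewrite mulr_ge0.
apply: linear_boundZ => //; apply: linear_boundD => //.
by apply: linear_boundZ (linear_bound_nongeneric_rate _); rewrite mulr_ge0.
Qed.

Lemma linear_bound_rule_error k : linear_bound (fun e => rule_error c e k).
Proof.
elim: k => [|k IH] /=; first exact: linear_bound0.
apply: linear_boundD (linear_bound_order_error k); apply: linear_boundD IH _.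
by apply: linear_boundZ (linear_bound_nongeneric_rate _); rewrite mulr_ge0.
Qed.

Lemma linear_bound_constant_error k : linear_bound (fun e => constant_error e c k).
Proof.
elim: k => [|k IH] /=; first exact: linear_bound0.
apply: linear_boundD IH _.
by apply: linear_boundZ (linear_bound_nongeneric_rate _); rewrite mulr_ge0.
Qed.

Lemma linear_bound_mean_error k : linear_bound (fun e => mean_error c A e k).
Proof.
elim: k => [|k IH] /=; first exact: linear_bound0.
have An m : 0 <= A ^+ m by rewrite exprn_ge0.
apply: linear_boundD; first by apply: linear_boundZ IH; rewrite addr_ge0 // mulr_ge0.
apply: linear_boundD.
  apply: linear_boundD (linear_bound_order_error k) _.
  by apply: linear_boundZ (linear_bound_nongeneric_rate _); rewrite mulr_ge0.
apply: linear_boundZ => //; apply: linear_boundD.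
  by apply: linear_boundZ linear_bound_sqr; rewrite !addr_ge0 // mulr_ge0 // sqr_ge0.
by apply: linear_boundZ linear_bound_id; rewrite !addr_ge0 // mulr_ge0.
Qed.

Lemma linear_bound_small f eps : linear_bound f -> 0 < eps -> exists e, [/\ 0 < e, e <= 1 & f e <= eps].
Proof.
move=> [C C0 fC] eps0; exists (Num.min 1 (eps / (C + 1))).
have C1 : 0 < C + 1 by rewrite ltr_wpDl.
have h0 : 0 < Num.min 1 (eps / (C + 1)) by rewrite lt_min ltr01 divr_gt0.
have h1 : Num.min 1 (eps / (C + 1)) <= 1 by rewrite ge_min lexx.
split=> //; apply: (le_trans (fC _ h0 h1)).
apply: (@le_trans _ _ ((C + 1) * (eps / (C + 1)))); last by rewrite mulrCA divff ?mulr1 // gt_eqF.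
by apply: ler_pM; rewrite ?(ltW h0) ?lerDl // ge_min lexx orbT.
Qed.
End LinearBounds.

(** * Simple graphs come from equally many configurations *)

Section Fibers.
Variables (n : nat) (d : 'I_n -> nat).
Local Notation H := (halfedge d).
Implicit Types (M : matching d) (x y z u : H) (i j : 'I_n) (E : {set {set 'I_n}}).
Local Notation Conf := (configurations d).

Lemma relabel_edges (pi : {perm H}) M : M \in Conf -> relabel pi M = [set (pi @: (B : {set H}))%SET | B in M]%SET.
Proof.
move=> MC; apply/setP => B; apply/idP/imsetP => [BM|[B' B'M ->]].
  have RC := relabel_conf pi MC; have [x ->] := conf_edgeP RC BM.
  rewrite -(permKV pi x) partner_relabel //; set y := (pi^-1)%g x.
  exists [set y; partner M y]%SET; first by rewrite in_conf.
  by rewrite imsetU1 imset_set1.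
have [x ->] := conf_edgeP MC B'M; rewrite imsetU1 imset_set1 in_conf ?relabel_conf //.
by rewrite partner_relabel.
Qed.

Lemma projection_relabel (pi : {perm H}) M : (forall x, tag (pi x) = tag x) -> M \in Conf ->
  projection (relabel pi M) = projection M.
Proof.
move=> pit MC; apply/ffunP => e; rewrite !ffunE relabel_edges //.
rewrite -[RHS](card_imset _ (imset_inj (@perm_inj _ pi))); congr #|pred_of_set _|.
have ends_pi (B : {set H}) : ends (pi @: B)%SET = ends B.
  apply/setP => i; apply/imsetP/imsetP => [[_ /imsetP[x xB ->] ->]|[x xB ->]].
    by exists x; rewrite ?pit.
  by exists (pi x); rewrite ?pit // imset_f.
apply/setP => B; apply/setIdP/imsetP => [[/imsetP[B' B'M ->]]|[B' /setIdP[B'M e'] ->]].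
  by rewrite ends_pi => eB'; exists B' => //; apply/setIdP.
by split; [exact: imset_f|rewrite ends_pi].
Qed.

Definition graph_of M : {set {set 'I_n}} := [set ends (B : {set H}) | B in M]%SET.
Definition fiber E : {set matching d} := [set M in Conf | no_bad_edges M && (graph_of M == E)]%SET.
Definition nbr E i : {set 'I_n} := [set j | [set i; j]%SET \in E]%SET.

Lemma not_bad_inj M x y : M \in Conf -> no_bad_edges M -> tag x = tag y ->
  tag (partner M x) = tag (partner M y) -> x = y.
Proof.
move=> MC nb e1 e2; apply/eqP; apply: contraT => xy.
by have /no_badP := nb => /(_ MC x) /negP[]; exact: mult_ge2 e1 e2.
Qed.

Lemma no_bad_loop M x : M \in Conf -> no_bad_edges M -> tag x != tag (partner M x).
Proof. by move=> MC nb; apply: not_bad_loop => //; have /no_badP := nb; exact. Qed.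

Lemma graph_ofP M x : M \in Conf -> [set tag x; tag (partner M x)]%SET \in graph_of M.
Proof. by move=> MC; rewrite -ends_pair; apply: imset_f; rewrite in_conf. Qed.

Lemma in_graph_of M s : M \in Conf -> s \in graph_of M -> exists x, s = [set tag x; tag (partner M x)]%SET.
Proof.
by move=> MC /imsetP[B BM ->]; have [x ->] := conf_edgeP MC BM; exists x; rewrite ends_pair.
Qed.

Lemma projection_graph M : M \in Conf -> no_bad_edges M -> projection M = multigraph_of_graph (graph_of M).
Proof.
move=> MC nb; apply/ffunP => e; rewrite !ffunE.
case: (boolP (val e \in graph_of M)) => [/imsetP[B BM eB]|ne]; last first.
  apply: eq_card0 => B; apply/negP => /setIdP[BM /eqP eB].
  by move: ne; rewrite -eB imset_f.
transitivity #|[set B]%SET|; last by rewrite cards1.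
congr #|pred_of_set _|; apply/setP => B'; apply/setIdP/set1P => [[B'M]|->]; last by rewrite eB.
rewrite eB; have [x ->] := conf_edgeP MC BM; have [y ->] := conf_edgeP MC B'M.
rewrite !ends_pair => /eqP/set2_eq[][e1 e2]; first by rewrite (not_bad_inj MC nb e1 e2).
have -> : y = partner M x by apply: (not_bad_inj MC nb) => //; rewrite partnerK.
by rewrite partnerK // finset.setUC.
Qed.

Lemma set2_injr (T : finType) (a b c : T) : [set a; b]%SET = [set a; c]%SET -> b = c.
Proof. by case/set2_eq => [][e1 e2] //; rewrite e2. Qed.

Lemma card_tag i : #|[set x : H | tag x == i]%SET| = d i.
Proof.
by rewrite -card_at -sum1_card [LHS]big_mkcond; apply: eq_bigr => x _; rewrite inE; case: (_ == _).
Qed.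

Lemma graph_of_simple M : M \in Conf -> no_bad_edges M -> graph_of M \in simple_graphs d.
Proof.
move=> MC nb; rewrite inE; apply/andP; split.
  by apply/forall_inP => s /(in_graph_of MC)[x ->]; rewrite cards2 no_bad_loop.
apply/forallP => i; rewrite -card_tag -(card_in_imset (f := fun x : H => [set tag x; tag (partner M x)]%SET)).
  apply/eqP; congr #|pred_of_set _|; apply/setP => s; apply/setIdP/imsetP => [[/(in_graph_of MC)[x ->]]|[x]].
    rewrite !inE => /orP[]/eqP->; first by exists x; rewrite ?inE.
    by exists (partner M x); rewrite ?inE ?partnerK // finset.setUC.
  by rewrite inE => /eqP <- ->; rewrite graph_ofP // set21.
move=> x y; rewrite !inE => /eqP xi /eqP yi; rewrite xi yi => /set2_injr e.
by apply: (not_bad_inj MC nb); rewrite ?xi ?yi.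
Qed.

Section Labels.
Variable E : {set {set 'I_n}}.
Hypothesis ES : E \in simple_graphs d.

Lemma simple_pair i j : [set i; j]%SET \in E -> i != j.
Proof.
move=> ijE; move: ES; rewrite inE => /andP[/forall_inP/(_ _ ijE) + _].
by rewrite cards2; case: (i == j).
Qed.

Lemma card_nbr_simple i : #|nbr E i| = d i.
Proof.
move: (ES); rewrite inE => /andP[/forall_inP c2 /forallP/(_ i)/eqP <-].
have inj : injective (fun j => [set i; j]%SET) by move=> j k; exact: set2_injr.
rewrite -(card_imset _ inj); congr #|pred_of_set _|; apply/setP => s; apply/imsetP/setIdP => [[j]|[sE si]].
  by rewrite inE => ijE ->; rewrite ijE set21.
have /cards2P[a [b [ab sab]]] := c2 _ sE; move: si sE; rewrite sab !inE => /orP[]/eqP <- abE.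
  by exists b; rewrite ?inE.
by exists a; rewrite ?inE finset.setUC.
Qed.

Variable t : H -> 'I_n.
Hypothesis tE : forall x, t x \in nbr E (tag x).
Hypothesis t_inj : forall x y, tag x = tag y -> t x = t y -> x = y.

Lemma label_surj i j : j \in nbr E i -> exists x, tag x = i /\ t x = j.
Proof.
move=> ji; have : j \in t @: [set x : H | tag x == i]%SET.
  have /eqP -> // : (t @: [set x : H | tag x == i])%SET == nbr E i.
  rewrite eqEcard card_nbr_simple card_in_imset ?card_tag ?leqnn ?andbT.
    by apply/fintype.subsetP => _ /imsetP[x + ->]; rewrite inE => /eqP <-.
  by move=> x y; rewrite !inE => /eqP xi /eqP yi; apply: t_inj; rewrite xi.
by case/imsetP => x; rewrite inE => /eqP xi ->; exists x.
Qed.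

Definition mate x : H := odflt x [pick y | (tag y == t x) && (t y == tag x)].

Lemma mateP x : tag (mate x) = t x /\ t (mate x) = tag x.
Proof.
rewrite /mate; case: pickP => [y /andP[/eqP ? /eqP ?]//|h].
have /label_surj[y [y1 y2]] : tag x \in nbr E (t x).
  by have := tE x; rewrite !inE finset.setUC.
by have := h y; rewrite y1 y2 !eqxx.
Qed.

Lemma mate_pairing : pairing mate.
Proof.
split=> x; have [h1 h2] := mateP x; have [h3 h4] := mateP (mate x).
  by apply: t_inj; rewrite ?h3 ?h4.
by apply/eqP => h; have := tE x; rewrite inE => /simple_pair; rewrite -h1 h eqxx.
Qed.

(** An injective labelling of the half-edges at each vertex by its neighbours in a
simple graph determines a configuration: the half-edge of i labelled j is paired
with that of j labelled i. *)
Definition config_of_labels : matching d := config_of mate.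

Lemma labels_partner x : tag (partner config_of_labels x) = t x.
Proof. by rewrite partner_config_of ?(mateP x).1 //; exact: mate_pairing. Qed.

Lemma labels_fiber : config_of_labels \in fiber E.
Proof.
have MC : config_of_labels \in Conf by apply: config_of_conf; exact: mate_pairing.
apply/setIdP; split=> //; apply/andP; split.
  apply/no_badP => // x; rewrite /badh mult_card -leqNgt.
  rewrite -(cards1 x); apply: subset_leq_card; apply/fintype.subsetP => y; rewrite !inE !labels_partner.
  by move=> /andP[/eqP h1 /eqP h2]; apply/eqP; exact: t_inj.
apply/eqP/setP => s; apply/idP/idP => [/(in_graph_of MC)[x ->]|sE].
  by rewrite labels_partner; have := tE x; rewrite inE.
move: (ES); rewrite inE => /andP[/forall_inP/(_ _ sE)/cards2P[a [b [ab sab]]] _].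
have /label_surj[x [x1 x2]] : b \in nbr E a by rewrite inE -sab.
by rewrite sab -x1 -x2 -labels_partner graph_ofP.
Qed.
End Labels.

(** A simple configuration is determined by the vertices of the partners. *)
Lemma labels_determine M M' : M \in Conf -> no_bad_edges M -> M' \in Conf ->
  (forall x, tag (partner M x) = tag (partner M' x)) -> M = M'.
Proof.
move=> MC nb M'C e; apply: conf_inj => // x; apply: (not_bad_inj MC nb) => //.
by rewrite partnerK // e partnerK.
Qed.

Lemma fiber_labels E M x : M \in fiber E -> tag (partner M x) \in nbr E (tag x).
Proof. by case/setIdP => MC /andP[_ /eqP <-]; rewrite inE graph_ofP. Qed.

(** The half-edges at each vertex are labelled by its neighbours, in order. *)
Lemma conf_nonempty E : E \in simple_graphs d -> exists M, M \in fiber E.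
Proof.
move=> ES; pose t (x : H) := nth (tag x) (enum (nbr E (tag x))) (tagged x).
have sz i : size (enum (nbr E i)) = d i by rewrite -cardE card_nbr_simple.
have tE x : t x \in nbr E (tag x).
  by rewrite -mem_enum mem_nth // sz; case: (tagged x).
have t_inj x y : tag x = tag y -> t x = t y -> x = y.
  rewrite /t; case: x y => [i a] [i' b] /= e; move: b; rewrite -e => b /eqP.
  by rewrite nth_uniq ?enum_uniq ?sz // => /eqP/val_inj ->.
by exists (config_of_labels t); exact: labels_fiber.
Qed.

(** A bijection between the neighbourhoods in [E] and in [E'] of each vertex, which
have the same size, transports the labels of a configuration over [E] to labels
for [E']. *)
Lemma fiber_le E E' : E \in simple_graphs d -> E' \in simple_graphs d -> (#|fiber E| <= #|fiber E'|)%N.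
Proof.
move=> ES E'S.
have sz i : size (enum (nbr E i)) = d i by rewrite -cardE card_nbr_simple.
have sz' i : size (enum (nbr E' i)) = d i by rewrite -cardE card_nbr_simple.
(* [th i] maps the neighbours of i in E, in their order, to those in E' *)
pose th i j := nth i (enum (nbr E' i)) (index j (enum (nbr E i))).
have th_in i j : j \in nbr E i -> th i j \in nbr E' i.
  by move=> ji; rewrite -mem_enum mem_nth // sz' -sz index_mem mem_enum.
have th_inj i j k : j \in nbr E i -> k \in nbr E i -> th i j = th i k -> j = k.
  move=> ji ki /eqP; rewrite nth_uniq ?enum_uniq ?sz' -?sz ?index_mem ?mem_enum //.
  by move=> /eqP e; rewrite -[j](nth_index i (s := enum (nbr E i))) ?mem_enum // e nth_index ?mem_enum.
pose t M x := th (tag x) (tag (partner M x)).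
have tE M : M \in fiber E -> forall x, t M x \in nbr E' (tag x).
  by move=> MF x; apply: th_in; exact: fiber_labels.
have t_inj M : M \in fiber E -> forall x y, tag x = tag y -> t M x = t M y -> x = y.
  move=> MF x y e; have hx := fiber_labels x MF; have hy := fiber_labels y MF.
  rewrite /t -e => /th_inj h; case/setIdP: (MF) => MC /andP[nb _].
  by apply: (not_bad_inj MC nb e); apply: h => //; rewrite e.
rewrite -(card_in_imset (f := fun M => config_of_labels (t M)) (D := mem (fiber E))).
  apply: subset_leq_card; apply/fintype.subsetP => _ /imsetP[M MF ->].
  by apply: labels_fiber => //; [exact: tE|exact: t_inj].
move=> M M' MF M'F e; have [MC /andP[nb _]] := setIdP MF; have [M'C _] := setIdP M'F.
apply: labels_determine => // x; apply: (th_inj (tag x)); try exact: fiber_labels.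
have h1 := labels_partner E'S (tE M MF) (t_inj M MF) x.
have h2 := labels_partner E'S (tE M' M'F) (t_inj M' M'F) x.
by rewrite -[LHS]h1 -[RHS]h2 e.
Qed.

(** All fibers have the same size by [fiber_le], so that the uniform mean over simple
configurations is the uniform mean over simple graphs. *)
Lemma simple_mean (R : realType) (phi : multigraph n -> R) : graphic d ->
  \sum_(M in Conf | no_bad_edges M)
    (phi (projection M) - #|simple_graphs d|%:R^-1 * \sum_(E in simple_graphs d) phi (multigraph_of_graph E)) = 0.
Proof.
move=> [E0 E0S]; set m := _ * _.
rewrite (partition_big graph_of (mem (simple_graphs d))) /=; last first.
  by move=> M /andP[MC nb]; exact: graph_of_simple.
rewrite (eq_bigr (fun E => (phi (multigraph_of_graph E) - m) * #|fiber E0|%:R)); last first.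
  move=> E ES; rewrite (eq_bigl (mem (fiber E))); last first.
    by move=> M; rewrite /= [RHS]finset.in_set andbA.
  rewrite (eq_bigr (fun=> (phi (multigraph_of_graph E) - m) * 1)); last first.
    by move=> M /setIdP[MC /andP[nb /eqP e]]; rewrite projection_graph // e mulr1.
  rewrite -mulr_sumr sumr_const; congr (_ * _%:R).
  by apply/eqP; rewrite eqn_leq !fiber_le.
rewrite -mulr_suml sumrB sumr_const -[m *+ _]mulr_natl /m mulrA divff ?mul1r ?subrr ?mul0r //.
by rewrite pnatr_eq0 -lt0n; apply/card_gt0P; exists E0.
Qed.
End Fibers.

Local Open Scope classical_set_scope.
Local Open Scope ring_scope.

(** * The law of a run *)

Section FiniteValued.
Variables (disp : measure_display) (Omega : measurableType disp) (R : realType).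
Variable P : probability Omega R.
Implicit Types (A B : set Omega).

Definition Pr A : R := fine (P A).

Definition measurable_values (T : finType) (X : Omega -> T) := forall x, measurable (X @^-1` [set x]).

Lemma PrE A : measurable A -> (Pr A)%:E = P A.
Proof. by move=> mA; rewrite fineK // fin_num_measure. Qed.

Lemma Pr_ge0 A : 0 <= Pr A.
Proof. by rewrite fine_ge0. Qed.

Lemma Pr_le A B : measurable A -> measurable B -> A `<=` B -> Pr A <= Pr B.
Proof. by move=> mA mB AB; rewrite -lee_fin !PrE // le_measure ?inE. Qed.

Lemma Pr_setU A B : measurable A -> measurable B -> Pr (A `|` B) <= Pr A + Pr B.
Proof.
move=> mA mB; rewrite -lee_fin EFinD !PrE //; last exact: measurableU.
by apply: measureU2.
Qed.

Lemma Pr_setT : Pr setT = 1.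
Proof. by rewrite /Pr probability_setT. Qed.

Variables (T : finType) (X : Omega -> T).
Hypothesis mX : measurable_values X.

Lemma measurable_pred (Q : T -> Prop) : measurable [set w | Q (X w)].
Proof.
have -> : [set w | Q (X w)] = \bigcup_(x in [set x | Q x]) (X @^-1` [set x]).
  by apply/seteqP; split=> w /= => [q|[x q ->]//]; exists (X w).
by apply: fin_bigcup_measurable => //; exact: finite_finset.
Qed.

Lemma Pr_split A : measurable A -> Pr A = \sum_x Pr (A `&` X @^-1` [set x]).
Proof.
move=> mA; apply: EFin_inj; rewrite -sumEFin PrE //.
rewrite (eq_bigr (fun x => P (A `&` X @^-1` [set x]))); last first.
  by move=> x _; rewrite PrE //; exact: measurableI.
have -> : P A = P (\bigcup_(x in [set: T]) (A `&` X @^-1` [set x])).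
  by rewrite -setI_bigcupr; congr (P _); apply/seteqP; split=> w /= => [Aw|[]//]; split=> //; exists (X w).
rewrite measure_fin_bigcup; first last.
- by move=> x _; exact: measurableI.
- by move=> x y _ _ [w [[_ /= <-] [_ /= <-]]].
- exact: finite_finset.
rewrite (fsbigE (index_enum T)) ?index_enum_uniq //; last by move=> x _; rewrite mem_index_enum.
by apply: eq_bigl => x; rewrite in_setT.
Qed.

Lemma Pr_pred (Q : pred T) : Pr [set w | Q (X w)] = \sum_x (Q x)%:R * Pr (X @^-1` [set x]).
Proof.
rewrite (Pr_split (measurable_pred Q)); apply: eq_bigr => x _; case: (boolP (Q x)) => qx.
  by rewrite mul1r; congr Pr; apply/seteqP; split=> w /=; [case|move=> ->].
rewrite mul0r (_ : _ `&` _ = set0) /Pr ?measure0 //.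
by apply/seteqP; split=> w //= [+ e]; rewrite e (negbTE qx).
Qed.

Lemma expectation_finite (h : T -> R) : 'E_P[fun w => h (X w)]%E = (\sum_x h x * Pr (X @^-1` [set x]))%:E.
Proof.
rewrite expectation.unlock.
under eq_integral => w _.
  rewrite (_ : (h (X w))%:E = \sum_(x : T) (h x)%:E * (\1_(X @^-1` [set x]) w)%:E)%E; last first.
    rewrite (bigD1 (X w)) //= big1 ?addr0.
      by rewrite indicE mem_set // mule1.
    by move=> x xw; rewrite indicE memNset ?mule0 //= => /eqP; rewrite eq_sym (negbTE xw).
  over.
have iX x : P.-integrable setT (EFin \o \1_(X @^-1` [set x])).
  by apply: integrable_indic => //; rewrite ltey_eq fin_num_measure.
rewrite integral_sum //; last by move=> x; apply: integrableZl => //; exact: iX.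
rewrite -sumEFin; apply: eq_bigr => x _.
rewrite (integralZl measurableT (iX x)) EFinM PrE //; congr (_ * _)%E.
by rewrite (integral_indic P measurableT (mX x)) setIT.
Qed.
End FiniteValued.

Lemma first_timeP (Q : nat -> Prop) k : first_time Q = k <->
  (Q k /\ forall j, Q j -> (k <= j)%N) \/ (k = 0%N /\ forall j, ~ Q j).
Proof.
rewrite /first_time; set S := [set k | _].
have [[k0 Sk0]|S0] := pselect (exists k0, S k0); last first.
  have Sn j : ~ Q j.
    move=> Qj; apply: S0; have ex : exists j, `[< Q j >] by exists j; exact/asboolP.
    exists (ex_minn ex); rewrite /S /=; case: ex_minnP => m /asboolP Qm h.
    by split=> // i Qi; apply: h; exact/asboolP.
  split=> [<-|[[Qk _]|[-> _]]]; first 1 last.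
  - by case: (Sn _ Qk).
  - by case: xgetP => // x _ [Qx _]; case: (Sn _ Qx).
  right; split=> //; case: xgetP => // x _ [Qx _]; case: (Sn _ Qx).
split=> [<-|].
  by left; exact: (xgetPex 0%N (ex_intro _ _ Sk0)).
case=> [[Qk kl]|[_ Qn]]; last by case: (Qn k0); case: Sk0.
apply: (xget_unique _ (conj Qk kl)) => j [Qj jl].
by apply/eqP; rewrite eqn_leq jl // kl.
Qed.

Section Run.
Variables (disp : measure_display) (Omega : measurableType disp) (R : realType).
Variable P : probability Omega R.
Variables (n : nat) (d : 'I_n -> nat) (rule : switching_rule d R).
Variable Gam : nat -> nat -> Omega -> matching d.
Hypothesis process : switching_process P rule Gam.
Local Notation Pr := (Pr P).
Local Notation Conf := (configurations d).
Implicit Types (M x y : matching d).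

Lemma measurable_Gam r k : measurable_values (Gam r k).
Proof. by move=> M; case: process => h _; exact: h. Qed.

Definition path_event (m : nat -> matching d) K := [set w | forall k, (k <= K)%N -> Gam 0 k w = m k].

Lemma path_eventS m K : path_event m K.+1 = path_event m K `&` Gam 0 K.+1 @^-1` [set m K.+1].
Proof.
apply/seteqP; split=> [w h|w [h1 h2] k].
  by split=> [k kK|]; apply: h => //; rewrite ltnW.
by rewrite leq_eqVlt => /orP[/eqP->//|]; exact: h1.
Qed.

Lemma path_event0 m : path_event m 0 = Gam 0 0 @^-1` [set m 0%N].
Proof. by apply/seteqP; split=> w /= h; [exact: h|case]. Qed.

Lemma measurable_path_event m K : measurable (path_event m K).
Proof.
elim: K => [|K IH]; first by rewrite path_event0; exact: measurable_Gam.
by rewrite path_eventS; apply: measurableI => //; exact: measurable_Gam.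
Qed.

Lemma path_measure m K : Pr (path_event m K) = path_prob rule m K.
Proof.
case: process => _ /(_ 1%N K (fun=> m)); rewrite big_ord1 => h; rewrite /Pr -[RHS]/(fine (_%:E)) -h.
congr (fine (P _)); apply/seteqP; split=> w /= h' => [r k|k kK]; last exact: h'.
by rewrite ltnS leqn0 => /eqP ->; exact: h'.
Qed.

Lemma path_prob_eq m m' K : (forall k, (k <= K)%N -> m k = m' k) -> path_prob rule m K = path_prob rule m' K.
Proof.
move=> h; rewrite -!path_measure; congr Pr; apply/seteqP; split=> w /= h' k kK; rewrite h' ?h //.
Qed.

Lemma path_probS m K : path_prob rule m K.+1 = path_prob rule m K * step_prob rule (mkseq m K) (m K) (m K.+1).
Proof. by rewrite /path_prob big_ord_recr /= mulrA. Qed.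

(** The definition of [value] is the Markov recursion that the path probabilities
satisfy; the history [mkseq m j] is what the rule may depend on. *)
Lemma path_value psi i j m :
  \sum_y Pr (path_event m j `&` Gam 0 (j + i)%N @^-1` [set y]) * psi y = path_prob rule m j * value rule psi i (mkseq m j) (m j).
Proof.
elim: i j m => [|i IH] j m.
  rewrite addn0 (bigD1 (m j)) //= big1 ?addr0.
    rewrite -path_measure; congr (Pr _ * _); apply/seteqP; split=> [w []//|w h]; split=> //.
    exact: h.
  move=> y yj; rewrite (_ : _ `&` _ = set0) /Pr ?measure0 ?mul0r //.
  by apply/seteqP; split=> w //= [/(_ j (leqnn _)) -> e]; rewrite e eqxx in yj.
(* the path m up to time j, prolonged by M *)
pose m' M k := if (k <= j)%N then m k else M.
have ev M : path_event (m' M) j.+1 = path_event m j `&` Gam 0 j.+1 @^-1` [set M].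
  rewrite path_eventS {2}/m' ltnn; congr (_ `&` _).
  by apply/seteqP; split=> w /= h k kj; rewrite h // /m' kj.
transitivity (\sum_M \sum_y Pr (path_event (m' M) j.+1 `&` Gam 0 (j.+1 + i)%N @^-1` [set y]) * psi y).
  rewrite exchange_big; apply: eq_bigr => y _; rewrite -mulr_suml; congr (_ * _).
  rewrite (Pr_split P (@measurable_Gam 0%N j.+1)); last by apply: measurableI; [exact: measurable_path_event|exact: measurable_Gam].
  by apply: eq_bigr => M _; rewrite ev setIAC addSnnS.
rewrite /= mulr_sumr; apply: eq_bigr => M _; rewrite IH path_probS.
have e1 k : (k <= j)%N -> m' M k = m k by rewrite /m' => ->.
have -> : mkseq (m' M) j = mkseq m j.
  by apply/eq_in_map => k; rewrite mem_iota add0n => /andP[_ kj]; rewrite e1 // ltnW.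
have -> : mkseq (m' M) j.+1 = rcons (mkseq m j) (m j).
  rewrite /mkseq -addn1 iotaD /= map_cat cats1 add0n e1 //; congr rcons.
  by apply/eq_in_map => k; rewrite mem_iota add0n => /andP[_ kj]; rewrite e1 // ltnW.
by rewrite (path_prob_eq e1) e1 // /m' ltnn mulrA.
Qed.

Lemma run_start x : Pr (Gam 0 0 @^-1` [set x]) = (x \in Conf)%:R * #|Conf|%:R^-1.
Proof.
rewrite -(path_event0 (fun=> x)) path_measure /path_prob big_ord0 mulr1.
by case: (x \in Conf); rewrite ?mul1r ?mul0r.
Qed.

Lemma run_value psi k x :
  \sum_y Pr (Gam 0 0 @^-1` [set x] `&` Gam 0 k @^-1` [set y]) * psi y =
  (x \in Conf)%:R * #|Conf|%:R^-1 * value rule psi k [::] x.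
Proof.
have := path_value psi k 0 (fun=> x); rewrite add0n path_event0 => ->; congr (_ * _).
by rewrite -path_measure path_event0 run_start.
Qed.

(** There are only finitely many initial segments of a run. *)
Lemma null_of_null_paths A K : measurable A -> (forall m, Pr (A `&` path_event m K) = 0) -> Pr A = 0.
Proof.
move=> mA; elim: K => [|K IH] A0; last first.
  apply: IH => m; pose m' M k := if (k <= K)%N then m k else M.
  rewrite (Pr_split P (@measurable_Gam 0%N K.+1)); last by apply: measurableI => //; exact: measurable_path_event.
  rewrite big1 // => M _; rewrite -[RHS](A0 (m' M)) path_eventS setIA; congr (Pr (_ `&` _ `&` _)).
    by apply/seteqP; split=> w /= h k kj; rewrite h // /m' kj.
  by rewrite /m' ltnn.
rewrite (Pr_split P (@measurable_Gam 0%N 0%N)) // big1 // => M _.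
by rewrite -[RHS](A0 (fun=> M)) path_event0.
Qed.

Lemma measurable_Gam2 r k r' k' (Q : matching d -> matching d -> Prop) : measurable [set w | Q (Gam r k w) (Gam r' k' w)].
Proof.
have -> : [set w | Q (Gam r k w) (Gam r' k' w)] =
  \bigcup_(x in [set: matching d]) ((Gam r k @^-1` [set x]) `&` [set w | Q x (Gam r' k' w)]).
  by apply/seteqP; split=> w /= => [q|[x _ [<-]]//]; exists (Gam r k w).
apply: fin_bigcup_measurable; first exact: finite_finset.
move=> x _; apply: measurableI; first exact: measurable_Gam.
exact: (measurable_pred (@measurable_Gam r' k') (Q x)).
Qed.

(** The law of the run prescribes that a configuration without bad edges is kept
almost surely. *)
Lemma stopped_null j : Pr [set w | no_bad_edges (Gam 0 j w) /\ Gam 0 j.+1 w != Gam 0 j w] = 0.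
Proof.
have mA : measurable [set w | no_bad_edges (Gam 0 j w) /\ Gam 0 j.+1 w != Gam 0 j w].
  exact: (measurable_Gam2 0 j 0 j.+1 (fun x y => no_bad_edges x /\ y != x)).
apply: (@null_of_null_paths _ j.+1 mA) => m.
have [[nb ne]|h] := pselect (no_bad_edges (m j) /\ m j.+1 != m j).
  apply/eqP; rewrite eq_le Pr_ge0 andbT; apply: (@le_trans _ _ (Pr (path_event m j.+1))).
    by apply: Pr_le; [apply: measurableI => //; exact: measurable_path_event|exact: measurable_path_event|move=> w []].
  by rewrite path_measure path_probS /step_prob nb (negbTE ne) mulr0.
rewrite (_ : _ `&` _ = set0) /Pr ?measure0 //.
apply/seteqP; split=> w //= [] => h1 h2; apply: h; move: h1.
by rewrite (h2 j) ?(h2 j.+1).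
Qed.

Definition unstable k : set Omega :=
  \big[setU/set0]_(j < k) [set w | no_bad_edges (Gam 0 j w) /\ Gam 0 j.+1 w != Gam 0 j w].

Lemma measurable_unstable k : measurable (unstable k).
Proof.
apply: bigsetU_measurable => j _.
exact: (measurable_Gam2 0 j 0 j.+1 (fun x y => no_bad_edges x /\ y != x)).
Qed.

Lemma unstable_null k : Pr (unstable k) = 0.
Proof.
rewrite /unstable; elim: k => [|k IH]; first by rewrite big_ord0 /Pr measure0.
rewrite big_ord_recr /=; apply/eqP; rewrite eq_le Pr_ge0 andbT.
apply: (le_trans (Pr_setU _ _ _)); first exact: measurable_unstable.
  exact: (measurable_Gam2 0 k 0 k.+1 (fun x y => no_bad_edges x /\ y != x)).
by rewrite IH stopped_null addr0.
Qed.

(** If the first run has no bad edge at time k, its first such time is at most k, and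
outside [unstable k] nothing changes in between. *)
Lemma switched_graph_stopped k w : no_bad_edges (Gam 0 k w) -> ~ unstable k w ->
  switched_graph Gam w = projection (Gam 0 k w).
Proof.
move=> nb st; rewrite /switched_graph.
have -> : first_time (fun r => terminates Gam r w) = 0%N.
  by apply/first_timeP; left; split=> //; exists k.
set k0 := first_time _; have [k0k nb0] : (k0 <= k)%N /\ no_bad_edges (Gam 0 k0 w).
  have /first_timeP[[h1 h2]|[_ /(_ _ nb)//]] := erefl k0.
  by split=> //; exact: h2.
congr projection.
have step j : (j < k)%N -> no_bad_edges (Gam 0 j w) -> Gam 0 j.+1 w = Gam 0 j w.
  move=> jk nbj; apply: contra_notP st => /eqP ne.
  by rewrite /unstable (bigD1 (Ordinal jk)) //=; left.
have: forall i, (k0 + i <= k)%N -> Gam 0 (k0 + i)%N w = Gam 0 k0 w.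
  elim=> [|i IH]; first by rewrite addn0.
  by rewrite addnS => lt; rewrite step ?IH // ltnW.
by move/(_ (k - k0)%N); rewrite subnKC // => ->.
Qed.

Variable f : multigraph n -> R.

Definition moved (eps : R) := [set w | eps < `|f (switched_graph Gam w) - f (configuration_multigraph Gam w)|].

Lemma measurable_first_time (Q : nat -> Omega -> Prop) k : (forall j, measurable [set w | Q j w]) ->
  measurable [set w | first_time (Q^~ w) = k].
Proof.
move=> mQ.
have -> : [set w | first_time (Q^~ w) = k] =
  ([set w | Q k w] `&` \bigcap_(j in [set j | ~~ (k <= j)%N]) ~` [set w | Q j w]) `|`
  ([set w | k = 0%N] `&` \bigcap_(j in [set: nat]) ~` [set w | Q j w]).
  apply/seteqP; split=> w /=; rewrite first_timeP.
    case=> [[Qk h]|[-> h]]; [left|right]; split=> //; last by move=> j _ /=; exact: h.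
    by move=> j /= /negP kj Qj; apply: kj; exact: h.
  case=> [[Qk h]|[-> h]]; [left|right]; split=> //; last by move=> j; exact: h.
  by move=> j Qj; apply: contraT => kj; case: (h j kj).
apply: measurableU; apply: measurableI => //.
- by apply: bigcap_measurableType => j _; exact: measurableC.
- have [e|ne] := pselect (k = 0%N).
    by rewrite (_ : [set _ | _] = setT) //; apply/seteqP; split.
  by rewrite (_ : [set _ | _] = set0) //; apply/seteqP; split.
- by apply: bigcap_measurableType => j _; exact: measurableC.
Qed.

(** The outcome is read off at a random run and a random time, each of which takes
countably many values on measurable sets. *)
Lemma measurable_moved eps : measurable (moved eps).
Proof.
have mk r k : measurable [set w | first_time (fun k => no_bad_edges (Gam r k w)) = k].
  apply: (@measurable_first_time (fun k w => no_bad_edges (Gam r k w))) => j.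
  exact: (measurable_pred (@measurable_Gam r j) (fun M => no_bad_edges M)).
have mr r : measurable [set w | first_time (fun r => terminates Gam r w) = r].
  apply: (@measurable_first_time (fun r w => terminates Gam r w)) => j.
  rewrite (_ : [set _ | _] = \bigcup_k [set w | no_bad_edges (Gam j k w)]); last first.
    by apply/seteqP; split=> w /= [k h]; [exists k|move=> h'; exists k].
  by apply: bigcupT_measurable => k; exact: (measurable_pred (@measurable_Gam j k) (fun M => no_bad_edges M)).
have -> : moved eps = \bigcup_r \bigcup_k (
   [set w | first_time (fun r => terminates Gam r w) = r] `&`
   ([set w | first_time (fun k => no_bad_edges (Gam r k w)) = k] `&`
   [set w | eps < `|f (projection (Gam r k w)) - f (projection (Gam 0 0 w))|])).
  apply/seteqP; split=> w /=.
    move=> h; exists (first_time (fun r => terminates Gam r w)) => //.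
    by exists (first_time (fun k => no_bad_edges (Gam (first_time (fun r => terminates Gam r w)) k w))).
  by move=> [r _ [k _ [<- [<- h]]]].
apply: bigcupT_measurable => r; apply: bigcupT_measurable => k.
apply: measurableI => //; apply: measurableI => //.
exact: (measurable_Gam2 r k 0 0 (fun x y => eps < `|f (projection x) - f (projection y)|)).
Qed.

(** The set on the left is contained in [moved eps], up to the null set [unstable k]. *)
Lemma stopped_moved_le k eps :
  Pr [set w | no_bad_edges (Gam 0 k w) && (eps < `|f (projection (Gam 0 k w)) - f (projection (Gam 0 0 w))|)]
  <= Pr (moved eps).
Proof.
rewrite -[leRHS]addr0 -(unstable_null k).
apply: (le_trans _ (Pr_setU P (measurable_moved eps) (measurable_unstable k))).
apply: Pr_le; last 1 first.
- move=> w /= /andP[nb h]; have [u|u] := pselect (unstable k w); [by right|left].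
  by rewrite /moved /= (switched_graph_stopped nb u).
- exact: (measurable_Gam2 0 k 0 0 (fun x y => no_bad_edges x && (eps < `|f (projection x) - f (projection y)|))).
- by apply: measurableU; [exact: measurable_moved|exact: measurable_unstable].
Qed.
End Run.

(** * Comparison of means at a fixed number of vertices *)

Lemma pairs2_degrees n (d : 'I_n -> nat) : pairs2 d = (\sum_i d i ^ 2)%N.
Proof.
rewrite /pairs2.
transitivity (\sum_(x : halfedge d) d (tag x))%N.
  by apply: eq_bigr => x _; rewrite -(card_at d (tag x)); apply: eq_bigr => y _; rewrite eq_sym.
transitivity (\sum_(x : halfedge d) \sum_i (tag x == i) * d i)%N.
  apply: eq_bigr => x _; rewrite (bigD1 (tag x)) //= eqxx mul1n big1 ?addn0 // => i.
  by rewrite eq_sym => /negbTE ->.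
rewrite exchange_big; apply: eq_bigr => i _.
by rewrite -big_distrl /= card_at mulnn.
Qed.

Section FiniteSize.
Variables (disp : measure_display) (Omega : measurableType disp) (R : realType).
Variable P : probability Omega R.
Variables (n : nat) (d : 'I_n -> nat) (rule : switching_rule d R).
Variable Gam : nat -> nat -> Omega -> matching d.
Hypothesis rule_ok : is_switching_rule rule.
Hypothesis process : switching_process P rule Gam.
Hypothesis d_graphic : graphic d.
Local Notation Conf := (configurations d).
Local Notation N := #|{: halfedge d}|.
Local Notation Pr := (Pr P).
Implicit Types (M x y : matching d).

Variables (A e : R).
Hypothesis N16 : (16 <= N)%N.
Hypothesis A0 : 0 <= A.
Hypothesis e0 : 0 < e.
Hypothesis hA : (\sum_i d i ^ 2)%:R <= A * N%:R :> R.
Hypothesis hD : (\max_i d i)%:R ^+ 2 <= e ^+ 2 * N%:R :> R.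

Lemma Cgt0 : (0 < #|Conf|)%N.
Proof.
have [E /conf_nonempty[M /setIdP[MC _]]] := d_graphic.
by apply/card_gt0P; exists M.
Qed.

Let hA' : (pairs2 d)%:R <= A * N%:R :> R. Proof. by rewrite pairs2_degrees. Qed.
Let D0 : (0 < maxdeg d)%N := maxdeg_gt0 N16.

(** The law of the initial configuration of a run is uniform. *)
Lemma Ex_run (F : matching d -> R) : Ex F = \sum_x Pr (Gam 0 0 @^-1` [set x]) * F x.
Proof.
rewrite /Ex mulr_sumr big_mkcond; apply: eq_bigr => x _; rewrite (run_start process).
by case: (x \in Conf); rewrite ?mul1r ?mul0r.
Qed.

Variables (f : multigraph n -> R) (g : R -> R) (C : R).
Hypothesis gC : forall t, `|g t| <= C.
Local Notation F M := (f (projection M)).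
Let C0 : 0 <= C. Proof. exact: le_trans (gC 0). Qed.

Definition simple_average : R :=
  #|simple_graphs d|%:R^-1 * \sum_(E in simple_graphs d) g (f (multigraph_of_graph E)).

Definition centered M := g (F M) - simple_average.

Lemma simple_average_bound : `|simple_average| <= C.
Proof.
have S0 : 0 < #|simple_graphs d|%:R :> R by have [E ES] := d_graphic; rewrite ltr0n; apply/card_gt0P; exists E.
rewrite /simple_average mulrC normrM [`|_^-1|]gtr0_norm ?invr_gt0 // ler_pdivrMr //.
apply: (le_trans (ler_norm_sum _ _ _)); apply: (@le_trans _ _ (\sum_(E in simple_graphs d) C)).
  exact: ler_sum.
by rewrite sumr_const mulr_natr.
Qed.

Lemma centered_bound M : `|centered M| <= 2 * C.
Proof.
apply: (le_trans (ler_normB _ _)); have := gC (F M); have := simple_average_bound; lra.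
Qed.

Lemma centered_inv : relabel_invariant centered.
Proof. by move=> pi pit M MC; rewrite /centered projection_relabel. Qed.

Lemma state00 M : M \in Conf -> (M \in state d 0 0) = no_bad_edges M.
Proof.
move=> MC; transitivity (level 0 M); last by rewrite level0 MC.
apply/idP/idP => [/state_level//|/levelP[a [b [Mab /eqP]]]].
by rewrite addn_eq0 => /andP[/eqP ea /eqP eb]; move: Mab; rewrite ea eb.
Qed.

Lemma centered_mean : Ex (fun M => (M \in state d 0 0)%:R * centered M) = 0.
Proof.
rewrite /Ex; apply/eqP; rewrite mulf_eq0; apply/orP; right; apply/eqP.
have := simple_mean (fun G => g (f G)) d_graphic; rewrite big_mkcondr => h; rewrite -[RHS]h.
apply: eq_bigr => M MC; rewrite state00 //.
by case: (no_bad_edges M); rewrite ?mul1r ?mul0r.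
Qed.

Lemma joint_Pr k (Q : matching d -> matching d -> bool) : Pr [set w | Q (Gam 0 0 w) (Gam 0 k w)] =
  \sum_x \sum_y Pr (Gam 0 0 @^-1` [set x] `&` Gam 0 k @^-1` [set y]) * (Q x y)%:R.
Proof.
rewrite (Pr_split P (measurable_Gam process 0 0)); last exact: (measurable_Gam2 process 0 0 0 k (fun x y => Q x y)).
apply: eq_bigr => x _; rewrite (Pr_split P (measurable_Gam process 0 k)); last first.
  by apply: measurableI; [exact: (measurable_Gam2 process 0 0 0 k (fun x y => Q x y))|exact: (measurable_Gam process)].
apply: eq_bigr => y _; case: (boolP (Q x y)) => q; rewrite ?mulr1 ?mulr0.
  by congr Pr; apply/seteqP; split=> w /=; [case; case|case=> h1 h2; rewrite h1 h2].
rewrite (_ : _ `&` _ = set0) /Pr ?measure0 //.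
by apply/seteqP; split=> w //= [[+ e1] e2]; rewrite e1 e2 (negbTE q).
Qed.

Lemma joint_start k x : \sum_y Pr (Gam 0 0 @^-1` [set x] `&` Gam 0 k @^-1` [set y]) = Pr (Gam 0 0 @^-1` [set x]).
Proof. by rewrite [RHS](Pr_split P (measurable_Gam process 0 k)) //; exact: (measurable_Gam process). Qed.

Variables (T eta eps : R).
Hypothesis g_unif : forall s t, `|s| <= T -> `|t - s| <= eps -> `|g t - g s| <= eta.
Hypothesis eta0 : 0 <= eta.

(** The mean of the process over level k, and the probability that a run from level k
has not stopped after k steps. *)
Definition level_error k : R :=
  (rule_error (2 * C) e k + k.+1%:R * mean_error (2 * C) A e k) + 2 * C * (rule_error 1 e k + constant_error e 1 k).

(** The mean over level k of [centered] at the initial configuration is compared to its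
mean at time k, which [level_value_le] bounds.  The two values differ by at most
[eta] unless the initial value is far, it has moved by more than [eps], or the run
has not stopped at time k. *)
Lemma level_mean k : `|Ex (fun M => (level k M)%:R * centered M)| <= level_error k +
  (eta + 2 * C * (Pr [set w | T < `|f (configuration_multigraph Gam w)|] + Pr (moved Gam f eps))).
Proof.
pose p x y := Pr (Gam 0 0 @^-1` [set x] `&` Gam 0 k @^-1` [set y]).
pose q x := Pr (Gam 0 0 @^-1` [set x]).
have p0 x y : 0 <= p x y by exact: Pr_ge0.
have q0 x : 0 <= q x by exact: Pr_ge0.
have pq x : \sum_y p x y = q x by exact: joint_start.
have c0 : 0 <= 2 * C by rewrite mulr_ge0.
pose V := value rule (uniform_value centered 0) k [::].
pose W := value rule (uniform_value (fun=> 1) 0) k [::].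
have pV psi x : \sum_y p x y * psi y = q x * value rule psi k [::] x.
  by rewrite [LHS](run_value process) -(run_start process).
pose far x := (T < `|F x|).
pose jump x y := no_bad_edges y && (eps < `|F y - F x|).
(* Unless f is far at x, has moved by more than eps, or y is not simple, the
   two values differ by at most eta; in any case they differ by at most 2 C. *)
have pt x y : `|centered x - uniform_value centered 0 y| <= eta + 2 * C * ((far x)%:R + (jump x y)%:R + (1 - uniform_value (fun=> 1) 0 y)).
  rewrite /=; case Sy: (level 0 y); last first.
    rewrite !subr0; apply: (le_trans (centered_bound x)).
    rewrite -[leLHS]add0r lerD // ler_peMr // lerDr addr_ge0 //.
  have nb : no_bad_edges y by move: Sy; rewrite level0 => /andP[].
  rewrite subrr addr0 /jump nb /= /centered opprB addrA subrK.
  have big : `|g (F x) - g (F y)| <= 2 * C.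
    by apply: (le_trans (ler_normB _ _)); rewrite mulr_natl mulr2n lerD.
  have [nf|nf] := boolP (far x); first by rewrite -[leLHS]add0r lerD // (le_trans big) // ler_peMr // lerDl.
  have [j|j] := boolP (eps < _); first by rewrite -[leLHS]add0r lerD // (le_trans big) // ler_peMr // lerDr.
  by rewrite addr0 mulr0 addr0 distrC; apply: g_unif; rewrite leNgt.
have -> : Ex (fun M => (level k M)%:R * centered M) =
  Ex (fun M => (level k M)%:R * V M) + \sum_x (level k x)%:R * \sum_y p x y * (centered x - uniform_value centered 0 y).
  rewrite !Ex_run -big_split; apply: eq_bigr => x _ /=.
  under [in RHS]eq_bigr do rewrite mulrBr.
  rewrite sumrB -mulr_suml pq pV -/(V x) -/(q x); ring.
rewrite /level_error -!addrA (le_trans (ler_normD _ _)) // addrA lerD //.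
  exact: (level_value_le Cgt0 N16 A0 e0 hA' hD c0 centered_inv (fun M _ => centered_bound M) rule_ok k centered_mean).
have gap0 : 0 <= rule_error 1 e k + constant_error e 1 k.
  by rewrite addr_ge0 // ?constant_error_ge0 // rule_error_ge0.
have Wge x : level k x -> 1 - W x <= rule_error 1 e k + constant_error e 1 k.
  move=> Sx; rewrite lerBlDl -lerBlDr.
  apply: (value_cst_ge N16 hD ler01 _ _ rule_ok _ Sx) => // M _; by rewrite normr1.
apply: (le_trans (ler_norm_sum _ _ _)).
apply: (@le_trans _ _ (\sum_x (q x * (eta + 2 * C * (rule_error 1 e k + constant_error e 1 k)) +
     2 * C * (q x * (far x)%:R) + 2 * C * \sum_y p x y * (jump x y)%:R))).
  apply: ler_sum => x _; case Sx: (level k x); last first.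
    rewrite mul0r normr0 !addr_ge0 ?mulr_ge0 ?addr_ge0 ?mulr_ge0 //.
    by apply: sumr_ge0 => y _; rewrite mulr_ge0.
  rewrite mul1r; apply: (le_trans (ler_norm_sum _ _ _)).
  apply: (@le_trans _ _ (\sum_y p x y * (eta + 2 * C * ((far x)%:R + (jump x y)%:R + (1 - uniform_value (fun=> 1) 0 y))))).
    by apply: ler_sum => y _; rewrite normrM ger0_norm // ler_wpM2l.
  have -> : \sum_y p x y * (eta + 2 * C * ((far x)%:R + (jump x y)%:R + (1 - uniform_value (fun=> 1) 0 y))) =
    q x * (eta + 2 * C * (1 - W x)) + 2 * C * (q x * (far x)%:R) + 2 * C * \sum_y p x y * (jump x y)%:R.
    rewrite mulr_sumr.
    have -> : q x * (eta + 2 * C * (1 - W x)) = q x * (eta + 2 * C) - 2 * C * (q x * W x) by ring.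
    rewrite /W -pV -pq mulr_sumr !mulr_suml -sumrB mulr_sumr -!big_split /=.
    by apply: eq_bigr => y _; ring.
  by rewrite -!addrA lerD2r ler_wpM2l // lerD2l ler_wpM2l // Wge.
rewrite !big_split /= -!mulr_suml -!mulr_sumr.
have -> : \sum_x q x = 1.
  by have := Pr_split P (measurable_Gam process 0 0) measurableT; rewrite Pr_setT => ->; apply: eq_bigr => x _; rewrite setTI.
have -> : \sum_x q x * (far x)%:R = Pr [set w | T < `|f (configuration_multigraph Gam w)|].
  rewrite (Pr_pred P (measurable_Gam process 0 0) (fun M => T < `|F M|)).
  by apply: eq_bigr => x _; rewrite mulrC.
have : \sum_x \sum_y p x y * (jump x y)%:R <= Pr (moved Gam f eps).
  by rewrite -(joint_Pr k jump); exact: (stopped_moved_le process).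
move=> h; rewrite mul1r.
have := ler_wpM2l c0 h; lra.
Qed.

Lemma start_mean : Ex (fun M => g (F M)) = fine ('E_P[fun w => g (f (configuration_multigraph Gam w))]%E).
Proof.
rewrite (expectation_finite P (measurable_Gam process 0 0) (fun M => g (F M))) /= Ex_run.
by apply: eq_bigr => x _; rewrite mulrC.
Qed.

(** Summing [level_mean] over the levels up to K, and [level_tight] for the rest. *)
Lemma finite_comparison K :
  `|fine ('E_P[fun w => g (f (configuration_multigraph Gam w))]%E) - simple_average| <=
  \sum_(k < K.+1) (level_error k +
    (eta + 2 * C * (Pr [set w | T < `|f (configuration_multigraph Gam w)|] + Pr (moved Gam f eps)))) +
  2 * C * ((2 * A + 4 * A ^+ 2) / (2 * K.+1%:R) + (4 * A + 8 * A ^+ 2) * e ^+ 2).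
Proof.
rewrite -start_mean -[simple_average](Ex_cst (R := R) Cgt0).
have -> : Ex (fun M => g (F M)) - Ex (fun M : matching d => simple_average) = Ex centered.
  by rewrite -[- Ex _]mulN1r -ExZ -ExD; apply: ExE => M _; rewrite mulN1r.
have -> : Ex centered = \sum_(k < K.+1) Ex (fun M => (level k M)%:R * centered M) +
   Ex (fun M => (~~ [exists k : 'I_K.+1, level k M])%:R * centered M).
  rewrite -Ex_sum -ExD; apply: ExE => M MC; rewrite -mulr_suml -mulrDl -[LHS]mul1r; congr (_ * _).
  case: existsP => [[k Sk]|nS]; rewrite /= ?addr0.
    rewrite (bigD1 k) //= Sk big1 ?addr0 // => j jk; case Sj: (level j M) => //.
    by rewrite -val_eqE /= (level_uniq Sj Sk) eqxx in jk.
  by rewrite big1 ?add0r // => k _; case Sk: (level k M) => //; case: nS; exists k.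
apply: (le_trans (ler_normD _ _)); apply: lerD.
  by apply: (le_trans (ler_norm_sum _ _ _)); apply: ler_sum => k _; exact: level_mean.
apply: (le_trans (Ex_norm_le _)).
apply: (@le_trans _ _ (2 * C * Ex (fun M => (~~ [exists k : 'I_K.+1, level k M])%:R))).
  rewrite -ExZ; apply: Ex_le => M MC; rewrite normrM normr_nat mulrC ler_wpM2r //.
  exact: centered_bound.
by rewrite ler_wpM2l ?mulr_ge0 //; apply: level_tight => //; exact: Cgt0.
Qed.
End FiniteSize.

(** * Passage to the limit *)

Lemma uniformly_close_on_segment (R : realType) (g : R -> R) (T eta : R) : continuous g -> 0 < eta ->
  exists2 eps, 0 < eps & forall s t, `|s| <= T -> `|t - s| <= eps -> `|g t - g s| <= eta.
Proof.
move=> gc eta0; have /compact_near_coveringP := @segment_compact R (- T) T.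
move=> /(_ _ (0 : R)^'+ (fun e s => forall t, `|t - s| <= e -> `|g t - g s| <= eta) _) h.
have := h _; case=> //.
  move=> x _; have eta2 : 0 < eta / 2 by rewrite divr_gt0.
  have /cvgrPdist_lt/(_ _ eta2)/nbhs_ballP[r /= r0 hr] := gc x.
  have r2 : 0 < r / 2 by rewrite divr_gt0.
  exists (ball x (r / 2), [set e : R | e < r / 2]) => /=.
    by split; [exact: nbhsx_ballx|exact: nbhs_right_lt].
  move=> [y e] /= [xy er] t ty.
  have h1 := hr y; have h2 := hr t.
  have y1 : `|g x - g y| < eta / 2 by apply: h1; apply: (le_ball _ xy); lra.
  have t1 : `|g x - g t| < eta / 2.
    apply: h2; rewrite /ball /=; rewrite (_ : x - t = (x - y) - (t - y)); last by ring.
    apply: (le_lt_trans (ler_normB _ _)); move: xy; rewrite /ball /=; lra.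
  rewrite (_ : g t - g y = (g x - g y) - (g x - g t)); last by ring.
  apply: (le_trans (ler_normB _ _)); lra.
move=> r /= r0 hr; exists (r / 2); first by rewrite divr_gt0.
move=> s t sT; apply: hr => //=.
- by rewrite /ball /= sub0r normrN gtr0_norm ?divr_gt0 // ltr_pdivrMr //; lra.
- by rewrite divr_gt0.
- by rewrite in_itv /= -ler_norml.
Qed.

(** A continuous substitute for the indicator of the values beyond T, against which
convergence in distribution can be tested. *)
Definition ramp (R : realType) (T x : R) : R := Num.min 1 (Num.max 0 (`|x| - T)).

Lemma ramp_continuous (R : realType) (T : R) : continuous (ramp T).
Proof.
move=> x; apply: (@continuous_min _ _ (cst 1) (cst 0 \max (fun x => `|x| - T)) x); first exact: cvg_cst.
apply: (@continuous_max _ _ (cst 0) (fun x => `|x| - T) x); first exact: cvg_cst.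
by apply: cvgB; [exact: norm_continuous|exact: cvg_cst].
Qed.

Lemma ramp_ge0 (R : realType) (T x : R) : 0 <= ramp T x.
Proof. by rewrite /ramp le_min ler01 le_max lexx. Qed.

Lemma ramp_le1 (R : realType) (T x : R) : ramp T x <= 1.
Proof. by rewrite /ramp ge_min lexx. Qed.

(** A random variable is tight: the sets where |Y| is at least k decrease to the empty
set. *)
Lemma ramp_tail (disp : measure_display) (Omega : measurableType disp) (R : realType)
  (P : probability Omega R) (Y : {RV P >-> R}) (a : R) : 0 < a ->
  exists T, ('E_P[fun w => ramp T (Y w)] < a%:E)%E.
Proof.
move=> a0; pose F k := [set w | k%:R <= `|Y w|].
have mF k : measurable (F k).
  have mY : measurable_fun setT (fun w => `|Y w|) by apply: measurableT_comp.
  have := mY measurableT [set x | k%:R <= x]; rewrite setTI; apply.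
  by rewrite -set_itvcy; exact: measurable_itv.
have F0 : \bigcap_k F k = set0.
  apply/seteqP; split=> w //= /(_ (Num.trunc `|Y w|).+1 I); rewrite /F /= leNgt.
  by rewrite truncnS_gt.
have F0oo : (P (F 0%N) < +oo)%E by rewrite ltey_eq fin_num_measure.
have Fdecr : {homo F : n m / (n <= m)%N >-> (m <= n)%O}.
  by move=> m k mk; apply/subsetPset => w; apply: le_trans; rewrite ler_nat.
have mF0 : measurable (\bigcap_k F k) by rewrite F0.
have cF := @nonincreasing_cvg_mu _ _ R P F F0oo mF mF0 Fdecr.
rewrite F0 measure0 in cF.
have a0' : (0%:E < a%:E)%E by rewrite lte_fin.
have [k _ /(_ k (leqnn k)) Pk] := cF _ (open_ereal_lt' a0').
exists k%:R; apply: le_lt_trans Pk.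
have -> : (P \o F) k = 'E_P[\1_(F k)]%E by rewrite expectation.unlock integral_indic // setIT.
apply: expectation_le.
- by apply: measurableT_comp => //; apply: measurable_realfun.continuous_measurable_fun; exact: ramp_continuous.
- exact: measurable_realfun.measurable_indic.
- by move=> w; exact: ramp_ge0.
- by move=> w; rewrite indicE.
apply: aeW => w; rewrite indicE; case: (boolP (w \in F k)) => wF; first exact: ramp_le1.
rewrite /ramp ge_min; apply/orP; right; rewrite ge_max lexx /= subr_le0 leNgt; apply: contra wF => h.
by rewrite inE /F /= ltW.
Qed.

(** [ramp T] dominates the indicator of the values above T + 1. *)
Lemma far_le (disp : measure_display) (Omega : measurableType disp) (R : realType) (P : probability Omega R)
  (V : finType) (X : Omega -> V) (h : V -> R) (T : R) : measurable_values X ->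
  ((Pr P [set w | T + 1 < `|h (X w)|])%:E <= 'E_P[fun w => ramp T (h (X w))])%E.
Proof.
move=> mX; rewrite (expectation_finite P mX (fun v => ramp T (h v))) lee_fin.
rewrite (Pr_pred P mX (fun v => T + 1 < `|h v|)); apply: ler_sum => v _; rewrite ler_wpM2r ?Pr_ge0 //.
case: (boolP (T + 1 < _)) => [far|_]; last exact: ramp_ge0.
by rewrite mulr1n /ramp le_min lexx le_max; apply/orP; right; lra.
Qed.

Lemma uniform_expectation (disp : measure_display) (Omega : measurableType disp) (R : realType) (P : probability Omega R)
  (V : finType) (S : {set V}) (X : Omega -> V) (h : V -> R) : uniform_on P S X ->
  'E_P[fun w => h (X w)]%E = (#|S|%:R^-1 * \sum_(v in S) h v)%:E.
Proof.
move=> uX; have mX : measurable_values X by move=> v; have [] := uX v.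
rewrite (expectation_finite P mX); congr (_%:E); rewrite mulr_sumr big_mkcond [RHS]big_mkcond; apply: eq_bigr => v _ /=.
by rewrite /Pr (uX v).2; case: ifP; rewrite /= ?mulr0 // mulrC.
Qed.

Lemma small_tail (R : realType) (X a : R) : 0 < a -> exists K, X / (2 * K.+1%:R) <= a.
Proof.
move=> a0; exists (Num.trunc (X / a)); rewrite ler_pdivrMr ?mulr_gt0 //.
have := truncnS_gt (X / a); rewrite ltr_pdivrMr // => h.
have := mulr_ge0 (ler0n R (Num.trunc (X / a)).+1) (ltW a0); lra.
Qed.

Lemma quarters (R : realType) (a u v w z : R) : u + v <= a / 4 -> w <= a / 4 -> z <= a / 4 + a / 4 ->
  u + z + (w + v) <= a.
Proof. by move=> *; lra. Qed.

Lemma linear_bound_level_error (R : realType) (A C : R) k : 0 <= A -> 0 <= C ->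
  linear_bound (fun e => level_error A e C k).
Proof.
move=> A0 C0; have c0 : 0 <= 2 * C by rewrite mulr_ge0.
apply: linear_boundD; first apply: linear_boundD.
- exact: linear_bound_rule_error.
- by apply: linear_boundZ => //; exact: linear_bound_mean_error.
- apply: linear_boundZ => //; apply: linear_boundD; first exact: linear_bound_rule_error.
  exact: linear_bound_constant_error.
Qed.

Theorem corollary2p3 (R : realType)
  (d : forall n : nat, 'I_n -> nat)
  (d_graphic : forall n, (0 < n)%N -> graphic (d n))
  (d_sum : exists c C : R, [/\ 0 < c, 0 < C &
     \forall n \near \oo,
       c * n%:R <= (\sum_(i < n) d n i)%:R <= C * n%:R])
  (d_sum2 : exists C : R, \forall n \near \oo,
     (\sum_(i < n) d n i ^ 2)%:R <= C * n%:R)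
  (d_max : forall eps : R, 0 < eps -> \forall n \near \oo,
     (\max_(i < n) d n i)%:R <= eps * Num.sqrt n%:R)
  (f : forall n : nat, multigraph n -> R)
  (* G n is the random simple graph G(n,d) *)
  (disp' : nat -> measure_display)
  (Omega' : forall n, measurableType (disp' n))
  (P' : forall n, probability (Omega' n) R)
  (G : forall n, Omega' n -> {set {set 'I_n}})
  (G_uniform : forall n, (0 < n)%N ->
     uniform_on (P' n) (simple_graphs (d n)) (G n))
  (* the configuration model and the switched configuration model *)
  (disp : nat -> measure_display)
  (Omega : forall n, measurableType (disp n))
  (P : forall n, probability (Omega n) R)
  (rule : forall n, switching_rule (d n) R)
  (rule_ok : forall n, (0 < n)%N -> is_switching_rule (rule n))
  (Gam : forall n, nat -> nat -> Omega n -> matching (d n))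
  (Gam_process : forall n, (0 < n)%N ->
     switching_process (P n) (rule n) (Gam n))
  (f_close : cvg_in_probability0 P (fun n w =>
     f n (switched_graph (Gam n) w) - f n (configuration_multigraph (Gam n) w)))
  (dispY : measure_display) (OmegaY : measurableType dispY)
  (PY : probability OmegaY R) (Y : {RV PY >-> R})
  (Xstar_cvg : cvg_in_distribution P
     (fun n w => f n (configuration_multigraph (Gam n) w)) PY Y) :
  cvg_in_distribution P'
    (fun n w => f n (multigraph_of_graph (G n w))) PY Y.
Proof.
move=> g gc gb; have Lg := Xstar_cvg g gc gb; case: gb => C gC.
have C0 : 0 <= C by exact: le_trans (gC 0).
pose E n := 'E_(P n)[fun w => g (f n (configuration_multigraph (Gam n) w))]%E.
pose S n := simple_average (d n) (@f n) g.
have EE n : (0 < n)%N -> E n = (fine (E n))%:E.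
  by move=> n0; rewrite /E (expectation_finite (P n) (measurable_Gam (Gam_process _ n0) 0 0) (fun M => g (f n (projection M)))).
have SE n : (0 < n)%N -> 'E_(P' n)[fun w => g (f n (multigraph_of_graph (G n w)))]%E = (S n)%:E.
  by move=> n0; rewrite (uniform_expectation (fun B => g (f n (multigraph_of_graph B))) (G_uniform _ n0)).
(* It suffices that the real difference of the means tends to 0; the limit may
   then be taken among the extended reals. *)
suff h : (fun n => fine (E n) - S n) @ \oo --> (0 : R).
  rewrite -[X in _ --> X]sube0.
  have h' : (fun n => (fine (E n) - S n)%:E) @ \oo --> (0%:E : \bar R) by apply/cvg_EFin => //; near=> n.
  have lim : (fun n => E n - (fine (E n) - S n)%:E)%E @ \oo --> ('E_PY[fun w => g (Y w)] - 0)%E.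
    by apply: cvgeB => //; rewrite fin_num_adde_defl.
  apply: cvg_trans lim; apply: near_eq_cvg; near=> n.
  have n0 : (0 < n)%N by near: n; exact: nbhs_infty_gt.
  by rewrite SE // EE // -EFinB subKr.
apply/cvgrPdist_le => a a0.
have [c [C1 [c0 _ Nn]]] := d_sum; have [C2 d2] := d_sum2.
pose A := `|C2| / c.
have A0 : 0 <= A by rewrite divr_ge0 // ltW.
have a4 : 0 < a / 4 by rewrite divr_gt0.
have [K hK] := small_tail (2 * C * (2 * A + 4 * A ^+ 2)) a4.
have lb : linear_bound (fun e => \sum_(k < K.+1) level_error A e C k + 2 * C * (4 * A + 8 * A ^+ 2) * e ^+ 2).
  apply: linear_boundD; first by apply: linear_bound_sum => k; exact: linear_bound_level_error.
  have ge0 : 0 <= 2 * C * (4 * A + 8 * A ^+ 2).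
    by apply: mulr_ge0; [apply: mulr_ge0|apply: addr_ge0; rewrite mulr_ge0 ?exprn_ge0].
  exact: linear_boundZ ge0 (linear_bound_sqr R).
have [e [e0 _ he]] := linear_bound_small lb a4.
have K0 : 0 < K.+1%:R :> R by [].
pose eta := a / 4 / K.+1%:R.
have eta0 : 0 < eta by rewrite divr_gt0.
(* K.+1 errors 2 C (b + b) add up to at most a / 4 *)
pose b := a / 16 / (K.+1%:R * (C + 1)).
have C10 : 0 < C + 1 by rewrite ltr_wpDl.
have b0 : 0 < b by rewrite !divr_gt0 // mulr_gt0.
have [T hT] := ramp_tail Y b0.
have [eps eps0 g_unif] := uniformly_close_on_segment (T + 1) gc eta0.
have rb : exists C, forall x, `|ramp T x| <= C.
  by exists 1 => x; rewrite ger0_norm ?ramp_ge0 ?ramp_le1.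
have Lr := Xstar_cvg _ (@ramp_continuous R T) rb.
have Lm := f_close eps eps0.
have b0' : (0%:E < b%:E)%E by rewrite lte_fin.
near=> n.
have n0 : (0 < n)%N by near: n; exact: nbhs_infty_gt.
have NE := card_halfedge (d n).
have Nc : c * n%:R <= #|{: halfedge (d n)}|%:R :> R.
  rewrite NE; suff /andP[] : c * n%:R <= (\sum_(i < n) d n i)%:R <= C1 * n%:R by [].
  by near: n.
have n16 : 16 / c <= n%:R by near: n; exact: nbhs_infty_ger.
have N16 : (16 <= #|{: halfedge (d n)}|)%N.
  by rewrite -(ler_nat R); apply: le_trans Nc; move: n16; rewrite ler_pdivrMr // mulrC.
have hA : (\sum_i d n i ^ 2)%:R <= A * #|{: halfedge (d n)}|%:R :> R.
  apply: (@le_trans _ _ (C2 * n%:R)); first by near: n.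
  apply: (@le_trans _ _ (A * (c * n%:R))); last by rewrite ler_wpM2l.
  by rewrite /A mulrA divfK ?gt_eqF // ler_wpM2r // ler_norm.
have hD : (\max_i d n i)%:R ^+ 2 <= e ^+ 2 * #|{: halfedge (d n)}|%:R :> R.
  have h : (\max_i d n i)%:R <= e * Num.sqrt c * Num.sqrt n%:R :> R.
    by near: n; apply: d_max; rewrite mulr_gt0 // sqrtr_gt0.
  apply: (@le_trans _ _ ((e * Num.sqrt c * Num.sqrt n%:R) ^+ 2)).
    by rewrite lerXn2r ?nnegrE // !mulr_ge0 ?sqrtr_ge0 // ltW.
  by rewrite !exprMn !sqr_sqrtr // ?(ltW c0) // -mulrA ler_wpM2l // sqr_ge0.
have far : Pr (P n) [set w | T + 1 < `|f n (configuration_multigraph (Gam n) w)|] <= b.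
  rewrite -lee_fin; apply: (le_trans (far_le (P n) (fun M => f n (projection M)) T (measurable_Gam (Gam_process _ n0) 0 0))).
  apply: ltW; near: n; exact: (Lr _ (open_ereal_lt' hT)).
have mov : Pr (P n) (moved (Gam n) (@f n) eps) <= b.
  rewrite -lee_fin PrE; last exact: (measurable_moved (Gam_process _ n0)).
  apply: ltW; near: n; exact: (Lm _ (open_ereal_lt' b0')).
rewrite sub0r normrN.
rewrite /E /S; apply: (le_trans (finite_comparison (rule_ok _ n0) (Gam_process _ n0) (d_graphic _ n0) N16 A0 e0 hA hD (@f n) gC g_unif (ltW eta0) K)).
set pf := Pr _ _ in far *; set pm := Pr _ _ in mov *.
rewrite big_split /= sumr_const card_ord -[_ *+ K.+1]mulr_natl.
(* four errors of at most a / 4: the switchings, the high levels, the modulus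
   of continuity of g, and the events of probability at most b *)
have h1 : K.+1%:R * (eta + 2 * C * (pf + pm)) <= a / 4 + a / 4.
  rewrite mulrDr; apply: lerD; first by rewrite /eta mulrC divfK ?gt_eqF.
  apply: (@le_trans _ _ (K.+1%:R * (2 * (C + 1) * (b + b)))).
    rewrite ler_wpM2l // ler_pM ?mulr_ge0 ?addr_ge0 ?Pr_ge0 //; last exact: lerD.
    by rewrite ler_wpM2l // lerDl.
  rewrite /b le_eqVlt; apply/orP; left; apply/eqP; field.
  by rewrite !gt_eqF.
rewrite [X in _ + X <= _]mulrDr [X in _ + (X + _) <= _]mulrA [X in _ + (_ + X) <= _]mulrA.
exact: quarters he hK h1.
Unshelve. all: by end_near.
Qed.
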